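(* Let $z\in D\setminus\overline{\Omega}$ be a spatial point and let $\omega\subset\mathbb{R}^2$ be a bounded open inclusion shape with $\mathbf{0}\in\omega$. Assume that $u\in C^2(B_\delta(z))$ for some $\delta>0$, where $u=u(\Omega)$ is the unperturbed state. Then the first-order topological derivative of $\mathcal{J}$ at $z$ with respect to $\omega$ is given by $$d\mathcal{J}(\Omega)(z,\omega)=\frac{\alpha}{2}\left(\lambda^{\mathrm{in}}-\lambda^{\mathrm{out}}\right)\nabla u(z)^T\left[\mathcal{I}_2+\mathcal{P}^{(1)}_{\omega}\right]\nabla u(z),$$ where $\mathcal{I}_2$ is the $2\times2$ identity matrix and $\mathcal{P}^{(1)}_\omega\in\mathbb{R}^{2\times2}$ is the matrix whose $k$-th column ($k=1,2$) is $$\frac{1}{|\omega|}\int_\omega\nabla K^{(1)}_\omega[\mathbf{e}^{(k)}]\,dx .$$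
   Context: Setting. $D\subset\mathbb{R}^2$ is an open bounded Lipschitz domain, $f\in L^\infty(D)$, $\alpha>0$, $0<\lambda^{\mathrm{in}}<\lambda^{\mathrm{out}}$ are constants, and $\Omega\subset D$ is a fixed open subset. For an open set $A\subset D$ let $\lambda_A(x)=\lambda^{\mathrm{in}}$ for $x\in A$ and $\lambda_A(x)=\lambda^{\mathrm{out}}$ for $x\in D\setminus\overline{A}$. Let $u(A)\in H^1(D)$ be the unique solution of $$\int_D \alpha\lambda_A\nabla u(A)\cdot\nabla v+u(A)\,v\,dx=\int_D f v\,dx\qquad\forall v\in H^1(D).$$ Define $$J(w,A)=\frac12\int_D (w-f)^2+\alpha\lambda_A|\nabla w|^2\,dx,\qquad \mathcal{J}(A)=J(u(A),A),$$ and write $u=u(\Omega)$. $B_\delta(z)$ is the ball of radius $\delta$ centred at $z$. Topological derivative. For $\varepsilon>0$ set $\omega_\varepsilon(z)=z+\varepsilon\omega$. For $z\in D\setminus\overline{\Omega}$, the first-order topological derivative is $$d\mathcal{J}(\Omega)(z,\omega)=\lim_{\varepsilon\to0^+}\frac{1}{|\omega_\varepsilon(z)|}\left(\mathcal{J}(\Omega\cup\omega_\varepsilon(z))-\mathcal{J}(\Omega)\right),$$ where $|\cdot|$ of a set is Lebesgue measure. Corrector. Let $BL(\mathbb{R}^2)=\{v\in H^1_{\mathrm{loc}}(\mathbb{R}^2):\nabla v\in L^2(\mathbb{R}^2)^2\}$ and $\dot{BL}(\mathbb{R}^2)=BL(\mathbb{R}^2)/\mathbb{R}$ (functions modulo additive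 constants). For $\eta\in\mathbb{R}^2$, $K^{(1)}_\omega[\eta]\in\dot{BL}(\mathbb{R}^2)$ is the unique solution of $$\int_{\mathbb{R}^2}\alpha\lambda_\omega\nabla K^{(1)}_\omega[\eta]\cdot\nabla v\,dx=-\alpha(\lambda^{\mathrm{in}}-\lambda^{\mathrm{out}})\int_\omega\eta\cdot\nabla v\,dx\qquad\forall v\in BL(\mathbb{R}^2),$$ where here $\lambda_\omega=\lambda^{\mathrm{in}}$ on $\omega$ and $\lambda_\omega=\lambda^{\mathrm{out}}$ on $\mathbb{R}^2\setminus\overline{\omega}$. $(\mathbf{e}^{(1)},\mathbf{e}^{(2)})$ is the canonical basis of $\mathbb{R}^2$. *)

(* Defs.v *)
From HB Require Import structures.
From mathcomp Require Export all_boot all_order all_algebra.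
From mathcomp Require Export all_classical all_reals all_analysis.
Export Order.TTheory GRing.Theory Num.Theory.
Export numFieldNormedType.Exports.

Set Implicit Arguments.
Unset Strict Implicit.
Unset Printing Implicit Defensive.

Local Open Scope classical_set_scope.
Local Open Scope ring_scope.

(* Points of the plane are pairs of reals; gradients and directions are column
   vectors. The type measurableTypeR R is R with its Borel sigma-algebra, so
   that leb2 measures subsets of R * R. *)
Definition leb2 (R : realType)
    : {measure set (measurableTypeR R * measurableTypeR R) -> \bar R} :=
  (@lebesgue_measure R \x @lebesgue_measure R)%E.
Arguments leb2 {R}.

Definition dotv (R : realType) (a b : 'cV[R]_2) : R := (a^T *m b) 0 0.

(* The norm of R * R in the library is the max-norm, hence a separate
   definition of Euclidean balls. *)
Definition eball (R : realType) (z : R * R) (r : R) : set (R * R) :=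
  [set x | (x.1 - z.1) ^+ 2 + (x.2 - z.2) ^+ 2 < r ^+ 2].

Definition dirE (R : realType) (i : 'I_2) : R * R :=
  if i == 0 then (1, 0) else (0, 1).

Definition partial (R : realType) (i : 'I_2) (f : R * R -> R) (x : R * R) : R :=
  'D_(dirE R i) f x.

Definition grad (R : realType) (f : R * R -> R) (x : R * R) : 'cV[R]_2 :=
  \col_i partial i f x.

(* f is of class C^k on U; meant for open U, where the values of the iterated
   partial derivatives only depend on the restriction of f to U. *)
Fixpoint Ck_on (R : realType) (k : nat) (U : set (R * R)) (f : R * R -> R)
    : Prop :=
  (forall x, U x -> {for x, continuous f}) /\
  if k is k'.+1 then
    forall i : 'I_2,
      (forall x, U x -> derivable f x (dirE R i)) /\ Ck_on k' U (partial i f)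
  else True.

(* C_c^oo(U), as functions on the whole plane *)
Definition test_function (R : realType) (U : set (R * R)) (phi : R * R -> R)
    : Prop :=
  (forall k, Ck_on k setT phi) /\
  exists K : set (R * R),
    [/\ compact K, K `<=` U & forall x, ~ K x -> phi x = 0].

(* D lies locally on one side of the graph of a Lipschitz function, in
   coordinates centred at the boundary point p and rotated by the angle of
   cosine c and sine s. *)
Definition lipschitz_boundary (R : realType) (D : set (R * R)) : Prop :=
  forall p : R * R, (closure D `\` interior D) p ->
  exists c s r L : R, exists gamma : R -> R,
    [/\ c ^+ 2 + s ^+ 2 = 1, 0 < r,
        forall a b, `|gamma a - gamma b| <= L * `|a - b| &
        forall x, eball p r x ->
          let t := c * (x.1 - p.1) + s * (x.2 - p.2) in
          let y := - s * (x.1 - p.1) + c * (x.2 - p.2) in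
          D x <-> gamma t < y].

Definition bounded_lipschitz_domain (R : realType) (D : set (R * R)) : Prop :=
  [/\ open D, connected D, bounded_set D & lipschitz_boundary D].

Definition Lp_on (R : realType) (p : \bar R) (U : set (R * R))
    (v : R * R -> R) : Prop :=
  v \_ U \in Lfun leb2 p.

Definition Lp_loc (R : realType) (p : \bar R) (U : set (R * R))
    (v : R * R -> R) : Prop :=
  forall K : set (R * R), compact K -> K `<=` U -> Lp_on p K v.

Definition is_wgrad (R : realType) (U : set (R * R)) (v : R * R -> R)
    (g : R * R -> 'cV[R]_2) : Prop :=
  Lp_loc 1 U v /\
  forall i : 'I_2,
    Lp_loc 1 U (fun x => g x i 0) /\
    forall phi, test_function U phi ->
      \int[leb2]_(x in U) (v x * partial i phi x) =
      - \int[leb2]_(x in U) (g x i 0 * phi x).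

(* A choice of the weak gradient, which is determined a.e. on U when it
   exists. *)
Definition wgrad (R : realType) (U : set (R * R)) (v : R * R -> R)
    : R * R -> 'cV[R]_2 :=
  xget (fun=> 0) [set g | is_wgrad U v g].

Definition H1 (R : realType) (U : set (R * R)) (v : R * R -> R) : Prop :=
  [/\ Lp_on 2%:E U v, exists g, is_wgrad U v g &
      forall i : 'I_2, Lp_on 2%:E U (fun x => wgrad U v x i 0)].

Definition H1_loc (R : realType) (U : set (R * R)) (v : R * R -> R) : Prop :=
  [/\ Lp_loc 2%:E U v, exists g, is_wgrad U v g &
      forall i : 'I_2, Lp_loc 2%:E U (fun x => wgrad U v x i 0)].

(* Beppo-Levi space BL(R^2); an element of BL(R^2)/R is represented by any of
   its members. *)
Definition BL (R : realType) (v : R * R -> R) : Prop :=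
  H1_loc setT v /\
  forall i : 'I_2, Lp_on 2%:E setT (fun x => wgrad setT v x i 0).

(* Fixes the value lout on the boundary of A as well. *)
Definition lam (R : realType) (lin lout : R) (A : set (R * R)) (x : R * R) : R :=
  if x \in A then lin else lout.

Definition is_state (R : realType) (D : set (R * R)) (f : R * R -> R)
    (alpha lin lout : R) (A : set (R * R)) (u : R * R -> R) : Prop :=
  H1 D u /\
  forall v, H1 D v ->
    \int[leb2]_(x in D)
      (alpha * lam lin lout A x * dotv (wgrad D u x) (wgrad D v x) + u x * v x)
    = \int[leb2]_(x in D) (f x * v x).

Definition cost (R : realType) (D : set (R * R)) (f : R * R -> R)
    (alpha lin lout : R) (w : R * R -> R) (A : set (R * R)) : R :=
  2^-1 * \int[leb2]_(x in D)
    ((w x - f x) ^+ 2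
     + alpha * lam lin lout A x * dotv (wgrad D w x) (wgrad D w x)).

Definition inclusion (R : realType) (z : R * R) (omega : set (R * R)) (eps : R)
    : set (R * R) :=
  [set z + eps *: x | x in omega].

(* l is the first-order topological derivative of J at Omega, for a point z
   outside the closure of Omega *)
Definition is_topological_derivative (R : realType) (J : set (R * R) -> R)
    (Omega : set (R * R)) (z : R * R) (omega : set (R * R)) (l : R) : Prop :=
  (J (Omega `|` inclusion z omega eps) - J Omega)
    / fine (leb2 (inclusion z omega eps)) @[eps --> 0^'+] --> l.

Definition is_corrector (R : realType) (alpha lin lout : R)
    (omega : set (R * R)) (eta : 'cV[R]_2) (K : R * R -> R) : Prop :=
  BL K /\
  forall v, BL v ->
    \int[leb2]_(x in setT)
      (alpha * lam lin lout omega x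
       * dotv (wgrad setT K x) (wgrad setT v x))
    = - alpha * (lin - lout) * \int[leb2]_(x in omega) dotv eta (wgrad setT v x).

Definition polarization (R : realType) (omega : set (R * R))
    (K : 'cV[R]_2 -> R * R -> R) : 'M[R]_2 :=
  \matrix_(i, k) ((fine (leb2 omega))^-1
    * \int[leb2]_(x in omega) (wgrad setT (K (delta_mx k 0)) x i 0)).

(* Main.v *)
From HB Require Import structures.
Require Import Defs.
From mathcomp Require Import measurable_realfun ess_sup_inf lra ring.

Set Implicit Arguments.
Unset Strict Implicit.
Unset Printing Implicit Defensive.

Local Open Scope classical_set_scope.
Local Open Scope ring_scope.

(** Let S be the inclusion of size eps at z, let u be the unperturbed and u_S the
    perturbed state, w = u_S - u, zeta = grad u(z) and kappa = alpha (lout - lin).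

    Testing each of the two state equations with the other state shows that the
    cost changes by exactly (alpha / 2) (lin - lout) times the integral over S of
    grad u . grad u_S (cost_difference). As S has area eps^2 |omega|, this integral
    is needed up to o(eps^2). Coercivity gives only O(eps) for w and its gradient
    in L^2 (energy_estimate); hence, grad u being continuous at z, it can be
    replaced by zeta at the cost of o(eps^2), but the integral over S of
    e_k . grad w contributes at the leading order.

    That integral is found by duality, without approximating w itself. Let G be the
    gradient of the corrector for e_k, rescaled to the size of S. The corrector
    equation tested with chi w, where chi is a cutoff around z, expresses kappa
    times the integral of e_k . grad w over S; the equation satisfied by w, tested
    with the rescaled corrector, expresses kappa times the integral of grad u . G
    over S. The forms are symmetric and have the same coefficient where chi = 1, so
    the left-hand sides differ only by terms in which G is taken away from z
    (corrector_comparison). There G is o(eps) in L^2, because G is a rescaled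
    square-integrable field (corrector_decay); multiplied by the O(eps) of w this
    is o(eps^2). In the integral of grad u . G over S, replacing grad u by zeta and
    rescaling gives eps^2 times the integral of zeta . grad K over omega, that is,
    the entries of the polarization matrix (lo_cost).

    The delicate point is that the corrector need not be square-integrable, so that
    the size of the test function in the zero-order term w v is not obvious. The
    test function is therefore the difference of the rescaled corrector and of its
    translate by a fixed vector that moves the centre out of D (dipole). Its
    gradient differs from G by a far field only, and it is o(eps) in L^2, since the
    translates by h of a function with square-integrable first derivative differ
    from it by o(h) in L^2 (translation_small). This rests on the fundamental
    theorem of calculus for weak gradients (weak_translation), itself a consequence
    of the fundamental lemma of the calculus of variations tested on products of
    functions of one variable (fundamental_lemma). *)

(** * Borel sets of the plane *)

Section Plane.
Variable R : realType.
Notation mR := (measurableTypeR R).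
Notation plane := (mR * mR)%type.

Definition csq (p : R * R) (r : R) : set (R * R) :=
  `[p.1 - r, p.1 + r]%classic `*` `[p.2 - r, p.2 + r]%classic.

Lemma csqE p r x : csq p r x <-> `|x.1 - p.1| <= r /\ `|x.2 - p.2| <= r.
Proof.
rewrite /csq /= !in_itv /= !ler_norml.
by split=> -[/andP[? ?] /andP[? ?]]; split; apply/andP; split; lra.
Qed.

Lemma nbhs_csq (p : R * R) (U : set (R * R)) :
  nbhs p U -> exists2 r, 0 < r & csq p r `<=` U.
Proof.
move=> /nbhs_ballP[e /= e0 eU]; exists (e / 2); first by rewrite divr_gt0.
move=> x /csqE[x1 x2]; apply: eU; split; rewrite /ball /= distrC; lra.
Qed.

Definition ratsq (q : rat * rat * nat) : set (R * R) :=
  csq (ratr q.1.1, ratr q.1.2) q.2.+1%:R^-1.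

Definition osq (p : R * R) (r : R) : set (R * R) :=
  `]p.1 - r, p.1 + r[%classic `*` `]p.2 - r, p.2 + r[%classic.

Lemma osqE p r x : osq p r x <-> `|x.1 - p.1| < r /\ `|x.2 - p.2| < r.
Proof.
rewrite /osq /= !in_itv /= !ltr_norml.
by split=> -[/andP[? ?] /andP[? ?]]; split; apply/andP; split; lra.
Qed.

(** Countably many squares suffice to fill any open set. Measurability of open
    sets, measurability of locally integrable functions and almost-everywhere
    statements on open sets all reduce to squares in this way. *)
Lemma ratsq_basis (U : set (R * R)) p : open U -> U p ->
  exists q : rat * rat * nat,
    ratsq q `<=` U /\ osq (ratr q.1.1, ratr q.1.2) q.2.+1%:R^-1 p.
Proof.
move=> oU Up; have [r r0 rU] := nbhs_csq (open_nbhs_nbhs (conj oU Up)).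
have [n nr] : exists n : nat, n.+1%:R^-1 < r / 2.
  have r20 : 0 < r / 2 by rewrite divr_gt0.
  have [N _ HN] := near_infty_natSinv_lt (PosNum r20).
  by exists N; exact: (HN N (leqnn N)).
have n0 : 0 < n.+1%:R^-1 :> R by rewrite invr_gt0.
have H (a e : R) : 0 < e -> exists q : rat, `|a - ratr q| < e.
  move=> e0; have /rat_in_itvoo[q] : a - e < a + e by lra.
  rewrite in_itv /= => /andP[q1 q2]; exists q; rewrite ltr_norml.
  by apply/andP; split; lra.
have [q1 hq1] := H p.1 _ n0; have [q2 hq2] := H p.2 _ n0.
exists (q1, q2, n); split; last by apply/osqE.
rewrite /ratsq /=; move: (n.+1%:R^-1) n0 nr hq1 hq2 => e n0 nr hq1 hq2.
move=> x /csqE/=[x1 x2]; apply: rU; apply/csqE.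
move: x1 x2 hq1 hq2; rewrite !ler_norml !ltr_norml.
move=> /andP[? ?] /andP[? ?] /andP[? ?] /andP[? ?].
by split; apply/andP; split; lra.
Qed.

Lemma osq_csq p r : osq p r `<=` csq p r.
Proof. by move=> x /osqE[/ltW ? /ltW ?]; apply/csqE. Qed.

Lemma open_ratsq (U : set (R * R)) : open U ->
  U = \bigcup_(q in [set q | ratsq q `<=` U]) ratsq q.
Proof.
move=> oU; apply/seteqP; split; last by move=> x [q /= qU]; exact: qU.
by move=> p /(ratsq_basis oU)[q [qU /osq_csq qp]]; exists q.
Qed.

Lemma measurable_rect (A B : set R) : measurable (A : set mR) ->
  measurable (B : set mR) -> measurable (A `*` B : set plane).
Proof. exact: measurableX. Qed.

Lemma measurable_csq p r : measurable (csq p r : set plane).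
Proof. by apply: measurable_rect; exact: measurable_itv. Qed.

Lemma open_measurable2 (U : set (R * R)) : open U -> measurable (U : set plane).
Proof.
move=> /open_ratsq ->; rewrite bigcup_mkcond.
apply: countable_bigcupT_measurable => // q.
by case: ifPn => // _; exact: measurable_csq.
Qed.

Lemma closed_measurable2 (U : set (R * R)) : closed U -> measurable (U : set plane).
Proof. by move=> /closed_openC/open_measurable2/measurableC; rewrite setCK. Qed.

Lemma hausdorff_plane : hausdorff_space (R * R)%type.
Proof. exact: norm_hausdorff. Qed.

Lemma compact_measurable2 (U : set (R * R)) : compact U -> measurable (U : set plane).
Proof. by move=> /(compact_closed hausdorff_plane)/closed_measurable2. Qed.

Lemma csq_compact p r : compact (csq p r).
Proof. by apply: compact_setX; exact: segment_compact. Qed.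

Lemma bounded_csq (U : set (R * R)) : bounded_set U ->
  exists2 r, 0 < r & U `<=` csq 0 r.
Proof.
move=> [M [_ /(_ (Num.max M 0 + 1))]] H.
have M1 : M < Num.max M 0 + 1.
  by rewrite ltr_pwDr// le_max lexx.
exists (Num.max M 0 + 1); first by rewrite ltr_wpDl// le_max lexx orbT.
move=> x /(H M1); rewrite /= prod_normE ge_max /= => /andP[x1 x2].
by apply/csqE => /=; rewrite !subr0.
Qed.

Lemma leb_cc (a b : R) : a <= b ->
  lebesgue_measure (`[a, b]%classic : set mR) = (b - a)%:E.
Proof.
move=> ab; rewrite lebesgue_measure_itv /= lte_fin; case: ltP => // ba.
by congr EFin; lra.
Qed.

Lemma leb2_csq p r : 0 <= r -> leb2 (csq p r) = ((r *+ 2) ^+ 2)%:E.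
Proof.
move=> r0; rewrite /leb2 [LHS]product_measure1E; [|exact: measurable_itv..].
transitivity ((r *+ 2)%:E * (r *+ 2)%:E)%E; last by rewrite -EFinM -expr2.
have E (a : R) : lebesgue_measure (`[a - r, a + r]%classic : set mR) = (r *+ 2)%:E.
  by rewrite leb_cc; [congr EFin|]; lra.
exact: (congr2 mule (E p.1) (E p.2)).
Qed.

Lemma leb2_bounded (U : set (R * R)) : measurable (U : set plane) -> bounded_set U ->
  (leb2 U < +oo)%E.
Proof.
move=> mU /bounded_csq[r r0 Ur].
rewrite (@le_lt_trans _ _ (leb2 (csq 0 r)))//.
  by apply: le_measure; rewrite ?inE//; exact: measurable_csq.
by rewrite leb2_csq ?ltW// ltry.
Qed.

Lemma compact_bounded2 (K : set (R * R)) : compact K -> bounded_set K.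
Proof. exact: compact_bounded. Qed.

Lemma leb2_open_gt0 (U : set (R * R)) x : open U -> U x -> (0 < leb2 U)%E.
Proof.
move=> oU Ux; have /nbhs_csq[r r0 rU] : nbhs x U by exact: open_nbhs_nbhs.
rewrite (@lt_le_trans _ _ (leb2 (csq x r)))//.
  by rewrite leb2_csq ?ltW// lte_fin exprn_gt0// mulrn_wgt0.
apply: le_measure; rewrite ?inE//; first exact: measurable_csq.
exact: open_measurable2.
Qed.

(** Only pointwise continuity on U is assumed, since functions of class C^k
    on U are unspecified outside U. *)
Lemma continuous_on_measurable (U : set (R * R)) (f : R * R -> R) : open U ->
  (forall x, U x -> {for x, continuous f}) -> measurable_fun (U : set plane) f.
Proof.
move=> oU cf; apply: (measurability _ (RGenOpens.measurableE R)).
move=> _ [_ [a [b ->] <-]]; apply: open_measurable2.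
rewrite openE => x [Ux]; rewrite /= => fx; apply: filterI.
  exact: open_nbhs_nbhs.
by apply: cf => //; apply: open_nbhs_nbhs; split => //; exact: interval_open.
Qed.

Lemma continuous_measurable2 (f : R * R -> R) : continuous f ->
  measurable_fun (setT : set plane) f.
Proof. by move=> cf; apply: continuous_on_measurable => [|x _]; [exact: openT|exact: cf]. Qed.

End Plane.

(** * Affine changes of variables in the plane *)

Section Affine.
Variable R : realType.
Notation mR := (measurableTypeR R).
Notation plane := (mR * mR)%type.

Definition open_rects : set (set plane) :=
  [set A | exists a b c d : R, A = `]a, b[%classic `*` `]c, d[%classic].

(** This generating family is stable under intersection, as Dynkin's induction in
    ae_zero_open_rects requires. *)
Lemma open_rectsE : @measurable _ plane = <<s open_rects >>.
Proof.
apply/seteqP; split; last first.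
  apply: smallest_sub; first exact: sigma_algebra_measurable.
  by move=> _ [a [b [c [d ->]]]]; apply: measurable_rect; exact: measurable_itv.
have m1 : measurable_fun setT (fst : g_sigma_algebraType open_rects -> mR).
  apply: (measurability _ (RGenOpens.measurableE R)).
  move=> _ [_ [a [b ->] <-]]; rewrite setTI.
  rewrite (_ : _ @^-1` _ =
    \bigcup_n (`]a, b[%classic `*` `](- n%:R), n%:R[%classic)); last first.
    apply/seteqP; split => [x /= xab|x [n _ []//]].
    exists (Num.truncn `|x.2|).+1 => //; split => //=.
    by rewrite in_itv /= -ltr_norml truncnS_gt.
  apply: bigcupT_measurable => n; apply: sub_sigma_algebra.
  by exists a, b, (- n%:R), n%:R.
have m2 : measurable_fun setT (snd : g_sigma_algebraType open_rects -> mR).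
  apply: (measurability _ (RGenOpens.measurableE R)).
  move=> _ [_ [a [b ->] <-]]; rewrite setTI.
  rewrite (_ : _ @^-1` _ =
    \bigcup_n (`](- n%:R), n%:R[%classic `*` `]a, b[%classic)); last first.
    apply/seteqP; split => [x /= xab|x [n _ []//]].
    exists (Num.truncn `|x.1|).+1 => //; split => //=.
    by rewrite in_itv /= -ltr_norml truncnS_gt.
  apply: bigcupT_measurable => n; apply: sub_sigma_algebra.
  by exists (- n%:R), n%:R, a, b.
rewrite measurable_prod_measurableType.
apply: smallest_sub; first exact: smallest_sigma_algebra.
move=> _ [A mA [B mB <-]].
have := measurableI _ _ (m1 measurableT A mA) (m2 measurableT B mB).
by rewrite !setTI.
Qed.

Lemma measurable_affine1 (p e : R) : measurable_fun setT (fun x : mR => p + e * x : mR).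
Proof. by apply: measurable_funD => //; exact: measurable_funM. Qed.

Lemma leb_affine (p e : R) (A : set mR) : 0 < e -> measurable A ->
  lebesgue_measure A = (e%:E * lebesgue_measure ((fun x => p + e * x)%R @^-1` A))%E.
Proof.
move=> e0 mA; have e0' := ltW e0.
have mT := measurable_affine1 p e.
pose m : {measure set mR -> \bar R} :=
  mscale (NngNum e0') (pushforward lebesgue_measure (fun x : mR => p + e * x : mR)).
have := @lebesgue_measure_unique R (m mT); apply => // X [[a b] _ <-] /=.
rewrite /m /mscale /= /pushforward.
have -> : (fun x : mR => p + e * x : mR) @^-1` `]a, b]%classic =
   `](a - p) / e, (b - p) / e]%classic.
  apply/seteqP; split => x /=; rewrite !in_itv /= ltr_pdivrMr// ler_pdivlMr//;
  by rewrite (mulrC x) ltrBlDl lerBrDl.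
rewrite !lebesgue_measure_itv /= !lte_fin ltr_pM2r ?invr_gt0// ltrD2r.
case: ifP => _; last by rewrite mule0.
rewrite -!EFinD -EFinM -mulrBl opprB addrA subrK mulrCA divff ?mulr1//.
by rewrite gt_eqF.
Qed.

Lemma measurable_affine (p : R * R) (e : R) :
  measurable_fun setT (fun x : plane => p + e *: x : plane).
Proof.
apply/measurable_fun_pairP; split => /=.
  by apply: (measurableT_comp (measurable_affine1 p.1 e)).
by apply: (measurableT_comp (measurable_affine1 p.2 e)).
Qed.

(** The pushforward of the measure by the affine map, multiplied by e^2, takes
    the right values on products, and the product measure is unique. *)
Lemma leb2_affine (p : R * R) (e : R) (A : set plane) : 0 < e -> measurable A ->
  leb2 A = ((e ^+ 2)%:E * leb2 ((fun x => p + e *: x)%R @^-1` A))%E.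
Proof.
move=> e0 mA; have e0' : 0 <= e ^+ 2 by rewrite exprn_ge0// ltW.
have mT := measurable_affine p e.
pose m : {measure set plane -> \bar R} :=
  mscale (NngNum e0') (pushforward leb2 (fun x : plane => p + e *: x : plane)).
have := @product_measure_unique _ _ _ _ _ lebesgue_measure lebesgue_measure (m mT).
apply => // X Y mX mY; apply/esym.
apply: (etrans (congr2 mule (leb_affine p.1 e0 mX) (leb_affine p.2 e0 mY))).
rewrite -[RHS]/((e ^+ 2)%:E * leb2 (((fun x => p.1 + e * x)%R @^-1` X) `*`
  ((fun x => p.2 + e * x)%R @^-1` Y)))%E.
have mX' : measurable ((fun x => p.1 + e * x)%R @^-1` X : set mR).
  by rewrite -[X in measurable X]setTI; exact: measurable_affine1.
have mY' : measurable ((fun x => p.2 + e * x)%R @^-1` Y : set mR).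
  by rewrite -[X in measurable X]setTI; exact: measurable_affine1.
have P := product_measure1E lebesgue_measure lebesgue_measure mX' mY'.
apply: (etrans _ (esym (congr1 (mule (e ^+ 2)%:E) P))).
by rewrite expr2 EFinM muleACA.
Qed.

Lemma ge0_integral_affine (p : R * R) (e : R) (f : plane -> \bar R) : 0 < e ->
  measurable_fun setT f -> (forall x, 0 <= f x)%E ->
  (\int[leb2]_x f x = (e ^+ 2)%:E * \int[leb2]_x f (p + e *: x)%R)%E.
Proof.
move=> e0 mf f0; have e0' : 0 <= e ^+ 2 by rewrite exprn_ge0// ltW.
have mT := measurable_affine p e.
have -> : (\int[leb2]_x f (p + e *: x)%R =
  \int[pushforward leb2 (fun x : plane => p + e *: x : plane)%R]_x f x)%E.
  by rewrite (ge0_integral_pushforward mT).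
rewrite -(ge0_integral_mscale (pushforward leb2 (fun x : plane => p + e *: x : plane))
   measurableT (NngNum e0'))//.
apply: eq_measure_integral => A mA _.
exact: leb2_affine.
Qed.

Lemma integrable_affine (p : R * R) (e : R) (f : plane -> R) : 0 < e ->
  leb2.-integrable setT (EFin \o f) ->
  leb2.-integrable setT (EFin \o (fun x => f (p + e *: x))).
Proof.
move=> e0 /integrableP[mf fi].
have mT := measurable_affine p e.
apply/integrableP; split; first exact: (measurableT_comp mf mT).
move: fi; rewrite (ge0_integral_affine p e0)//.
  rewrite !ltey; apply: contra => /eqP /= ->.
  by rewrite gt0_muley// lte_fin exprn_gt0.
exact: measurableT_comp.
Qed.

Lemma Rintegral_affine (p : R * R) (e : R) (f : plane -> R) : 0 < e ->
  leb2.-integrable setT (EFin \o f) ->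
  \int[leb2]_x f x = e ^+ 2 * \int[leb2]_x f (p + e *: x).
Proof.
move=> e0 fi.
have fi' := integrable_affine p e0 fi.
have mT := measurable_affine p e.
have mE : measurable_fun setT (EFin \o f) by case/integrableP: fi.
pose g x := f (p + e *: x).
rewrite -[RHS]/(e ^+ 2 * fine (\int[leb2]_x (EFin \o g) x)%E).
rewrite /Rintegral integralE [in RHS]integralE.
rewrite (ge0_integral_affine p e0 (measurable_funepos mE))//.
rewrite (ge0_integral_affine p e0 (measurable_funeneg mE))//.
have -> : (\int[leb2]_x (EFin \o f)^\+ (p + e *: x)%R = \int[leb2]_x (EFin \o g)^\+ x)%E.
  by apply: eq_integral => x _; rewrite !funeposE.
have -> : (\int[leb2]_x (EFin \o f)^\- (p + e *: x)%R = \int[leb2]_x (EFin \o g)^\- x)%E.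
  by apply: eq_integral => x _; rewrite !funenegE.
have fp : (\int[leb2]_x (EFin \o g)^\+ x)%E \is a fin_num.
  exact: (integrable_fin_num measurableT (integrable_funepos measurableT fi')).
have fn : (\int[leb2]_x (EFin \o g)^\- x)%E \is a fin_num.
  exact: (integrable_fin_num measurableT (integrable_funeneg measurableT fi')).
by rewrite -(fineK fp) -(fineK fn) -!EFinM -!EFinB /= mulrBr.
Qed.
End Affine.

(** * Square-integrable functions and vector fields *)

Section SquareIntegrable.
Context d (T : measurableType d) (R : realType) (mu : {measure set T -> \bar R}).
Implicit Types (D E : set T) (f g m : T -> R).

(** Membership in L^2(D) in terms of the integral of the square, so that the
    bilinear computations below stay among real-valued integrals; Lp_on2P makes the
    link with the norm-based definition. *)
Definition sqint D f :=
  measurable_fun D f /\ mu.-integrable D (EFin \o (fun x => f x ^+ 2)).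

Definition l2n D f : R := Num.sqrt (\int[mu]_(x in D) f x ^+ 2).

Lemma le_integrableR D (f g : T -> R) : measurable D -> measurable_fun D f ->
  (forall x, D x -> `|f x| <= g x) ->
  mu.-integrable D (EFin \o g) -> mu.-integrable D (EFin \o f).
Proof.
move=> mD mf fg ig; apply: (le_integrable mD _ _ ig); first exact/measurable_EFinP.
by move=> x Dx; rewrite /= lee_fin (le_trans (fg x Dx))// ler_norm.
Qed.

Lemma integrableDR D f g : measurable D -> mu.-integrable D (EFin \o f) ->
  mu.-integrable D (EFin \o g) -> mu.-integrable D (EFin \o (fun x => f x + g x)).
Proof. by move=> mD fi gi; have := integrableD mD fi gi. Qed.

Lemma integrableZR D f c : measurable D -> mu.-integrable D (EFin \o f) ->
  mu.-integrable D (EFin \o (fun x => c * f x)).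
Proof. by move=> mD fi; have := integrableZl mD c fi. Qed.

Lemma integrable_measurable D f : mu.-integrable D (EFin \o f) -> measurable_fun D f.
Proof. by move=> /integrableP[/measurable_EFinP]. Qed.

Lemma integrableBR D f g : measurable D -> mu.-integrable D (EFin \o f) ->
  mu.-integrable D (EFin \o g) -> mu.-integrable D (EFin \o (fun x => f x - g x)).
Proof. by move=> mD fi gi; have := integrableB mD fi gi. Qed.

Lemma integrable_cst_fin D (c : R) : measurable D -> (mu D < +oo)%E ->
  mu.-integrable D (EFin \o cst c).
Proof.
move=> mD fD; apply/integrableP; split; first exact/measurable_EFinP/measurable_cst.
by rewrite [ltLHS](integral_cst mu mD `|c|%:E) lte_mul_pinfty.
Qed.

Lemma sqint_cst D (c : R) : measurable D -> (mu D < +oo)%E -> sqint D (fun=> c).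
Proof.
move=> mD fD; split; first exact: measurable_cst.
exact: (integrable_cst_fin (c ^+ 2) mD fD).
Qed.

Lemma integrable_bounded_mul D m f M : measurable D -> measurable_fun D m ->
  (forall x, D x -> `|m x| <= M) -> mu.-integrable D (EFin \o f) ->
  mu.-integrable D (EFin \o (fun x => m x * f x)).
Proof.
move=> mD mm mM fi; have mf := integrable_measurable fi.
apply: (@le_integrableR _ _ (fun x => M * `|f x|)) => //.
- exact: measurable_funM.
- by move=> x Dx; rewrite normrM ler_wpM2r// mM.
- by apply: integrableZR => //; exact: integrable_norm.
Qed.

Lemma sqintM D f g : measurable D -> sqint D f -> sqint D g ->
  mu.-integrable D (EFin \o (fun x => f x * g x)).
Proof.
move=> mD [mf fi] [mg gi].
apply: (@le_integrableR _ _ (fun x => f x ^+ 2 + g x ^+ 2)) => //.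
- exact: measurable_funM.
- move=> x _; rewrite normrM -(real_normK (num_real (f x))) -(real_normK (num_real (g x))).
  by have := sqr_ge0 (`|f x| - `|g x|); have := normr_ge0 (f x);
    have := normr_ge0 (g x); nra.
- exact: integrableDR.
Qed.

Lemma sqintS D E f : measurable D -> measurable E -> E `<=` D ->
  sqint D f -> sqint E f.
Proof.
by move=> mD mE ED [mf fi]; split;
  [exact: measurable_funS ED mf|exact: integrableS ED fi].
Qed.

Lemma sqintD D f g : measurable D -> sqint D f -> sqint D g ->
  sqint D (fun x => f x + g x).
Proof.
move=> mD sf sg; split; first exact: measurable_funD sf.1 sg.1.
have -> : (fun x => (f x + g x) ^+ 2) =
  (fun x => (f x ^+ 2 + g x ^+ 2) + 2 * (f x * g x)).
  by apply/funext => x; ring.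
apply: integrableDR => //; last by apply: integrableZR => //; exact: sqintM.
by apply: integrableDR => //; [exact: sf.2|exact: sg.2].
Qed.

Lemma sqint_bounded_mul D m f M : measurable D -> measurable_fun D m ->
  (forall x, D x -> `|m x| <= M) -> sqint D f -> sqint D (fun x => m x * f x).
Proof.
move=> mD mm mM [mf fi]; split; first exact: measurable_funM.
have -> : (fun x => (m x * f x) ^+ 2) = (fun x => m x ^+ 2 * f x ^+ 2).
  by apply/funext => x; rewrite exprMn.
apply: (@integrable_bounded_mul _ _ _ (M ^+ 2)) => //.
  by apply: measurable_funX.
move=> x Dx; rewrite normrX ler_sqr ?nnegrE ?mM//.
exact: le_trans (normr_ge0 _) (mM x Dx).
Qed.

Lemma sqintZ D f c : measurable D -> sqint D f -> sqint D (fun x => c * f x).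
Proof. by move=> mD; apply: (@sqint_bounded_mul _ _ _ `|c|). Qed.

Lemma sqintB D f g : measurable D -> sqint D f -> sqint D g ->
  sqint D (fun x => f x - g x).
Proof.
move=> mD sf sg; have := sqintD mD sf (sqintZ (-1) mD sg).
by congr sqint; apply/funext => x; rewrite mulN1r.
Qed.

Lemma l2n_ge0 D f : 0 <= l2n D f. Proof. exact: sqrtr_ge0. Qed.

Lemma sqr_l2n D f : l2n D f ^+ 2 = \int[mu]_(x in D) f x ^+ 2.
Proof. by rewrite sqr_sqrtr// Rintegral_ge0// => x _; exact: sqr_ge0. Qed.

(** The polynomial t |-> ||t |f| - |g|||^2 is nonnegative; its
    discriminant is the claim. *)
Lemma cauchy_schwarz D f g : measurable D -> sqint D f -> sqint D g ->
  \int[mu]_(x in D) `|f x * g x| <= l2n D f * l2n D g.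
Proof.
move=> mD sf sg; have fgi := integrable_norm (sqintM mD sf sg).
set C := \int[mu]_(x in D) _.
have C0 : 0 <= C by apply: Rintegral_ge0.
have key t : 0 <= t ^+ 2 * l2n D f ^+ 2 - 2 * t * C + l2n D g ^+ 2.
  rewrite !sqr_l2n -!RintegralZl//; [|exact: sf.2].
  rewrite -RintegralB//; [|by apply: integrableZR => //; exact: sf.2|
    by apply: integrableZR => //; exact: fgi].
  rewrite -RintegralD//; [| |exact: sg.2]; last first.
    by apply: integrableBR => //; apply: integrableZR => //; exact: sf.2.
  apply: Rintegral_ge0 => x _; rewrite normrM.
  rewrite -(real_normK (num_real (f x))) -(real_normK (num_real (g x))).
  have -> : t ^+ 2 * `|f x| ^+ 2 - 2 * t * (`|f x| * `|g x|) + `|g x| ^+ 2 =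
    (t * `|f x| - `|g x|) ^+ 2 by ring.
  exact: sqr_ge0.
pose p := Poly [:: l2n D g ^+ 2; - (2 * C); l2n D f ^+ 2].
have : p`_1 ^+ 2 - 4 * p`_2 * p`_0 <= 0.
  apply: deg_le2_poly_ge0 => [|t]; first exact: size_Poly.
  by rewrite horner_Poly /=; have := key t; congr (0 <= _); ring.
rewrite !coef_Poly /= => H.
by rewrite -ler_sqr ?nnegrE ?mulr_ge0 ?l2n_ge0// exprMn; lra.
Qed.

Lemma le_l2n D f g : measurable D -> sqint D f -> sqint D g ->
  (forall x, D x -> `|f x| <= `|g x|) -> l2n D f <= l2n D g.
Proof.
move=> mD sf sg fg; apply: ler_wsqrtr; apply: le_Rintegral => //.
- exact: sf.2.
- exact: sg.2.
- move=> x Dx; rewrite -(real_normK (num_real (f x))) -(real_normK (num_real (g x))).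
  by rewrite ler_sqr ?nnegrE ?fg.
Qed.

Lemma le_l2nS D E f : measurable D -> measurable E -> E `<=` D -> sqint D f ->
  l2n E f <= l2n D f.
Proof.
move=> mD mE ED sf; apply: ler_wsqrtr.
rewrite /Rintegral fine_le//.
- exact: (integrable_fin_num mE (sqintS mD mE ED sf).2).
- exact: (integrable_fin_num mD sf.2).
- apply: ge0_subset_integral => //.
  + by case/integrableP: sf.2.
  + by move=> x _; rewrite lee_fin sqr_ge0.
Qed.

Lemma l2nD D f g : measurable D -> sqint D f -> sqint D g ->
  l2n D (fun x => f x + g x) <= l2n D f + l2n D g.
Proof.
move=> mD sf sg; rewrite -ler_sqr ?nnegrE ?addr_ge0 ?l2n_ge0//.
rewrite sqrrD !sqr_l2n.
have fgi := sqintM mD sf sg.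
have -> : \int[mu]_(x in D) (f x + g x) ^+ 2 = \int[mu]_(x in D) f x ^+ 2 +
   2 * \int[mu]_(x in D) (f x * g x) + \int[mu]_(x in D) g x ^+ 2.
  rewrite -RintegralZl// -RintegralD//; [|exact: sf.2|exact: integrableZR].
  rewrite -RintegralD//; [| |exact: sg.2]; last first.
    by apply: integrableDR => //; [exact: sf.2|exact: integrableZR].
  by apply: eq_Rintegral => x _; ring.
rewrite lerD2r lerD2l -[leRHS]mulr_natl ler_wpM2l//.
apply: le_trans (cauchy_schwarz mD sf sg).
by apply: le_trans (ler_norm _) (le_normr_Rintegral mD fgi).
Qed.

End SquareIntegrable.

Section VectorFields.
Context d (T : measurableType d) (R : realType) (mu : {measure set T -> \bar R}).
Implicit Types (D E : set T) (g h : T -> 'cV[R]_2).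

Lemma dotvE (a b : 'cV[R]_2) : dotv a b = a 0 0 * b 0 0 + a 1 0 * b 1 0.
Proof.
rewrite /dotv mxE big_ord_recl big_ord1 !mxE.
by congr (_ + a _ _ * b _ _); apply/val_inj.
Qed.

Lemma dotvv_ge0 (a : 'cV[R]_2) : 0 <= dotv a a.
Proof. by rewrite dotvE addr_ge0// -expr2 sqr_ge0. Qed.

Definition vsqint D g := forall i, sqint mu D (fun x => g x i 0).

(** L^2 norm of a vector field. *)
Definition vn D g : R := Num.sqrt (\int[mu]_(x in D) dotv (g x) (g x)).

Definition vnorm (a : 'cV[R]_2) := Num.sqrt (dotv a a).

Lemma vnE D g : vn D g = l2n mu D (fun x => vnorm (g x)).
Proof.
rewrite /vn /l2n; congr Num.sqrt; apply: eq_Rintegral => x _.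
by rewrite sqr_sqrtr// dotvv_ge0.
Qed.

Lemma dotv_le (a b : 'cV[R]_2) : `|dotv a b| <= vnorm a * vnorm b.
Proof.
rewrite -ler_sqr ?nnegrE ?mulr_ge0 ?sqrtr_ge0// exprMn !sqr_sqrtr ?dotvv_ge0//.
rewrite real_normK ?num_real// !dotvE -subr_ge0.
have -> : forall p q r s : R, (p * p + q * q) * (r * r + s * s) - (p * r + q * s) ^+ 2
  = (p * s - q * r) ^+ 2 by move=> p q r s; ring.
exact: sqr_ge0.
Qed.

Lemma integrable_dotv D g h : measurable D -> vsqint D g -> vsqint D h ->
  mu.-integrable D (EFin \o (fun x => dotv (g x) (h x))).
Proof.
move=> mD sg sh; under [_ \o _]eq_fun do rewrite /= dotvE.
by apply: integrableDR => //; apply: sqintM.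
Qed.

Lemma vsqint_vnorm D g : measurable D -> vsqint D g -> sqint mu D (fun x => vnorm (g x)).
Proof.
move=> mD sg; split.
  apply: (measurableT_comp (continuous_measurable_fun (@sqrt_continuous R))).
  under eq_fun do rewrite dotvE.
  by apply: measurable_funD; apply: measurable_funM; exact: (sg _).1.
have -> : (fun x => vnorm (g x) ^+ 2) = (fun x => dotv (g x) (g x)).
  by apply/funext => x; rewrite sqr_sqrtr// dotvv_ge0.
exact: integrable_dotv.
Qed.

Lemma vcauchy_schwarz D (m : T -> R) g h M : measurable D -> measurable_fun D m ->
  (forall x, D x -> `|m x| <= M) -> 0 <= M -> vsqint D g -> vsqint D h ->
  `|\int[mu]_(x in D) (m x * dotv (g x) (h x))| <= M * (vn D g * vn D h).
Proof.
move=> mD mm mM M0 sg sh; rewrite !vnE.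
have gi := vsqint_vnorm mD sg; have hi := vsqint_vnorm mD sh.
have ghi := integrable_dotv mD sg sh.
have mghi := integrable_bounded_mul mD mm mM ghi.
have ghi' := sqintM mD gi hi.
apply: (le_trans (le_normr_Rintegral mD mghi)).
apply: (@le_trans _ _ (\int[mu]_(x in D) (M * (vnorm (g x) * vnorm (h x))))).
  apply: le_Rintegral => //.
  - exact: integrable_norm.
  - exact: integrableZR.
  - by move=> x Dx; rewrite normrM ler_pM// ?mM// dotv_le.
rewrite RintegralZl// ler_wpM2l//; apply: le_trans (cauchy_schwarz mD gi hi).
by apply: le_trans (ler_norm _) (le_normr_Rintegral mD ghi').
Qed.

Lemma vsqintS D E g : measurable D -> measurable E -> E `<=` D ->
  vsqint D g -> vsqint E g.
Proof. by move=> mD mE ED sg i; exact: sqintS (sg i). Qed.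

Lemma vsqintB D g h : measurable D -> vsqint D g -> vsqint D h ->
  vsqint D (fun x => g x - h x).
Proof.
move=> mD sg sh i; have := sqintB mD (sg i) (sh i).
by congr sqint; apply/funext => x; rewrite !mxE.
Qed.

Lemma vsqintD D g h : measurable D -> vsqint D g -> vsqint D h ->
  vsqint D (fun x => g x + h x).
Proof.
move=> mD sg sh i; have := sqintD mD (sg i) (sh i).
by congr sqint; apply/funext => x; rewrite !mxE.
Qed.

Lemma vn_ge0 D g : 0 <= vn D g. Proof. exact: sqrtr_ge0. Qed.

Lemma sqr_vn D g : vn D g ^+ 2 = \int[mu]_(x in D) dotv (g x) (g x).
Proof. by rewrite sqr_sqrtr// Rintegral_ge0// => x _; exact: dotvv_ge0. Qed.

Lemma le_vnS D E g : measurable D -> measurable E -> E `<=` D -> vsqint D g ->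
  vn E g <= vn D g.
Proof. by move=> mD mE ED sg; rewrite !vnE le_l2nS//; exact: vsqint_vnorm. Qed.

End VectorFields.

(** * Smooth functions of one variable *)

Section Smooth1.
Variable R : realType.
Implicit Types (a b : R -> R) (n : nat).

Fixpoint Ck1 n a : Prop :=
  if n is n'.+1 then (forall x, derivable a x 1) /\ Ck1 n' (derive1 a) else continuous a.

Definition smooth a := forall n, Ck1 n a.

Lemma Ck1_continuous n a : Ck1 n a -> continuous a.
Proof.
case: n => [//|n [da _] x].
exact/differentiable_continuous/derivable1_diffP/da.
Qed.

Lemma Ck1W n a : Ck1 n.+1 a -> Ck1 n a.
Proof.
elim: n a => [|n IH] a /=; last by move=> [? /IH].
by move=> h; exact: (@Ck1_continuous 1).
Qed.

Lemma Ck1_derive n a a' : (forall x : R, is_derive x 1 a (a' x)) -> Ck1 n a' -> Ck1 n.+1 a.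
Proof.
move=> da ca'; split; first by move=> x; have [] := da x.
suff -> : (derive1 a) = a' by [].
by apply/funext => x; rewrite derive1E; exact: derive_val.
Qed.

Lemma smooth_derive a : smooth a -> smooth (derive1 a).
Proof. by move=> sa n; have [] := sa n.+1. Qed.

Lemma smooth_is_derive a (x : R) : smooth a -> is_derive x 1 a ((derive1 a) x).
Proof. by move=> /(_ 1%N)[da _]; rewrite derive1E; exact/derivableP. Qed.

Lemma smooth_continuous a : smooth a -> continuous a.
Proof. by move=> /(_ 0%N). Qed.

Lemma smooth_primitive a a' : (forall x : R, is_derive x 1 a (a' x)) -> smooth a' -> smooth a.
Proof. by move=> da sa' [|n]; [apply: (@Ck1_continuous 1)|]; exact: Ck1_derive da (sa' _). Qed.

Lemma Ck1_cst n (c : R) : Ck1 n (cst c).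
Proof.
elim: n c => [|n IH] c; first exact: cst_continuous.
by apply: (Ck1_derive (a' := cst 0)).
Qed.

Lemma Ck1D n a b : Ck1 n a -> Ck1 n b -> Ck1 n (fun x => a x + b x).
Proof.
elim: n a b => [|n IH] a b; first by move=> ca cb x; apply: cvgD; [exact: ca|exact: cb].
move=> [da ca] [db cb].
apply: (Ck1_derive (a' := fun x => (derive1 a) x + (derive1 b) x)); last exact: IH.
by move=> x; rewrite !derive1E; apply: is_deriveD; exact/derivableP.
Qed.

Lemma Ck1M n a b : Ck1 n a -> Ck1 n b -> Ck1 n (fun x => a x * b x).
Proof.
elim: n a b => [|n IH] a b; first by move=> ca cb x; apply: cvgM; [exact: ca|exact: cb].
move=> ca cb; have [da ca'] := ca; have [db cb'] := cb.
apply: (Ck1_derive (a' := fun x => a x * (derive1 b) x + b x * (derive1 a) x)).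
  by move=> x; rewrite !derive1E; apply: is_deriveM; exact/derivableP.
by apply: Ck1D; apply: IH => //; exact: Ck1W.
Qed.

Lemma is_derive_affine (c p x : R) : is_derive x 1 (fun x : R => p + c * x) c.
Proof.
have h : is_derive x 1 (cst p + (cst c * (@id R))) (0 + (cst c x *: 1 + (@id R) x *: 0)).
  by apply: is_deriveD.
apply: (is_derive_eq h).
by rewrite scaler0 addr0 add0r /GRing.scale /= mulr1.
Qed.

Lemma Ck1_affine n a (c p : R) : Ck1 n a -> Ck1 n (fun x => a (p + c * x)).
Proof.
elim: n a => [|n IH] a.
  move=> ca x; apply: (@continuous_comp _ _ _ (fun x => p + c * x) a); last exact: ca.
  by apply: cvgD; [exact: cvg_cst|apply: cvgM; [exact: cvg_cst|exact: cvg_id]].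
move=> [da ca'].
apply: (Ck1_derive (a' := fun x => c * (derive1 a) (p + c * x))).
  move=> x; rewrite mulrC.
  apply: (@is_derive1_comp _ a (fun x : R => p + c * x)).
    by rewrite derive1E; exact/derivableP.
  exact: is_derive_affine.
by apply: (Ck1M (a := cst c)); [exact: Ck1_cst|exact: IH].
Qed.

Lemma smoothM a b : smooth a -> smooth b -> smooth (fun x => a x * b x).
Proof. by move=> sa sb n; exact: Ck1M. Qed.

Lemma smoothD a b : smooth a -> smooth b -> smooth (fun x => a x + b x).
Proof. by move=> sa sb n; exact: Ck1D. Qed.

Lemma smooth_affine a c p : smooth a -> smooth (fun x => a (p + c * x)).
Proof. by move=> sa n; exact: Ck1_affine. Qed.

Lemma smoothZ a (c : R) : smooth a -> smooth (fun x => c * a x).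
Proof. by move=> sa n; apply: (Ck1M (a := cst c)) => //; exact: Ck1_cst. Qed.

(** The family exp(-1/t) / t^m, extended by 0 to t <= 0, is stable under
    differentiation up to linear combinations, so that all its members are smooth by
    induction on the order of differentiation. *)
Definition flat (m : nat) (t : R) : R := if 0 < t then t ^- m * expR (- t^-1) else 0.

Lemma flat_ge0 m t : 0 <= flat m t.
Proof.
rewrite /flat; case: ltP => // t0.
by rewrite mulr_ge0 ?expR_ge0// invr_ge0 exprn_ge0// ltW.
Qed.

(** The exponential dominates each term of its series; the term of degree m + 1
    at 1/t gives the bound, and the extra factor t is what makes the difference
    quotient at 0 vanish in the limit. *)
Lemma flat_le m t : flat m t <= m.+1`!%:R * `|t|.
Proof.
rewrite /flat; case: ltP => [t0|]; last by rewrite mulr_ge0.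
have it0 : 0 <= t^-1 by rewrite invr_ge0 ltW.
rewrite expRN ler_pdivrMr ?expR_gt0//.
apply: (@le_trans _ _ (m.+1`!%:R * `|t| * (t^-1 ^+ m.+1 / m.+1`!%:R))).
  have f0 : (m.+1`!%:R != 0 :> R) by rewrite pnatr_eq0 -lt0n fact_gt0.
  have t1 : t != 0 by rewrite gt_eqF.
  rewrite (gtr0_norm t0) exprVn exprS.
  by rewrite le_eqVlt; apply/orP; left; apply/eqP; field; rewrite f0 t1 expf_neq0.
rewrite ler_wpM2l ?mulr_ge0//.
by apply: le_trans (expR_ge1Dxn m it0); rewrite lerDr.
Qed.

Lemma flat_gt0 m t : (0 < flat m t) = (0 < t).
Proof.
rewrite /flat; case: (ltP 0 t) => t0; last by rewrite ltxx.
by rewrite mulr_gt0 ?expR_gt0// invr_gt0 exprn_gt0.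
Qed.

Lemma flatN m t : t <= 0 -> flat m t = 0.
Proof. by rewrite /flat leNgt => /negbTE ->. Qed.

(** Away from 0 this is the usual computation. At 0 the difference quotient of
    the member m is the member m + 1, which tends to 0 by flat_le. *)
Lemma is_derive_flat m (t : R) :
  is_derive t 1 (flat m) (- m%:R * flat m.+1 t + flat m.+2 t).
Proof.
have [t0|t0|t0] := ltgtP 0 t.
- have -> : - m%:R * flat m.+1 t + flat m.+2 t =
      t ^- m *: (expR (- t^-1) * (- (- t ^- 2))) + expR (- t^-1) *: (- m%:R * t ^- m.+1).
    rewrite /flat t0 /GRing.scale /=.
    have t1 : t != 0 by rewrite gt_eqF.
    by rewrite !exprS expr0; field; rewrite t1 expf_neq0.
  have dV : is_derive t 1 (fun x : R => x^-1) (- t ^- 2).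
    have h := @is_deriveV R id t 1 1 (lt0r_neq0 t0) (is_derive_id _ _).
    by apply: (is_derive_eq h); rewrite /GRing.scale /= mulr1.
  have dE : is_derive t 1 (fun x : R => expR (- x^-1)) (expR (- t^-1) * (- (- t ^- 2))).
    exact: (@is_derive1_comp R expR (fun x : R => - x^-1)).
  have dP : is_derive t 1 (fun x : R => x ^- m) (- m%:R * t ^- m.+1).
    case: m => [|m].
      rewrite [X in is_derive _ _ X](_ : _ = cst 1); last first.
        by apply/funext => x; rewrite expr0 invr1.
      by rewrite oppr0 mul0r; exact: is_derive_cst.
    have dX : is_derive t 1 (fun x : R => x ^+ m.+1) (m.+1%:R * t ^+ m).
      have h := is_deriveX m.+1 (is_derive_id t (1 : R)).
      rewrite (_ : (fun x : R => x ^+ m.+1) = (@id R) ^+ m.+1); last first.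
        by apply/funext => x; rewrite fctE.
      by apply: (is_derive_eq h); rewrite /GRing.scale /= mulr1.
    have h := @is_deriveV R (fun x : R => x ^+ m.+1) t _ 1 (expf_neq0 _ (lt0r_neq0 t0)) dX.
    apply: (is_derive_eq h); rewrite /GRing.scale /= !exprS expr0.
    by field; rewrite (lt0r_neq0 t0) expf_neq0// lt0r_neq0.
  apply: (@near_eq_is_derive _ _ _ (fun x : R => x ^- m * expR (- x^-1))).
    near=> x; rewrite /flat ifT//.
    by near: x; exact: lt_nbhsr.
  exact: is_deriveM.
- rewrite !flatN ?ltW// mulr0 addr0.
  apply: (@near_eq_is_derive _ _ _ (cst 0)).
  near=> x; rewrite flatN//; apply: ltW.
  by near: x; exact: lt_nbhsl.
- subst t; rewrite !flatN// mulr0 addr0.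
  have H : (fun h => h^-1 *: ((flat m \o shift 0) (h *: 1) - flat m 0)) @ 0^' --> (0 : R).
    apply/cvgr0Pnorm_le => e e0; near=> h.
    rewrite /= (flatN m (lexx 0)) subr0 addr0 /GRing.scale /= mulr1 normrM normfV.
    have h0 : h != 0 by near: h; exact: nbhs_dnbhs_neq.
    rewrite mulrC ler_pdivrMr ?normr_gt0// (ger0_norm (flat_ge0 _ _)).
    have [hp|hn] := ltP 0 h; last by rewrite flatN// mulr_ge0// ltW.
    have -> : flat m h = h * flat m.+1 h.
      by rewrite /flat hp exprS; field; rewrite h0 expf_neq0.
    rewrite (gtr0_norm hp) mulrC ler_wpM2r ?(ltW hp)//.
    apply: (le_trans (flat_le _ _)).
    rewrite -ler_pdivlMl ?ltr0n ?fact_gt0// mulrC.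
    near: h; apply: dnbhs0_le.
    by rewrite divr_gt0// ltr0n fact_gt0.
  apply: DeriveDef; first by apply/cvg_ex; exists 0.
  exact: cvg_lim.
Unshelve. all: by end_near. Qed.

Lemma smooth_flat m : smooth (flat m).
Proof.
move=> n; elim: n m => [|n IH] m.
  move=> x; apply/differentiable_continuous/derivable1_diffP.
  by have [] := is_derive_flat m x.
apply: (Ck1_derive (a' := fun t => - m%:R * flat m.+1 t + flat m.+2 t)).
  by move=> x; exact: is_derive_flat.
by apply: Ck1D; [apply: (Ck1M (a := cst (- m%:R))); [exact: Ck1_cst|]|].
Qed.

End Smooth1.

Section Primitive.
Variable R : realType.

(** The integral starts at p - 1, strictly to the left of the support, so that
    the fundamental theorem of calculus applies at every point of the support. *)
Lemma compact_primitive (a : R -> R) (p q : R) : p < q -> smooth a ->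
  (forall x, x <= p -> a x = 0) -> (forall x, q <= x -> a x = 0) ->
  exists A : R -> R, [/\ smooth A, forall x : R, is_derive x 1 A (a x),
    forall x, x <= p -> A x = 0 & forall x, q <= x -> A x = A q].
Proof.
move=> pq sa ap aq; have ca := smooth_continuous sa.
pose A x := \int[lebesgue_measure]_(t in [set` `[p - 1, x]]) a t.
have Ap x : x <= p -> A x = 0.
  move=> xp; rewrite /A; under eq_Rintegral => t.
    rewrite inE /= in_itv /= => /andP[_ tx]; rewrite (ap t (le_trans tx xp)); over.
  by rewrite Rintegral_cst ?mul0r//; exact: measurable_itv.
have dA (x : R) : is_derive x 1 A (a x).
  have [xp|px] := ltP x p.
    rewrite (ap _ (ltW xp)); apply: (@near_eq_is_derive _ _ _ (cst 0)).
    near=> t; rewrite Ap//; apply: ltW.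
    by near: t; exact: lt_nbhsl.
  have [||||dA1 dA2] := @continuous_FTC1_closed R a (p - 1) x (x + 1).
  - by rewrite ltrDl.
  - apply: continuous_compact_integrable; first exact: segment_compact.
    by apply: continuous_subspaceT.
  - by apply: lt_le_trans px; rewrite ltrBlDr ltrDl.
  - exact: ca.
  - by apply: DeriveDef; [exact: dA1|rewrite -derive1E; exact: dA2].
exists A; split => //.
  by apply: smooth_primitive sa.
move=> x; rewrite le_eqVlt => /predU1P[->//|qx].
have cA : {within `[q, x], continuous A}.
  apply: continuous_subspaceT => y.
  by apply/differentiable_continuous/derivable1_diffP; have [] := dA y.
have [c] := MVT qx (fun y _ => dA y) cA.
rewrite in_itv /= => /andP[qc _]; rewrite (aq _ (ltW qc)) mul0r => /eqP.
by rewrite subr_eq0 => /eqP.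
Unshelve. all: by end_near. Qed.

(** The primitive of a nonnegative smooth function supported in [0, 1],
    divided by its total integral. *)
Lemma smooth_step : exists s : R -> R, [/\ smooth s,
  forall x, x <= 0 -> s x = 0 & forall x, 1 <= x -> s x = 1].
Proof.
pose a (x : R) := flat 0 x * flat 0 (1 + -1 * x).
have sa : smooth a by apply: smoothM; [|apply: smooth_affine]; exact: smooth_flat.
have [||A [sA dA A0 A1]] := compact_primitive ltr01 sa.
- by move=> x x0; rewrite /a flatN// mul0r.
- by move=> x x1; rewrite /a [X in _ * X]flatN ?mulr0//; lra.
have cA : {within `[0, 1], continuous A}.
  by apply: continuous_subspaceT; exact: smooth_continuous.
have [c] := MVT ltr01 (fun y _ => dA y) cA.
rewrite in_itv /= => /andP[c0 c1]; rewrite (A0 0)// !subr0 mulr1 => A1E.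
have A1p : 0 < A 1 by rewrite A1E mulr_gt0 ?flat_gt0//; lra.
exists (fun x => (A 1)^-1 * A x); split.
- exact: smoothZ.
- by move=> x x0; rewrite (A0 x x0) mulr0.
- by move=> x x1; rewrite (A1 x x1) mulVf// gt_eqF.
Qed.

Lemma smooth_plateau : exists c : R -> R, [/\ smooth c,
  forall x, `|x| <= 1 -> c x = 1 & forall x, 2 <= `|x| -> c x = 0].
Proof.
have [s [ss s0 s1]] := smooth_step.
exists (fun x => s (2 + 1 * x) * s (2 + -1 * x)); split.
- by apply: smoothM; exact: smooth_affine.
- by move=> x; rewrite ler_norml => /andP[? ?]; rewrite !s1 ?mulr1//; lra.
- move=> x; rewrite ler_normr => /orP[] x2.
    by rewrite [X in _ * X]s0 ?mulr0//; lra.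
  by rewrite [X in X * _]s0 ?mul0r//; lra.
Qed.

End Primitive.

(** * Smooth functions and test functions in the plane *)

Section Smooth2.
Variable R : realType.
Implicit Types (f g phi : R * R -> R) (U : set (R * R)).

Lemma partial_slice0 f (x : R * R) l :
  is_derive x (dirE R 0) f l <-> is_derive x.1 1 (fun t => f (t, x.2)) l.
Proof.
have E : (fun h : R => h^-1 *: ((f \o shift x) (h *: dirE R 0) - f x)) =
   (fun h : R => h^-1 *: (((fun t => f (t, x.2)) \o shift x.1) (h *: 1) -
     (fun t => f (t, x.2)) x.1)).
  apply/funext => h; rewrite /= /dirE eqxx.
  by congr (_ *: (f _ - f _)); case: x => a b //; congr pair; rewrite /= scaler0 add0r.
by split => -[d1 d2]; apply: DeriveDef; move: d1 d2; rewrite /derivable /derive ?E.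
Qed.

Lemma partial_slice1 f (x : R * R) l :
  is_derive x (dirE R 1) f l <-> is_derive x.2 1 (fun t => f (x.1, t)) l.
Proof.
have E : (fun h : R => h^-1 *: ((f \o shift x) (h *: dirE R 1) - f x)) =
   (fun h : R => h^-1 *: (((fun t => f (x.1, t)) \o shift x.2) (h *: 1) -
     (fun t => f (x.1, t)) x.2)).
  apply/funext => h; rewrite /= /dirE /=.
  by congr (_ *: (f _ - f _)); case: x => a b //; congr pair; rewrite /= scaler0 add0r.
by split => -[d1 d2]; apply: DeriveDef; move: d1 d2; rewrite /derivable /derive ?E.
Qed.

Lemma partialE i f x l : is_derive x (dirE R i) f l -> partial i f x = l.
Proof. by move=> ?; rewrite /partial derive_val. Qed.

Lemma is_partial i f x : derivable f x (dirE R i) ->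
  is_derive x (dirE R i) f (partial i f x).
Proof. exact: derivableP. Qed.

Lemma Ck_onW k U f : Ck_on k.+1 U f -> Ck_on k U f.
Proof.
elim: k f => [|k IH] f; first by case.
move=> [cf df]; split => // i; have [d1 d2] := df i.
by split => //; exact: IH.
Qed.

Lemma Ck_on_continuous k f : Ck_on k setT f -> continuous f.
Proof. by case: k => [|k] [cf _] x; exact: cf. Qed.

Lemma Ck_on_step k f (f' : 'I_2 -> R * R -> R) : continuous f ->
  (forall i x, is_derive x (dirE R i) f (f' i x)) -> (forall i, Ck_on k setT (f' i)) ->
  Ck_on k.+1 setT f.
Proof.
move=> cf df cf'; split; first by move=> x _; exact: cf.
move=> i; split; first by move=> x _; have [] := df i x.
suff -> : partial i f = f' i by [].
by apply/funext => x; exact: partialE.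
Qed.

Lemma Ck_on0 f : continuous f -> Ck_on 0 setT f.
Proof. by move=> cf; split => // x _; exact: cf. Qed.

Lemma Ck_onD k f g : Ck_on k setT f -> Ck_on k setT g ->
  Ck_on k setT (fun x => f x + g x).
Proof.
elim: k f g => [|k IH] f g hf hg.
  apply: Ck_on0 => x.
  by apply: cvgD; [exact: (Ck_on_continuous hf)|exact: (Ck_on_continuous hg)].
have [cf df] := hf; have [cg dg] := hg.
apply: (@Ck_on_step k _ (fun i x => partial i f x + partial i g x)).
- by move=> x; apply: cvgD; [exact: cf|exact: cg].
- by move=> i x; apply: is_deriveD; apply: is_partial; [apply (df i).1|apply (dg i).1].
- by move=> i; apply: IH; [apply (df i).2|apply (dg i).2].
Qed.

Lemma Ck_onM k f g : Ck_on k setT f -> Ck_on k setT g ->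
  Ck_on k setT (fun x => f x * g x).
Proof.
elim: k f g => [|k IH] f g hf hg.
  apply: Ck_on0 => x.
  by apply: cvgM; [exact: (Ck_on_continuous hf)|exact: (Ck_on_continuous hg)].
have [cf df] := hf; have [cg dg] := hg.
apply: (@Ck_on_step k _ (fun i x => f x * partial i g x + g x * partial i f x)).
- by move=> x; apply: cvgM; [exact: cf|exact: cg].
- by move=> i x; apply: is_deriveM; apply: is_partial; [apply (df i).1|apply (dg i).1].
- move=> i; apply: Ck_onD; apply: IH; try exact: Ck_onW.
    by apply (dg i).2.
  by apply (df i).2.
Qed.

Definition smooth2 f := forall k, Ck_on k setT f.

Lemma smooth2M f g : smooth2 f -> smooth2 g -> smooth2 (fun x => f x * g x).
Proof. by move=> sf sg k; exact: Ck_onM. Qed.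

Lemma smooth2_continuous f : smooth2 f -> continuous f.
Proof. by move=> /(_ 0%N) /Ck_on_continuous. Qed.

Lemma smooth2_partial i f : smooth2 f -> smooth2 (partial i f).
Proof. by move=> sf k; have [_ /(_ i)[]] := sf k.+1. Qed.

Lemma smooth2_is_partial i f x : smooth2 f -> is_derive x (dirE R i) f (partial i f x).
Proof. by move=> sf; apply: is_partial; have [_ /(_ i)[d _]] := sf 1%N; exact: d. Qed.

Lemma partialM i f g x : smooth2 f -> smooth2 g ->
  partial i (fun x => f x * g x) x = f x * partial i g x + g x * partial i f x.
Proof.
by move=> sf sg; apply: partialE; apply: is_deriveM; exact: smooth2_is_partial.
Qed.

(** Products of functions of one variable are enough as test functions, and
    reduce smoothness in the plane to smoothness on the line. *)
Definition tens (a b : R -> R) : R * R -> R := fun x => a x.1 * b x.2.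

Lemma is_partial_tens0 a b x : smooth a ->
  is_derive x (dirE R 0) (tens a b) (tens (derive1 a) b x).
Proof.
move=> sa; apply/partial_slice0; rewrite /tens /=.
have h := is_deriveM (smooth_is_derive x.1 sa) (is_derive_cst (b x.2) x.1 1).
by apply: (is_derive_eq h); rewrite scaler0 add0r /GRing.scale /= mulrC.
Qed.

Lemma is_partial_tens1 a b x : smooth b ->
  is_derive x (dirE R 1) (tens a b) (tens a (derive1 b) x).
Proof.
move=> sb; apply/partial_slice1; rewrite /tens /=.
have h := is_deriveM (is_derive_cst (a x.1) x.2 1) (smooth_is_derive x.2 sb).
by apply: (is_derive_eq h); rewrite scaler0 addr0 /GRing.scale.
Qed.

Lemma continuous_tens a b : continuous a -> continuous b -> continuous (tens a b).
Proof.
move=> ca cb x; apply: (@cvgM _ _ _ _ (fun x : R * R => a x.1) (fun x => b x.2)).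
  by apply: (@continuous_comp _ _ _ fst a); [exact: cvg_fst|exact: ca].
by apply: (@continuous_comp _ _ _ snd b); [exact: cvg_snd|exact: cb].
Qed.

Lemma smooth2_tens a b : smooth a -> smooth b -> smooth2 (tens a b).
Proof.
move=> sa sb k; elim: k a b sa sb => [|k IH] a b sa sb.
  by apply: Ck_on0; apply: continuous_tens; exact: smooth_continuous.
apply: (@Ck_on_step k _ (fun i => if i == 0 then tens (derive1 a) b else tens a (derive1 b))).
- by apply: continuous_tens; exact: smooth_continuous.
- move=> i x; have [->|i0] := eqVneq i 0; first exact: is_partial_tens0.
  have -> : i = 1 by apply/val_inj; move: i i0 => [[|[|]]].
  exact: is_partial_tens1.
- by move=> i; case: ifP => _; apply: IH => //; exact: smooth_derive.
Qed.

Lemma is_partial_affine i f x (p : R * R) (c : R) l :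
  is_derive (p + c *: x) (dirE R i) f l ->
  is_derive x (dirE R i) (fun x => f (p + c *: x)) (c * l).
Proof.
have [->|i0] := eqVneq i 0.
  move=> /partial_slice0 d; apply/partial_slice0; rewrite mulrC.
  exact: (@is_derive1_comp R (fun t => f (t, p.2 + c * x.2)) (fun t : R => p.1 + c * t)
     x.1 l c d (is_derive_affine _ _ _)).
have -> : i = 1 by apply/val_inj; move: i i0 => [[|[|]]].
move=> /partial_slice1 d; apply/partial_slice1; rewrite mulrC.
exact: (@is_derive1_comp R (fun t => f (p.1 + c * x.1, t)) (fun t : R => p.2 + c * t)
     x.2 l c d (is_derive_affine _ _ _)).
Qed.

Lemma continuous_affine2 (p : R * R) (c : R) : continuous (fun x : R * R => p + c *: x).
Proof.
by move=> x; apply: cvgD; [exact: cvg_cst|apply: cvgZr; exact: cvg_id].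
Qed.

Lemma smooth2_affine f (p : R * R) (c : R) : smooth2 f -> smooth2 (fun x => f (p + c *: x)).
Proof.
move=> sf k; elim: k f sf => [|k IH] f sf.
  apply: Ck_on0 => x; apply: (@continuous_comp (R * R)%type (R * R)%type R (fun x : R * R => p + c *: x) f).
    exact: continuous_affine2.
  exact: smooth2_continuous.
apply: (@Ck_on_step k _ (fun i x => c * partial i f (p + c *: x))).
- move=> x; apply: (@continuous_comp (R * R)%type (R * R)%type R (fun x : R * R => p + c *: x) f).
    exact: continuous_affine2.
  exact: smooth2_continuous.
- by move=> i x; apply: is_partial_affine; exact: smooth2_is_partial.
- move=> i; apply: (@Ck_onM _ (cst c)); last by apply: IH; exact: smooth2_partial.
  have := smooth2_tens (fun n => Ck1_cst n c) (fun n => Ck1_cst n (1 : R)).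
  by move=> /(_ k); congr Ck_on; apply/funext => y; rewrite /tens /= mulr1.
Qed.

Lemma partial_affine i f x (p : R * R) (c : R) : smooth2 f ->
  partial i (fun x => f (p + c *: x)) x = c * partial i f (p + c *: x).
Proof.
by move=> sf; apply: partialE; apply: is_partial_affine; exact: smooth2_is_partial.
Qed.

(** With c = 0 this says that derivatives of a test function have the same
    support; with c = 1 it says that a cutoff has no gradient where it equals 1. *)
Lemma partial_out i (K : set (R * R)) phi c : closed K -> (forall x, ~ K x -> phi x = c) ->
  forall x, ~ K x -> partial i phi x = 0.
Proof.
move=> cK K0 x nKx; apply: partialE.
apply: (@near_eq_is_derive _ _ _ (cst c)).
have : nbhs x (~` K) by apply: open_nbhs_nbhs; split => //; exact: closed_openC.
by apply: filterS => y /K0 ->.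
Qed.

Lemma test_function_partial U phi i : test_function U phi -> test_function U (partial i phi).
Proof.
move=> [sp [K [cK KU K0]]]; split; first exact: smooth2_partial.
exists K; split => //; apply: partial_out K0.
exact: compact_closed (@hausdorff_plane R) cK.
Qed.

Lemma test_functionS U V phi : U `<=` V -> test_function U phi -> test_function V phi.
Proof.
by move=> UV [sp [K [cK KU K0]]]; split => //; exists K; split => //; exact: subset_trans UV.
Qed.

Lemma test_functionM U chi phi : test_function U chi -> smooth2 phi ->
  test_function U (fun x => chi x * phi x).
Proof.
move=> [sc [K [cK KU K0]]] sp; split; first exact: smooth2M.
by exists K; split => // x /K0 ->; rewrite mul0r.
Qed.

Lemma test_function_bounded U phi : test_function U phi ->
  exists2 M, 0 <= M & forall x, `|phi x| <= M.
Proof.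
move=> [sp [K [cK KU K0]]].
have : compact (phi @` K).
  apply: continuous_compact => //; apply: continuous_subspaceT.
  exact: smooth2_continuous.
move=> /compact_bounded[M [_ HM]].
exists (Num.max M 0 + 1); first by rewrite addr_ge0// le_max lexx orbT.
move=> x; have [Kx|nKx] := pselect (K x); last first.
  by rewrite K0// normr0 addr_ge0// le_max lexx orbT.
apply: (HM (Num.max M 0 + 1)); last by exists x.
by rewrite ltr_pwDr// le_max lexx.
Qed.

Lemma test_function_tens U a b (p q r s : R) : smooth a -> smooth b ->
  (forall x, x <= p -> a x = 0) -> (forall x, q <= x -> a x = 0) ->
  (forall x, x <= r -> b x = 0) -> (forall x, s <= x -> b x = 0) ->
  `[p, q]%classic `*` `[r, s]%classic `<=` U -> test_function U (tens a b).
Proof.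
move=> sa sb ap aq br bs KU; split; first exact: smooth2_tens.
exists (`[p, q]%classic `*` `[r, s]%classic); split => //.
  by apply: compact_setX; exact: segment_compact.
move=> x /=; rewrite !in_itv /= /tens => nK.
have [xp|px] := leP x.1 p; first by rewrite ap// mul0r.
have [qx|xq] := leP q x.1; first by rewrite aq// mul0r.
have [xr|rx] := leP x.2 r; first by rewrite br// mulr0.
have [sx|xs] := leP s x.2; first by rewrite bs// mulr0.
by exfalso; apply: nK; split; apply/andP; split; exact: ltW.
Qed.

End Smooth2.

(** * The fundamental lemma of the calculus of variations *)

Section FundamentalLemma.
Variable R : realType.
Notation mR := (measurableTypeR R).
Notation plane := (mR * mR)%type.
Implicit Types (U : set (R * R)) (h : plane -> R).

Lemma Lp_on1P (K : set (R * R)) h : measurable (K : set plane) ->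
  Lp_on 1 K h <-> leb2.-integrable (K : set plane) (EFin \o h).
Proof.
move=> mK; rewrite /Lp_on; split.
  by move=> /Lfun1_integrable; rewrite -restrict_EFin => /(integrable_mkcond _ mK).
move=> hi; apply/Lfun1_integrable; rewrite -restrict_EFin.
exact/(integrable_mkcond _ mK).
Qed.

Lemma integrable_compact U h K : Lp_loc 1 U h -> compact K -> K `<=` U ->
  leb2.-integrable (K : set plane) (EFin \o h).
Proof.
by move=> hl cK KU; apply/Lp_on1P; [exact: compact_measurable2|exact: hl].
Qed.

Lemma open_rect_setI (a b c d a' b' c' d' : R) :
  (`]a, b[%classic `*` `]c, d[%classic) `&` (`]a', b'[%classic `*` `]c', d'[%classic) =
  `](Num.max a a'), (Num.min b b')[%classic `*` `](Num.max c c'), (Num.min d d')[%classic.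
Proof.
by apply/seteqP; split => [x [[/= + +] [/= + +]]|x /= []];
  rewrite !in_itv /= !gt_max !lt_min;
  [move=> /andP[-> ->] /andP[-> ->] /andP[-> ->] /andP[-> ->]|
   move=> /andP[/andP[-> ->] /andP[-> ->]] /andP[/andP[-> ->] /andP[-> ->]]].
Qed.

Lemma open_rectsI : setI_closed (@open_rects R).
Proof.
move=> _ _ [a [b [c [d ->]]]] [a' [b' [c' [d' ->]]]].
by rewrite open_rect_setI; do 4 eexists; reflexivity.
Qed.

Lemma open_rects_measurable A : open_rects A -> measurable (A : set plane).
Proof.
by move=> [a [b [c [d ->]]]]; apply: measurable_rect; exact: measurable_itv.
Qed.

(** The open rectangles generate the Borel sets and are stable under
    intersection, so the integral of h over every Borel subset of Q vanishes by
    Dynkin's induction. *)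
Lemma ae_zero_open_rects (Q : set plane) h : open_rects Q ->
  leb2.-integrable Q (EFin \o h) ->
  (forall A, open_rects A -> (\int[leb2]_(x in A `&` Q) (h x)%:E = 0)%E) ->
  {ae leb2, forall x, Q x -> h x = 0}.
Proof.
move=> rQ hi h0; have mQ := open_rects_measurable rQ.
pose k : plane -> \bar R := (EFin \o h) \_ Q.
have ki : leb2.-integrable setT k by apply/(integrable_mkcond _ mQ).
have kE (A : set plane) : (\int[leb2]_(x in A) k x = \int[leb2]_(x in A `&` Q) (h x)%:E)%E.
  by rewrite /k -integral_mkcondr.
have kiS (A : set plane) : measurable A -> leb2.-integrable A k.
  by move=> mA; apply: integrableS ki.
suff H (S : set plane) : measurable S -> (\int[leb2]_(x in S) k x = 0)%E.
  have : ae_eq leb2 setT k (cst 0%E).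
    apply: integral_ae_eq => // E _ mE; rewrite H//.
    by rewrite integral_cst// mul0e.
  apply: filterS => x /(_ I); rewrite /k /= patchE => + Qx.
  by rewrite mem_set// => -[].
rewrite open_rectsE => mS; move: S mS.
apply: dynkin_induction; [exact: open_rectsE|exact: open_rectsI| | | |].
- by rewrite kE setTI -(setIid Q) h0.
- by move=> A rA; rewrite kE h0.
- move=> A mA A0; have mCA := measurableC mA.
  have : (\int[leb2]_x k x = 0)%E by rewrite kE setTI -(setIid Q) h0.
  rewrite -(setUv A) integral_setU//.
  + by rewrite A0 add0e.
  + by rewrite setUv; case/integrableP: ki.
  + by apply/disj_setPS => x [].
- move=> F mF tF F0; rewrite integral_bigcup//.
    by rewrite eseries0// => n _ _; exact: F0.
  by apply: kiS; exact: bigcupT_measurable.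
Qed.

Lemma flat_le1 (t : R) : flat 0 t <= 1.
Proof.
rewrite /flat; case: ltP => // t0; rewrite expr0 invr1 mul1r expR_le1.
by rewrite oppr_le0 invr_ge0 ltW.
Qed.

Lemma cvg_flat (t : R) : 0 < t -> flat 0 (n.+1%:R * t) @[n --> \oo] --> (1 : R).
Proof.
move=> t0.
have -> : (fun n => flat 0 (n.+1%:R * t)) = (fun n => expR (- (harmonic n * t^-1))).
  apply/funext => n; rewrite /flat mulr_gt0// expr0 invr1 mul1r invfM.
  by rewrite /harmonic.
have H : (- (harmonic n * t^-1) : R) @[n --> \oo] --> (- (0 * t^-1) : R).
  by apply: cvgN; apply: cvgMl; exact: cvg_harmonic.
rewrite mul0r oppr0 in H.
have := continuous_cvg _ (@continuous_expR R 0) H.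
by rewrite expR0; exact.
Qed.

(** Smooth functions of one variable with support in a nondegenerate segment;
    their primitives are constant on both sides of it. *)
Definition csmooth (a : R -> R) := smooth a /\ exists p q,
  [/\ p < q, forall x, x <= p -> a x = 0 & forall x, q <= x -> a x = 0].

(** As n grows these functions increase to the indicator of the open interval
    from a to b. *)
Definition bump (a b : R) (n : nat) : R -> R :=
  fun x => flat 0 (n.+1%:R * (x - a)) * flat 0 (n.+1%:R * (b - x)).

Lemma smooth_bump a b n : smooth (bump a b n).
Proof.
have H1 := @smooth_affine R _ n.+1%:R (- n.+1%:R * a) (@smooth_flat R 0).
have H2 := @smooth_affine R _ (- n.+1%:R) (n.+1%:R * b) (@smooth_flat R 0).
have := smoothM H1 H2; congr smooth; apply/funext => x; rewrite /bump.
by congr (flat _ _ * flat _ _); ring.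
Qed.

Lemma bumpl a b n x : x <= a -> bump a b n x = 0.
Proof. by move=> xa; rewrite /bump flatN ?mul0r// pmulr_rle0// subr_le0. Qed.

Lemma bumpr a b n x : b <= x -> bump a b n x = 0.
Proof. by move=> xa; rewrite /bump [X in _ * X]flatN ?mulr0// pmulr_rle0// subr_le0. Qed.

Lemma csmooth_bump a b n : csmooth (bump a b n).
Proof.
split; first exact: smooth_bump.
exists a, (Num.max (a + 1) b); split; first by rewrite lt_max ltrDl ltr01.
- by move=> x; exact: bumpl.
- by move=> x; rewrite ge_max => /andP[_]; exact: bumpr.
Qed.

Lemma bump_ge0 a b n x : 0 <= bump a b n x.
Proof. by rewrite mulr_ge0// flat_ge0. Qed.

Lemma bump_le1 a b n x : bump a b n x <= 1.
Proof. by rewrite /bump mulr_ile1 ?flat_ge0 ?flat_le1. Qed.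

Lemma cvg_bump a b x : a < x < b -> bump a b n x @[n --> \oo] --> (1 : R).
Proof.
move=> /andP[ax xb]; rewrite -[X in _ --> X](mulr1 (1 : R)).
by apply: cvgM; apply: cvg_flat; rewrite subr_gt0.
Qed.

(** Tensor products of bumps converge to the indicator of the rectangle with
    values in [0, 1], and h is integrable on the closed rectangle, whence the claim
    by dominated convergence. *)
Lemma integral_rect_zero U h (a b c d : R) : open U -> Lp_loc 1 U h ->
  (forall p q, csmooth p -> csmooth q -> test_function U (tens p q) ->
     \int[leb2]_(x in U) (h x * tens p q x) = 0) ->
  `[a, b]%classic `*` `[c, d]%classic `<=` U ->
  (\int[leb2]_(x in `]a, b[%classic `*` `]c, d[%classic) (h x)%:E = 0)%E.
Proof.
move=> oU hl h0 QU; set A := _ `*` _.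
have mU := open_measurable2 oU.
have rA : open_rects A by exists a, b, c, d.
have mA := open_rects_measurable rA.
have cQ : compact (`[a, b]%classic `*` `[c, d]%classic : set (R * R)).
  by apply: compact_setX; exact: segment_compact.
have AQ : A `<=` `[a, b]%classic `*` `[c, d]%classic.
  by move=> x [/subset_itv_oo_cc ? /subset_itv_oo_cc ?].
have hiQ := integrable_compact hl cQ QU.
have hi : leb2.-integrable A (EFin \o h).
  by apply: integrableS hiQ => //; exact: compact_measurable2.
have mh := integrable_measurable hi.
pose phi n := tens (bump a b n) (bump c d n).
have phi_out n x : ~ A x -> phi n x = 0.
  rewrite /A /= !in_itv /= /phi /tens => nA.
  have [xa|ax] := leP x.1 a; first by rewrite bumpl ?mul0r.
  have [bx|xb] := leP b x.1; first by rewrite bumpr ?mul0r.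
  have [xc|cx] := leP x.2 c; first by rewrite [X in _ * X]bumpl ?mulr0.
  have [dx|xd] := leP d x.2; first by rewrite [X in _ * X]bumpr ?mulr0.
  by exfalso; apply: nA; split; apply/andP.
have phi1 n x : `|phi n x| <= 1.
  have p1 := bump_ge0 a b n x.1; have p2 := bump_ge0 c d n x.2.
  rewrite /phi /tens ger0_norm; last exact: mulr_ge0.
  by apply: mulr_ile1 => //; exact: bump_le1.
have tphi n : test_function U (phi n).
  by apply: (test_function_tens (p := a) (q := b) (r := c) (s := d)) => // *;
    try exact: smooth_bump; try exact: bumpl; exact: bumpr.
have mphi n : measurable_fun (setT : set plane) (phi n).
  by apply: continuous_measurable2; apply: smooth2_continuous; case: (tphi n).
have hphii n : leb2.-integrable A (EFin \o (fun x => h x * phi n x)).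
  under [_ \o _]eq_fun do rewrite /= mulrC.
  by apply: (integrable_bounded_mul (M := 1)) => //; exact: measurable_funTS.
have int0 n : (\int[leb2]_(x in A) (h x * phi n x)%:E = 0)%E.
  have := h0 _ _ (csmooth_bump a b n) (csmooth_bump c d n) (tphi n).
  rewrite /Rintegral integral_mkcond.
  rewrite (_ : _ \_ U = (fun x => (h x * phi n x)%:E) \_ A); last first.
    apply/funext => x; rewrite !patchE.
    have [Ax|nAx] := pselect (A x).
      by rewrite !mem_set//; apply: QU; exact: AQ.
    rewrite [in RHS]memNset// -/(phi n) phi_out// mulr0.
    by case: ifP.
  rewrite -integral_mkcond => E.
  by rewrite -(fineK (integrable_fin_num mA (hphii n))) /= E.
have [] := @dominated_convergence _ _ _ leb2 A mA
  (fun n x => (h x * phi n x)%:E) (EFin \o h) (EFin \o (fun x => `|h x|)).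
- by move=> n; case/integrableP: (hphii n).
- exact/measurable_EFinP.
- apply/aeW => x Ax; apply: cvg_EFin.
    by apply: nearW.
  rewrite -[X in _ --> X]mulr1; apply: cvgMr; rewrite /= /phi /tens.
  move: Ax; rewrite /A /= !in_itv /= => -[ax cx].
  by rewrite -[X in _ --> X](mulr1 (1 : R)); apply: cvgM; apply: cvg_bump.
- exact: integrable_norm.
- apply/aeW => x n Ax /=; rewrite lee_fin normrM ler_piMr//.
- move=> _ _; under eq_fun do rewrite int0.
  by move=> /cvg_lim => /(_ (@ereal_hausdorff _)); rewrite lim_cst.
Qed.

(** It is enough to test against products of functions of one variable. This
    refinement is used in weak_translation, where the test function has to be
    integrated in the first variable. *)
Theorem fundamental_lemma U h : open U -> Lp_loc 1 U h ->
  (forall p q, csmooth p -> csmooth q -> test_function U (tens p q) ->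
     \int[leb2]_(x in U) (h x * tens p q x) = 0) ->
  {ae leb2, forall x, U x -> h x = 0}.
Proof.
move=> oU hl h0.
(* countably many null sets, one for each square with rational centre inside U *)
pose P (n : nat) (x : plane) := if unpickle n is Some q then
  ratsq q `<=` U -> osq (ratr q.1.1, ratr q.1.2) q.2.+1%:R^-1 x -> h x = 0 else True.
have : \forall x \ae leb2, forall n, P n x.
  apply: ae_foralln => n; rewrite /P; case: unpickle => [q|]; last exact: aeW.
  have [qU|nqU] := pselect (ratsq q `<=` U); last by apply: aeW => x /nqU.
  have rq : open_rects (osq (ratr q.1.1, ratr q.1.2) q.2.+1%:R^-1 : set plane).
    by do 4 eexists; reflexivity.
  suff : {ae leb2, forall x : plane,
      osq (ratr q.1.1, ratr q.1.2) q.2.+1%:R^-1 x -> h x = 0}.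
    by apply: filterS => x h1 _.
  apply: (ae_zero_open_rects rq).
  - apply: integrableS (integrable_compact hl (@csq_compact R _ _) qU).
    + exact: measurable_csq.
    + exact: open_rects_measurable.
    + exact: osq_csq.
  - move=> A [a [b [c [d ->]]]]; rewrite open_rect_setI.
    apply: (integral_rect_zero oU) => //; apply: subset_trans qU => x /=.
    rewrite !in_itv /= !ge_max !le_min => -[/andP[/andP[_ ?] /andP[_ ?]]].
    move=> /andP[/andP[_ ?] /andP[_ ?]].
    by split => /=; rewrite in_itv /=; apply/andP.
apply: filterS => x Px Ux; have [q [qU qx]] := ratsq_basis oU Ux.
by have := Px (pickle q); rewrite /P pickleK; exact.
Qed.

End FundamentalLemma.

(** * Weak gradients *)

Section WeakGradient.
Variable R : realType.
Notation mR := (measurableTypeR R).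
Notation plane := (mR * mR)%type.
Implicit Types (U V : set (R * R)) (h v phi : R * R -> R) (g : R * R -> 'cV[R]_2).

Lemma Rintegral_supp (U V : set plane) (f : plane -> R) :
  (forall x, U x -> ~ V x -> f x = 0) -> (forall x, V x -> ~ U x -> f x = 0) ->
  \int[leb2]_(x in U) f x = \int[leb2]_(x in V) f x.
Proof.
move=> UV VU; rewrite [LHS]Rintegral_mkcond [RHS]Rintegral_mkcond.
congr Rintegral; apply/funext => x; rewrite !patchE.
have [Ux|nUx] := pselect (U x); have [Vx|nVx] := pselect (V x).
- by rewrite !mem_set.
- by rewrite mem_set// memNset// UV.
- by rewrite memNset// mem_set// VU.
- by rewrite !memNset.
Qed.

Lemma Rintegral_setT (U : set plane) (f : plane -> R) :
  (forall x, ~ U x -> f x = 0) -> \int[leb2]_(x in U) f x = \int[leb2]_x f x.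
Proof. by move=> f0; apply: Rintegral_supp => x h1 h2; [case: h2|exact: f0]. Qed.

Lemma integrable_supp (U V : set plane) (f : plane -> R) :
  measurable U -> measurable V -> V `<=` U -> (forall x, U x -> ~ V x -> f x = 0) ->
  leb2.-integrable V (EFin \o f) -> leb2.-integrable U (EFin \o f).
Proof.
move=> mU mV VU f0 /(integrable_mkcond _ mV) fi; apply/(integrable_mkcond _ mU).
move: fi; congr integrable; apply/funext => x; rewrite !patchE.
have [Ux|nUx] := pselect (U x); have [Vx|nVx] := pselect (V x).
- by rewrite !mem_set.
- by rewrite (mem_set Ux) memNset//= f0.
- by exfalso; exact/nUx/VU.
- by rewrite !memNset.
Qed.

Lemma integrable_test U h phi : open U -> Lp_loc 1 U h -> test_function U phi ->
  leb2.-integrable (U : set plane) (EFin \o (fun x => h x * phi x)).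
Proof.
move=> oU hl tphi; have [M _ HM] := test_function_bounded tphi.
have [sphi [K [cK KU K0]]] := tphi.
have hK := integrable_compact hl cK KU.
have mK := compact_measurable2 cK.
apply: (@integrable_supp _ K) => //.
- exact: open_measurable2.
- by move=> x _ /K0 ->; rewrite mulr0.
under [_ \o _]eq_fun do rewrite /= mulrC.
apply: (integrable_bounded_mul (M := M)) => //.
by apply: measurable_funTS; apply: continuous_measurable2; exact: smooth2_continuous.
Qed.

Lemma Lp_loc1P U h : Lp_loc 1 U h <->
  (forall K, compact K -> K `<=` U -> leb2.-integrable (K : set plane) (EFin \o h)).
Proof.
split; first by move=> hl K cK KU; exact: integrable_compact hl cK KU.
by move=> H K cK KU; apply/Lp_on1P; [exact: compact_measurable2|exact: H].
Qed.

Lemma Lp_loc1_lin U h h' (a b : R) : Lp_loc 1 U h -> Lp_loc 1 U h' ->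
  Lp_loc 1 U (fun x => a * h x + b * h' x).
Proof.
move=> /Lp_loc1P H /Lp_loc1P H'; apply/Lp_loc1P => K cK KU.
have mK := compact_measurable2 cK.
by apply: integrableDR => //; apply: integrableZR => //; [exact: H|exact: H'].
Qed.

Lemma wgradP U v : (exists g, is_wgrad U v g) -> is_wgrad U v (wgrad U v).
Proof. by move=> [g Hg]; apply: (@xgetPex _ _ [set g | is_wgrad U v g]); exists g. Qed.

Lemma is_wgrad_unique U v g g' : open U -> is_wgrad U v g -> is_wgrad U v g' ->
  forall i, {ae leb2, forall x : plane, U x -> g x i 0 = g' x i 0}.
Proof.
move=> oU [vl Hg] [_ Hg'] i; have [gl gi] := Hg i; have [gl' gi'] := Hg' i.
have := @fundamental_lemma R U (fun x => 1 * g x i 0 + (-1) * g' x i 0) oU.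
move=> /(_ (Lp_loc1_lin _ _ gl gl')) H.
have {}H : {ae leb2, forall x : plane, U x -> 1 * g x i 0 + (-1) * g' x i 0 = 0}.
  apply: H => p q sp sq tpq.
  under eq_Rintegral do rewrite mulrDl -!mulrA mul1r mulN1r.
  have mU := open_measurable2 oU.
  rewrite RintegralB//; try exact: integrable_test.
  apply/eqP; rewrite subr_eq0 -eqr_opp; apply/eqP.
  by rewrite -gi// -gi'.
by apply: filterS H => x Hx /Hx; rewrite mul1r mulN1r => /eqP; rewrite subr_eq0 => /eqP.
Qed.

Lemma is_wgrad_lin U v v' g g' (a b : R) : open U -> is_wgrad U v g -> is_wgrad U v' g' ->
  is_wgrad U (fun x => a * v x + b * v' x) (fun x => a *: g x + b *: g' x).
Proof.
move=> oU [vl Hg] [vl' Hg']; split; first exact: Lp_loc1_lin.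
move=> i; have [gl gi] := Hg i; have [gl' gi'] := Hg' i.
have E : (fun x => (a *: g x + b *: g' x) i 0) = (fun x => a * g x i 0 + b * g' x i 0).
  by apply/funext => x; rewrite !mxE.
rewrite E; split; first exact: Lp_loc1_lin.
move=> phi tphi; have mU := open_measurable2 oU.
have tphi' := test_function_partial i tphi.
under eq_Rintegral do rewrite mulrDl -!mulrA.
rewrite RintegralD//; [|by apply: integrableZR => //; exact: integrable_test..].
rewrite !RintegralZl//; [|exact: integrable_test..].
rewrite gi// gi'//.
under [in RHS]eq_Rintegral do rewrite !mxE mulrDl -!mulrA.
rewrite RintegralD//; [|by apply: integrableZR => //; exact: integrable_test..].
rewrite !RintegralZl//; [|exact: integrable_test..].
by rewrite !mulrN opprD.
Qed.

Lemma is_wgradS U V v g : open V -> V `<=` U -> is_wgrad U v g -> is_wgrad V v g.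
Proof.
move=> oV VU [vl Hg]; split.
  by move=> K cK KV; apply: vl => //; exact: subset_trans VU.
move=> i; have [gl gi] := Hg i; split.
  by move=> K cK KV; apply: gl => //; exact: subset_trans VU.
move=> phi tphi; have := gi phi (test_functionS VU tphi).
have [_ [K [cK KV K0]]] := tphi.
have [_ [K' [cK' KV' K0']]] := test_function_partial i tphi.
rewrite (@Rintegral_supp U V) ?(@Rintegral_supp U V _)//.
- by move=> x _ nV; rewrite K0 ?mulr0// => /KV.
- by move=> x /VU.
- by move=> x _ nV; rewrite K0' ?mulr0// => /KV'.
- by move=> x /VU.
Qed.

(** An open set is a countable union of compact squares, on each of which
    local integrability gives measurability. *)
Lemma Lp_loc1_measurable U h : open U -> Lp_loc 1 U h -> measurable_fun (U : set plane) h.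
Proof.
move=> oU /Lp_loc1P hl; pose F (n : nat) : set plane :=
  if unpickle n is Some q then if `[< ratsq q `<=` U >] then ratsq q else set0 else set0.
have -> : U = \bigcup_n F n.
  apply/seteqP; split => [x /(ratsq_basis oU)[q [qU /osq_csq qx]]|x [n _]].
    by exists (pickle q); [exact: I|rewrite /F pickleK (asboolT qU)].
  rewrite /F; case: unpickle => // q; case: asboolP => // + qx; exact.
have mF n : measurable (F n).
  rewrite /F; case: unpickle => // q; case: asboolP => // _.
  exact: measurable_csq.
apply/measurable_fun_bigcup => // n.
rewrite /F; case: unpickle => [q|]; last exact: measurable_fun_set0.
case: asboolP => qU; last exact: measurable_fun_set0.
by apply: integrable_measurable; apply: hl => //; exact: csq_compact.
Qed.

Lemma Lp_on2P (U : set plane) v : measurable U -> Lp_on 2%:E U v <-> sqint leb2 U v.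
Proof.
move=> mU; rewrite /Lp_on.
have E : (fun x => (v x ^+ 2)%:E) \_ U = EFin \o (fun x => (v \_ U) x ^+ 2).
  by apply/funext => x; rewrite /= !patchE; case: ifP => // _; rewrite expr0n.
split.
  move=> H; split.
    apply/(measurable_restrictT _ mU).
    by have := sub_Lfun_mfun H; rewrite inE.
  by apply/(integrable_mkcond _ mU); rewrite E; exact: Lfun2_integrable_sqr.
move=> [mv /(integrable_mkcond _ mU)]; rewrite E => vi.
have mv' : measurable_fun setT (v \_ U) by exact/(measurable_restrictT _ mU).
rewrite inE; apply/andP; split; first by rewrite inE.
rewrite inE /= /finite_norm unlock /Lnorm poweR_lty//.
case/integrableP: vi => _; apply: le_lt_trans.
rewrite le_eqVlt; apply/orP; left; apply/eqP; apply: eq_integral => x _ /=.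
by rewrite powR_mulrn// normrX.
Qed.

Lemma sqint_integrable_fin (K : set plane) v : measurable K -> (leb2 K < +oo)%E ->
  sqint leb2 K v -> leb2.-integrable K (EFin \o v).
Proof.
move=> mK Kfin sv.
by have := sqintM mK sv (sqint_cst 1 mK Kfin); under [_ \o _]eq_fun do rewrite /= mulr1.
Qed.

Lemma sqint_loc1 U v : measurable (U : set plane) -> sqint leb2 U v ->
  Lp_loc 1 U v.
Proof.
move=> mU sv; apply/Lp_loc1P => K cK KU; have mK := compact_measurable2 cK.
apply: sqint_integrable_fin => //; last exact: sqintS sv.
by apply: leb2_bounded => //; exact: compact_bounded2.
Qed.

Lemma sqint_ae U v v' : measurable (U : set plane) -> measurable_fun (U : set plane) v' ->
  {ae leb2, forall x : plane, U x -> v x = v' x} -> sqint leb2 U v ->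
  sqint leb2 U v'.
Proof.
move=> mU mv' vv' [mv vi]; split => //.
apply/integrableP; split; first by apply/measurable_EFinP; exact: measurable_funX.
case/integrableP: vi => _; apply: le_lt_trans.
rewrite le_eqVlt; apply/orP; left; apply/eqP; apply: ae_eq_integral => //.
- by apply: measurableT_comp => //; apply/measurable_EFinP; exact: measurable_funX.
- by apply: measurableT_comp => //; apply/measurable_EFinP; exact: measurable_funX.
- by apply: filterS vv' => x H Ux /=; rewrite H.
Qed.

Lemma H1_elim U v : open U -> H1 U v ->
  [/\ sqint leb2 U v, is_wgrad U v (wgrad U v) &
      vsqint leb2 U (wgrad U v)].
Proof.
move=> oU [v2 /wgradP wv gv]; have mU := open_measurable2 oU.
by split=> // [|i]; exact/Lp_on2P.
Qed.

(** The chosen weak gradient inherits square-integrability from any other weak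
    gradient, as both agree almost everywhere. *)
Lemma wgrad_sqint U v g : open U -> is_wgrad U v g -> vsqint leb2 U g ->
  vsqint leb2 U (wgrad U v).
Proof.
move=> oU wg sg i; have mU := open_measurable2 oU.
have wg' := wgradP (ex_intro _ g wg); have [_ /(_ i)[gl _]] := wg'.
apply: sqint_ae (is_wgrad_unique oU wg wg' i) (sg i) => //.
exact: Lp_loc1_measurable.
Qed.

Lemma H1_intro U v g : open U -> sqint leb2 U v -> is_wgrad U v g ->
  vsqint leb2 U g -> H1 U v.
Proof.
move=> oU sv wg sg; have mU := open_measurable2 oU; split.
- exact/Lp_on2P.
- by exists g.
- by move=> i; apply/Lp_on2P => //; exact: wgrad_sqint wg sg i.
Qed.

Lemma BL_elim v : BL v -> [/\ Lp_loc 2%:E setT v, is_wgrad setT v (wgrad setT v) &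
  vsqint leb2 setT (wgrad setT v)].
Proof.
move=> [[v2 /wgradP wv _] gv]; split => // i.
by apply/Lp_on2P; [exact: measurableT|exact: gv].
Qed.

Lemma BL_intro v g : Lp_loc 2%:E setT v -> is_wgrad setT v g ->
  vsqint leb2 setT g -> BL v.
Proof.
move=> v2 wg sg; have sg' := wgrad_sqint openT wg sg.
split; last by move=> i; apply/Lp_on2P; [exact: measurableT|exact: sg'].
split => //; first by exists g.
move=> i K cK _; have mK := compact_measurable2 cK; apply/Lp_on2P => //.
by apply: sqintS (sg' i).
Qed.

End WeakGradient.

(** * Calculus of weak gradients *)

Section WeakGradientOperations.
Variable R : realType.
Notation mR := (measurableTypeR R).
Notation plane := (mR * mR)%type.
Implicit Types (U D : set (R * R)) (h v phi f : R * R -> R) (g : R * R -> 'cV[R]_2).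

Lemma affineK (p x : R * R) (a : R) : 0 < a -> - (a^-1 *: p) + a^-1 *: (p + a *: x) = x.
Proof.
by move=> a0; rewrite scalerDr addKr scalerA mulVf ?scale1r// gt_eqF.
Qed.

Lemma affineVK (p x : R * R) (a : R) : 0 < a -> p + a *: (- (a^-1 *: p) + a^-1 *: x) = x.
Proof.
move=> a0; rewrite scalerDr scalerN !scalerA divff ?gt_eqF// !scale1r.
by rewrite addrA subrr add0r.
Qed.

Lemma compact_affine (p : R * R) (a : R) (K : set (R * R)) : compact K -> compact [set p + a *: x | x in K].
Proof.
move=> cK; apply: (@continuous_compact _ _ (fun x : R * R => p + a *: x)) => //.
by apply: continuous_subspaceT; exact: continuous_affine2.
Qed.

Lemma Lp_loc1_affine h (p : R * R) (a : R) : 0 < a -> Lp_loc 1 setT h ->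
  Lp_loc 1 setT (fun x => h (p + a *: x)).
Proof.
move=> a0 /Lp_loc1P hl; apply/Lp_loc1P => K cK _; have mK := compact_measurable2 cK.
have cTK := @compact_affine p a _ cK; have mTK := compact_measurable2 cTK.
have := hl _ cTK (@subsetT _ _) => /(integrable_mkcond _ mTK).
rewrite restrict_EFin => /(integrable_affine p a0) hi.
apply: (eq_integrable mK) (integrableS measurableT mK (@subsetT _ _) hi) => x xK.
rewrite /= patchE mem_set//; exists x => //; exact: set_mem.
Qed.

Lemma test_function_affine phi (p : R * R) (a : R) : 0 < a -> test_function setT phi ->
  test_function setT (fun x => phi (p + a *: x)).
Proof.
move=> a0 [sphi [K [cK _ K0]]]; split; first exact: smooth2_affine.
exists [set - (a^-1 *: p) + a^-1 *: x | x in K]; split => //.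
  exact: compact_affine.
move=> x nx; apply: K0 => Kx; apply: nx; exists (p + a *: x) => //.
exact: affineK.
Qed.

(** The test function is transported by the inverse affine map, and both sides
    are integrated by substitution. *)
Lemma is_wgrad_affine v g (p : R * R) (a : R) : 0 < a -> is_wgrad setT v g ->
  is_wgrad setT (fun x => v (p + a *: x)) (fun x => a *: g (p + a *: x)).
Proof.
move=> a0 [vl Hg]; split; first exact: Lp_loc1_affine.
move=> i; have [gl gi] := Hg i.
have E : (fun x => (a *: g (p + a *: x)) i 0) = (fun x => a * g (p + a *: x) i 0).
  by apply/funext => x; rewrite mxE.
rewrite E; split.
  have := Lp_loc1_lin a 0 (Lp_loc1_affine p a0 gl) (Lp_loc1_affine p a0 gl).
  by congr Lp_loc; apply/funext => x; rewrite mul0r addr0.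
move=> phi tphi; pose psi x := phi (- (a^-1 *: p) + a^-1 *: x).
have tpsi : test_function setT psi by apply: test_function_affine; rewrite ?invr_gt0.
have phiE x : phi x = psi (p + a *: x) by rewrite /psi affineK.
have dphiE x : partial i phi x = a * partial i psi (p + a *: x).
  have -> : phi = (fun x => psi (p + a *: x)) by apply/funext.
  by rewrite partial_affine//; case: tpsi.
under eq_Rintegral do rewrite dphiE mulrCA.
under [in RHS]eq_Rintegral do rewrite phiE mxE -mulrA.
have i1 := integrable_test openT vl (test_function_partial i tpsi).
have i2 := integrable_test openT gl tpsi.
rewrite RintegralZl//; last exact: (integrable_affine p a0 i2).
rewrite RintegralZl//; last exact: (integrable_affine p a0 i1).
have e1 := Rintegral_affine p a0 i1; have e2 := Rintegral_affine p a0 i2.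
have := gi _ tpsi; rewrite e1 e2 -mulrN => /(mulfI _) -> //.
  by rewrite mulrN.
by rewrite expf_neq0// gt_eqF.
Qed.

(** After multiplication by a cutoff supported in D a function can be extended
    by zero to the plane, whatever its behaviour at the boundary of D. This turns the
    difference of two states into a test function for the corrector equation. *)
Lemma is_wgrad_cutoff D v g chi : open D -> is_wgrad D v g -> test_function D chi ->
  is_wgrad setT (fun x => chi x * v x) (fun x => chi x *: g x + v x *: grad chi x).
Proof.
move=> oD [vl Hg] tchi; have mD := open_measurable2 oD.
have [schi [K [cK KD K0]]] := tchi.
have clK := compact_closed (@hausdorff_plane R) cK.
have dK0 i := @partial_out R i K chi 0 clK K0.
have toT f : (forall x, ~ K x -> f x = 0) ->
    leb2.-integrable (D : set plane) (EFin \o f) -> leb2.-integrable setT (EFin \o f).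
  move=> f0; apply: integrable_supp => // x _ nDx; apply: f0 => Kx; exact/nDx/KD.
have toL f : (forall x, ~ K x -> f x = 0) ->
    leb2.-integrable (D : set plane) (EFin \o f) -> Lp_loc 1 setT f.
  move=> f0 /(toT _ f0) fi; apply/Lp_loc1P => K' cK' _.
  by apply: integrableS fi => //; exact: compact_measurable2.
have vphi h psi : Lp_loc 1 D h -> smooth2 psi ->
    leb2.-integrable (D : set plane) (EFin \o (fun x => h x * (chi x * psi x))).
  by move=> hl spsi; apply: integrable_test => //; exact: test_functionM.
split.
  apply: toL; first by move=> x /K0 ->; rewrite mul0r.
  by under [_ \o _]eq_fun do rewrite /= mulrC; exact: integrable_test.
move=> i; have [gl gi] := Hg i.
have E : (fun x => (chi x *: g x + v x *: grad chi x) i 0) =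
    (fun x => g x i 0 * chi x + v x * partial i chi x).
  by apply/funext => x; rewrite !mxE mulrC.
have tdchi := test_function_partial i tchi.
rewrite E; split.
  apply: toL; first by move=> x nKx; rewrite K0// dK0// !mulr0 addr0.
  by apply: integrableDR => //; exact: integrable_test.
move=> phi tphi; have sphi := tphi.1.
rewrite -(@Rintegral_setT _ D); last first.
  move=> x nDx; have nK : ~ K x by move/KD.
  by rewrite K0// !mul0r.
rewrite -(@Rintegral_setT _ D); last first.
  move=> x nDx; have nK : ~ K x by move/KD.
  by rewrite !mxE K0// dK0// !(mulr0, mul0r, addr0).
have tchiphi : test_function D (fun x => chi x * phi x) by exact: test_functionM.
have tphidchi : test_function D (fun x => partial i chi x * phi x).
  exact: test_functionM.
have i1 := integrable_test oD gl tchiphi.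
have i2 := integrable_test oD vl tphidchi.
have i3 := integrable_test oD vl (test_function_partial i tchiphi).
transitivity (\int[leb2]_(x in D) (v x * partial i (fun x => chi x * phi x) x) -
   \int[leb2]_(x in D) (v x * (partial i chi x * phi x))).
  rewrite -RintegralB//; apply: eq_Rintegral => x _.
  by rewrite partialM//; ring.
rewrite gi// -opprD -RintegralD//; congr (- _); apply: eq_Rintegral => x _.
by rewrite !mxE; ring.
Qed.

(** Both ends of the segment of integration lie outside the support. *)
Lemma int_derivative_zero (r r' : R -> R) (L : R) : 0 < L ->
  (forall t : R, is_derive t 1 r (r' t)) -> continuous r' ->
  (forall t, L <= `|t| -> r t = 0) -> (forall t, L <= `|t| -> r' t = 0) ->
  (\int[lebesgue_measure]_t (r' t)%:E = 0)%E.
Proof.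
move=> L0 dr cr' rL r'L.
have -> : (\int[lebesgue_measure]_t (r' t)%:E =
    \int[lebesgue_measure]_(t in `[(- L)%R, L]) (r' t)%:E)%E.
  rewrite [RHS]integral_mkcond; apply: eq_integral => t _.
  rewrite patchE; case: ifPn => //; rewrite notin_setE /= in_itv /= => /negP.
  by rewrite -ler_norml -ltNge => /ltW /r'L ->.
have LL : - L < L by lra.
have cr : continuous r.
  move=> t; apply/differentiable_continuous/derivable1_diffP.
  by have [] := dr t.
rewrite (continuous_FTC2 (F := r) LL).
- by rewrite !rL ?subee// ?normrN ger0_norm// ltW.
- exact: continuous_subspaceT.
- split; first by move=> t _; have [] := dr t.
    by apply: cvg_at_right_filter; exact: cr.
  by apply: cvg_at_left_filter; exact: cr.
- by move=> t _; rewrite derive1E derive_val.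
Qed.

(** Fubini's theorem, integrating first in the direction of the derivative. *)
Lemma integral_partial_zero i (p q : R * R -> R) (L : R) : 0 < L ->
  (forall x, is_derive x (dirE R i) p (q x)) -> continuous q ->
  (forall x, L <= `|x.1| \/ L <= `|x.2| -> p x = 0) ->
  (forall x, L <= `|x.1| \/ L <= `|x.2| -> q x = 0) ->
  leb2.-integrable (setT : set plane) (EFin \o q) ->
  \int[leb2]_x q x = 0.
Proof.
move=> L0 dp cq pL qL qi; rewrite /Rintegral.
suff -> : (\int[leb2]_x (q x)%:E = 0)%E by [].
have c1 y : continuous (fun t => q (t, y)).
  move=> t; have h : (fun s : R => (s, y)) @ t --> (t, y).
    move=> A [[B C] /= [nB nC] BC]; apply: filterS nB => s Bs; apply: BC.
    by split => //=; exact: nbhs_singleton nC.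
  exact: (cvg_comp _ _ h (cq (t, y))).
have c2 y : continuous (fun t => q (y, t)).
  move=> t; have h : (fun s : R => (y, s)) @ t --> (y, t).
    move=> A [[B C] /= [nB nC] BC]; apply: filterS nC => s Cs; apply: BC.
    by split => //=; exact: nbhs_singleton nB.
  exact: (cvg_comp _ _ h (cq (y, t))).
have [i0|i0] := eqVneq i 0.
  rewrite -(integral21_prod_meas1 (m1 := lebesgue_measure) (m2 := lebesgue_measure) qi).
  rewrite integral0_eq// => y _.
  apply: (int_derivative_zero (r := fun t => p (t, y)) L0).
  - by move=> t; apply/(partial_slice0 p (t, y)); rewrite -i0.
  - exact: c1.
  - by move=> t tL; apply: pL; left.
  - by move=> t tL; apply: qL; left.
have {}i0 : i = 1 by apply/val_inj; move: i i0 {dp} => [[|[|]]].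
rewrite -(integral12_prod_meas1 (m1 := lebesgue_measure) (m2 := lebesgue_measure) qi).
rewrite integral0_eq// => y _.
apply: (int_derivative_zero (r := fun t => p (y, t)) L0).
- by move=> t; apply/(partial_slice1 p (y, t)); rewrite -i0.
- exact: c2.
- by move=> t tL; apply: pL; right.
- by move=> t tL; apply: qL; right.
Qed.

Lemma continuous_on_loc1 U f : open U -> (forall x, U x -> {for x, continuous f}) ->
  Lp_loc 1 U f.
Proof.
move=> oU cf; apply/Lp_loc1P => K cK KU; have mK := compact_measurable2 cK.
apply: measurable_bounded_integrable => //.
- by apply: leb2_bounded => //; exact: compact_bounded2.
- by apply: (measurable_funS (open_measurable2 oU) KU); exact: continuous_on_measurable.
- have : compact (f @` K).
    apply: continuous_compact => //; apply: continuous_in_subspaceT => x.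
    by rewrite inE => /KU; exact: cf.
  by move=> /compact_bounded; rewrite /bounded_set /= => [[M [Mr HM]]];
    exists M; split => // y My x Kx; apply: HM => //; exists x.
Qed.

(** The product of f with a test function, extended by 0, has a continuous
    partial derivative on the whole plane, and the integral of that derivative
    vanishes. *)
Lemma is_wgrad_classical U f : open U -> Ck_on 1 U f -> is_wgrad U f (grad f).
Proof.
move=> oU [cf df]; split; first exact: continuous_on_loc1.
move=> i; have [dfi [cdf _]] := df i.
have E : (fun x => grad f x i 0) = partial i f by apply/funext => x; rewrite mxE.
rewrite E; have lf := continuous_on_loc1 oU cf; have ldf := continuous_on_loc1 oU cdf.
split => // phi tphi; have [sphi [K [cK KU K0]]] := tphi.
have clK := compact_closed (@hausdorff_plane R) cK.
have dK0 := @partial_out R i K phi 0 clK K0.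
have tdphi := test_function_partial i tphi.
have i1 := integrable_test oU lf tdphi; have i2 := integrable_test oU ldf tphi.
have mU := open_measurable2 oU.
apply/eqP; rewrite -addr_eq0; apply/eqP.
under [X in _ + X]eq_Rintegral do rewrite mxE.
rewrite -RintegralD//.
have [L L0 KL] := bounded_csq (compact_bounded2 cK).
have out x : L + 1 <= `|x.1| \/ L + 1 <= `|x.2| -> ~ K x.
  move=> H /KL /csqE /=; rewrite !subr0 => -[x1 x2].
  by case: H => /le_trans h; [have := h _ x1|have := h _ x2]; rewrite gerDl ler10.
have nearK x : ~ K x -> \forall y \near x, ~ K y.
  move=> nKx; have : nbhs x (~` K) by apply: open_nbhs_nbhs; split => //; exact: closed_openC.
  exact.
rewrite Rintegral_setT; last first.
  by move=> x nUx; have nKx : ~ K x by [move/KU]; rewrite K0// dK0// !mulr0 addr0.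
apply: (@integral_partial_zero i (fun x => f x * phi x) _ (L + 1)).
- by rewrite addr_gt0.
- move=> x; have [Kx|nKx] := pselect (K x).
    have h := is_deriveM (is_partial (dfi x (KU x Kx))) (smooth2_is_partial i x sphi).
    by apply: (is_derive_eq h); rewrite /GRing.scale /= [X in _ + X]mulrC.
  rewrite K0// dK0// !mulr0 addr0.
  apply: (@near_eq_is_derive _ _ _ (cst 0)).
  by near=> y; rewrite /= K0 ?mulr0//; near: y; exact: nearK.
- move=> x; have [Kx|nKx] := pselect (K x).
    apply: cvgD; apply: cvgM; try exact: cf (KU x Kx); try exact: cdf (KU x Kx).
    + exact: (smooth2_continuous (smooth2_partial i sphi)).
    + exact: smooth2_continuous.
  rewrite /continuous_at K0// dK0// !mulr0 addr0.
  apply: cvg_near_cst; near=> y.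
  have nKy : ~ K y by near: y; exact: nearK.
  by rewrite K0// dK0// !mulr0 addr0.
- by move=> x /out nKx; rewrite K0// mulr0.
- by move=> x /out nKx; rewrite K0// dK0// !mulr0 addr0.
- apply: (@integrable_supp _ _ U) => //.
    by move=> x _ nUx; have nKx : ~ K x by [move/KU]; rewrite K0// dK0// !mulr0 addr0.
  exact: integrableDR.
Unshelve. all: by end_near. Qed.

End WeakGradientOperations.

(** * Integrals along horizontal segments *)

Section Translation.
Variable R : realType.
Notation mR := (measurableTypeR R).
Notation plane := (mR * mR)%type.
Notation leb := (@lebesgue_measure R).

Lemma leb2_sigma_finite : sigma_finite setT (@leb2 R).
Proof.
exists (fun n => csq 0 n%:R : set plane).
  apply/esym; rewrite -subTset => x _.
  exists (Num.truncn `|x.1| + Num.truncn `|x.2|).+1 => //; apply/csqE.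
  rewrite /= !subr0; split; apply: ltW;
    [apply: lt_le_trans (truncnS_gt `|x.1|) _|apply: lt_le_trans (truncnS_gt `|x.2|) _];
    by rewrite ler_nat ltnS ?leq_addr ?leq_addl.
move=> n; split; first exact: measurable_csq.
by rewrite leb2_csq// ltry.
Qed.

(** The planar measure together with the proof that it is sigma-finite, as the
    theorems of Fubini and Tonelli on the product of the plane with the line ask for. *)
Definition leb2s : {sigma_finite_measure set plane -> \bar R} :=
  HB.pack_for (SigmaFiniteMeasure.type plane R) (Measure.sort (@leb2 R))
    (isSFinite.Build _ _ _ _ (sfinite_measure_sigma_finite leb2_sigma_finite))
    (isSigmaFinite.Build _ _ _ _ leb2_sigma_finite).

(** Horizontal translations are enough: they already move the centre of the
    corrector away from a bounded set. *)
Definition slide (x : plane) (s : mR) : plane := (x.1 + s, x.2).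

Lemma measurable_slide : measurable_fun setT (fun z : plane * mR => slide z.1 z.2).
Proof.
apply/measurable_fun_pairP; split.
  apply: measurable_funD => //.
  exact: (measurableT_comp measurable_fst measurable_fst).
exact: (measurableT_comp measurable_snd measurable_fst).
Qed.

Lemma measurable_slide1 x : measurable_fun setT (slide x).
Proof.
apply/measurable_fun_pairP; split; last exact: measurable_cst.
by apply: measurable_funD => //; exact: measurable_cst.
Qed.

Lemma measurable_slide2 s : measurable_fun setT (fun x => slide x s).
Proof.
apply/measurable_fun_pairP; split; last exact: measurable_snd.
by apply: measurable_funD => //; exact: measurable_cst.
Qed.

Lemma slideE x s : slide x s = (s, 0) + 1 *: (x : R * R).
Proof.
by case: x => a b; rewrite /slide scale1r /=; congr pair; rewrite /= ?add0r// addrC.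
Qed.

Lemma shift_integral (q : plane -> \bar R) s : measurable_fun setT q ->
  (forall x, 0 <= q x)%E -> (\int[leb2]_x q (slide x s) = \int[leb2]_x q x)%E.
Proof.
move=> mq q0; rewrite [RHS](ge0_integral_affine (s, 0) (@ltr01 R) mq q0).
by rewrite expr1n mul1e; apply: eq_integral => x _; rewrite slideE.
Qed.

Lemma shift_integrable (q : plane -> R) s : leb2.-integrable setT (EFin \o q) ->
  leb2.-integrable setT (EFin \o (fun x => q (slide x s))).
Proof.
move=> /(integrable_affine (s, 0) (@ltr01 R)); congr integrable.
by apply/funext => x; rewrite /= slideE.
Qed.

Lemma shift_Rintegral (q : plane -> R) s : leb2.-integrable setT (EFin \o q) ->
  \int[leb2]_x q (slide x s) = \int[leb2]_x q x.
Proof.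
move=> qi; rewrite [RHS](Rintegral_affine (s, 0) (@ltr01 R) qi) expr1n mul1r.
by apply: eq_Rintegral => x _; rewrite slideE.
Qed.

(** Dominated convergence along the complements of growing squares. *)
Lemma integrable_tail (f : plane -> R) (eta : R) : 0 < eta ->
  leb2.-integrable setT (EFin \o f) -> (forall x, 0 <= f x) ->
  exists2 M, 0 < M & forall r, M <= r -> \int[leb2]_(x in ~` csq 0 r) f x <= eta.
Proof.
move=> eta0 fi f0.
have mC r : measurable (~` csq 0 r : set plane) by apply: measurableC; exact: measurable_csq.
have mf := integrable_measurable fi.
have [] := @dominated_convergence _ _ _ leb2 setT measurableT
  (fun n x => ((f \_ (~` csq 0 n%:R)) x)%:E) (cst 0%E) (EFin \o f).
- move=> n; apply/measurable_EFinP; apply/(measurable_restrictT _ (mC _)).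
  exact: measurable_funTS.
- exact: measurable_cst.
- apply/aeW => x _; apply: cvg_near_cst.
  near=> n; rewrite patchE memNset//= => nx; apply: nx; apply/csqE; rewrite /= !subr0.
  split; apply: ltW; near: n; exact: nbhs_infty_gtr.
- exact: fi.
- apply/aeW => x n _ /=; rewrite lee_fin patchE; case: ifP => _.
    by rewrite ger0_norm.
  by rewrite normr0.
rewrite integral_cst// mul0e => _ _ /fine_cvgP[_].
move=> /cvgrPdist_le /(_ _ eta0)[N _ HN].
exists (N.+1%:R) => // r Nr.
have := HN N.+1 (leqnSn N).
rewrite /= sub0r normrN => H; apply: le_trans H.
rewrite [X in `|X|](_ : _ = \int[leb2]_(x in ~` csq 0 N.+1%:R) f x); last first.
  by rewrite [RHS]Rintegral_mkcond.
apply: (le_trans _ (ler_norm _)); rewrite /Rintegral fine_le//.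
- by apply: integrable_fin_num => //; exact: integrableS fi.
- by apply: integrable_fin_num => //; exact: integrableS fi.
- apply: ge0_subset_integral => //.
  + by apply/measurable_EFinP; exact: measurable_funTS.
  + by move=> x _; rewrite lee_fin.
  + move=> x nx /csqE[x1 x2]; apply: nx; apply/csqE.
    by split; [exact: le_trans x1 Nr|exact: le_trans x2 Nr].
Unshelve. all: by end_near. Qed.

Section Strip.
Variable h : R.
Hypothesis h0 : 0 < h.
Let I : set mR := `[0, h]%classic.

Let mI : measurable I. Proof. exact: measurable_itv. Qed.

Let lebI : leb I = h%:E.
Proof. by rewrite /I leb_cc ?subr0// ltW. Qed.

Let lebIfin : (leb I < +oo)%E. Proof. by rewrite lebI ltry. Qed.

Lemma measurable_slide_comp (t : mR -> mR) (q : plane -> \bar R) :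
  measurable_fun setT t -> measurable_fun setT q ->
  measurable_fun setT (fun z : plane * mR => q (slide z.1 (t z.2)) * (\1_I z.2)%:E)%E.
Proof.
move=> mt mq; apply: emeasurable_funM.
  apply: (measurableT_comp mq).
  have m2 : measurable_fun setT (fun z : plane * mR => (z.1, t z.2)).
    apply/measurable_fun_pairP; split; first exact: measurable_fst.
    exact: (measurableT_comp mt measurable_snd).
  exact: (measurableT_comp measurable_slide m2).
apply/measurable_EFinP.
exact: (measurableT_comp (measurable_indic mI) measurable_snd).
Qed.

Lemma integral_inI (q : mR -> \bar R) :
  (\int[leb]_(s in I) q s = \int[leb]_s (q s * (\1_I s)%:E))%E.
Proof.
rewrite integral_mkcond; apply: eq_integral => s _; rewrite patchE indicE.
by case: ifP => _; rewrite ?mule1 ?mule0.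
Qed.

(** For each s the inner integral over the plane does not depend on t(s), by
    translation invariance. The function t is the identity for the averages
    themselves and the opposite for their adjoints. *)
Lemma slide_tonelli (t : mR -> mR) (q : plane -> \bar R) :
  measurable_fun setT t -> measurable_fun setT q -> (forall x, 0 <= q x)%E ->
  (\int[leb2]_x \int[leb]_(s in I) q (slide x (t s)) = h%:E * \int[leb2]_x q x)%E.
Proof.
move=> mt mq q0.
pose F (z : plane * mR) : \bar R := ((q (slide z.1 (t z.2))) * (\1_I z.2)%:E)%E.
have mF : measurable_fun setT F by exact: (measurable_slide_comp mt mq).
have F0 z : (0 <= F z)%E by apply: mule_ge0 => //; rewrite lee_fin.
under eq_integral do rewrite integral_inI.
have := @fubini_tonelli _ _ _ _ R leb2s leb F mF F0.
move=> E; apply: (etrans E).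
transitivity (\int[leb]_s ((\int[leb2]_x q x) * (\1_I s)%:E))%E.
  apply: eq_integral => s _; rewrite /F /=.
  rewrite -[X in X = _]/(\int[leb2]_x (q (slide x (t s)) * (\1_I s)%:E))%E.
  rewrite ge0_integralZr//; first by rewrite shift_integral.
  - exact: (measurableT_comp mq (measurable_slide2 (t s))).
under eq_integral do rewrite muleC.
rewrite ge0_integralZr//.
- congr (_ * _)%E; rewrite integral_indic// setIT; exact: lebI.
- by apply/measurable_EFinP; exact: measurable_indic.
- exact: integral_ge0.
Qed.

Lemma integrable_slide (t : mR -> mR) (q : plane -> R) : measurable_fun setT t ->
  (forall x, 0 <= q x) -> leb2.-integrable setT (EFin \o q) ->
  (leb2s \x leb)%E.-integrable setT
    (EFin \o (fun z : plane * mR => q (slide z.1 (t z.2)) * \1_I z.2)).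
Proof.
move=> mt q0 qi; have [mq _] := integrableP _ _ _ qi.
apply/integrable12ltyP; first exact: (measurable_slide_comp mt mq).
have e (x : plane) : (\int[leb]_s `|(EFin \o (fun z : plane * mR =>
    (q (slide z.1 (t z.2)) * \1_I z.2)%R)) (x, s)| =
    \int[leb]_(s in I) (q (slide x (t s)))%:E)%E.
  rewrite integral_inI; apply: eq_integral => s _ /=.
  by rewrite -EFinM ger0_norm// mulr_ge0.
under eq_integral do rewrite e.
rewrite (slide_tonelli (q := EFin \o q) mt mq); last by move=> x; rewrite lee_fin.
by rewrite lte_mul_pinfty// ?lee_fin ?(ltW h0)//; exact: integrable_lty.
Qed.

Variable g : plane -> R.
Hypothesis sg : sqint leb2 setT g.
Let mg : measurable_fun setT g := sg.1.

(** Up to the factor h, the mean of g over the horizontal segment of length h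
    starting at x. *)
Definition steklov (x : plane) : R := \int[leb]_(s in I) g (slide x s).

Let N (x : plane) : \bar R := (\int[leb]_(s in I) (g (slide x s) ^+ 2)%:E)%E.

Let mgs x : measurable_fun I (fun s => g (slide x s)).
Proof. by apply: measurable_funTS; exact: (measurableT_comp mg (measurable_slide1 x)). Qed.

Let mg2 : measurable_fun setT (fun y => (g y ^+ 2)%:E).
Proof. by apply/measurable_EFinP; exact: measurable_funX. Qed.

Let g20 y : (0 <= (g y ^+ 2)%:E)%E.
Proof. by rewrite lee_fin sqr_ge0. Qed.

Let mid : measurable_fun setT (fun s : mR => s : mR). Proof. exact: measurable_id. Qed.

Let intN : (\int[leb2]_x N x = (h * l2n leb2 setT g ^+ 2)%:E)%E.
Proof.
rewrite /N (slide_tonelli mid mg2 g20) sqr_l2n EFinM; congr (_ * _)%E.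
by rewrite /Rintegral fineK//; apply: integrable_fin_num => //; exact: sg.2.
Qed.

Let measurable_inner (q : plane -> \bar R) : measurable_fun setT q ->
  (forall x, 0 <= q x)%E ->
  measurable_fun setT (fun x => \int[leb]_(s in I) q (slide x s))%E.
Proof.
move=> mq q0; have mF := measurable_slide_comp mid mq.
have := @measurable_fun_fubini_tonelli_F _ _ _ _ R leb _ mF.
have F0 (z : plane * mR) : (0 <= q (slide z.1 z.2) * (\1_I z.2)%:E)%E.
  by apply: mule_ge0 => //; rewrite lee_fin.
move=> /(_ F0); congr measurable_fun; apply/funext => x; rewrite /fubini_F.
by rewrite integral_inI.
Qed.

Let mN : measurable_fun setT N.
Proof. exact: (measurable_inner mg2 g20). Qed.

Let Nfin : {ae leb2, forall x, N x \is a fin_num}.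
Proof.
have Ni : leb2.-integrable setT N.
  apply/integrableP; split => //.
  under eq_integral do rewrite gee0_abs ?integral_ge0//.
  by rewrite intN ltry.
by have := integrable_ae measurableT Ni; apply: filterS => x /(_ Logic.I).
Qed.

Let Nsq x : N x \is a fin_num -> sqint leb I (fun s => g (slide x s)).
Proof.
move=> Nx; split; first exact: mgs.
apply/integrableP; split; first by apply/measurable_EFinP; exact: measurable_funX.
under eq_integral do rewrite gee0_abs ?g20//.
by rewrite -/(N x) ltey_eq Nx.
Qed.

Lemma ae_integrable_slide :
  {ae leb2, forall x, leb.-integrable I (EFin \o (fun s => g (slide x s)))}.
Proof.
apply: filterS Nfin => x Nx; have sI := Nsq Nx.
apply: (@le_integrableR _ _ _ _ _ _ (fun s => g (slide x s) ^+ 2 + 1)) => //.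
  by move=> s _; have := sqr_ge0 (`|g (slide x s)| - 1);
    have := real_normK (num_real (g (slide x s))); nra.
apply: integrableDR => //; first exact: sI.2.
exact: (integrable_cst_fin 1 mI lebIfin).
Qed.

Lemma measurable_steklov : measurable_fun setT steklov.
Proof.
have mgE : measurable_fun setT (EFin \o g) by apply/measurable_EFinP.
rewrite /steklov /Rintegral.
apply: (measurableT_comp (@fine_measurable R setT measurableT)).
under eq_fun do rewrite integralE.
apply: emeasurable_funB.
  have := measurable_inner (measurable_funepos mgE) (funepos_ge0 _).
  congr measurable_fun; apply/funext => x; apply: eq_integral => s _.
  by rewrite !funeposE.
have := measurable_inner (measurable_funeneg mgE) (funeneg_ge0 _).
congr measurable_fun; apply/funext => x; apply: eq_integral => s _.
by rewrite !funenegE.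
Qed.

(** Cauchy-Schwarz on the part of the segment that meets the support of g: if g
    vanishes off a vertical strip, the constant is the width c of the strip instead
    of the length h of the segment. *)
Lemma steklov_le (B : set mR) (c : R) x : 0 < c -> measurable B ->
  (forall y, ~ B y.1 -> g y = 0) ->
  (leb (I `&` [set s | B (x.1 + s)%R]) <= c%:E)%E ->
  ((steklov x ^+ 2)%:E <= c%:E * N x)%E.
Proof.
move=> c0 mB gB lec; have [Nx|Nx] := boolP (N x \is a fin_num); last first.
  have -> : N x = +oo%E.
    by move: Nx; rewrite ge0_fin_numE ?integral_ge0// -leNgt leye_eq => /eqP.
  by rewrite gt0_muley ?lte_fin// leey.
have mP : measurable [set s | B (x.1 + s)%R].
  have m1 : measurable_fun setT (fun s : mR => x.1 + s : mR).
    by apply: measurable_funD => //; exact: measurable_cst.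
  by rewrite -[X in measurable X]setTI; exact: m1.
set P := [set s | B (x.1 + s)%R] in lec mP.
pose J := I `&` P; have mJ : measurable J by exact: measurableI.
have sI := Nsq Nx; have sJ := sqintS mI mJ (@subIsetl _ _ _) sI.
have J_lty : (leb J < +oo)%E by exact: le_lt_trans lec (ltry _).
have s1 : sqint leb J (fun=> 1) by exact: sqint_cst.
have -> : steklov x = \int[leb]_(s in J) (1 * g (slide x s)).
  rewrite /J Rintegral_mkcondr; apply: eq_Rintegral => s _; rewrite patchE mul1r.
  by case: ifPn => //; rewrite notin_setE => nP; rewrite (gB (slide x s) nP).
have l1 : l2n leb J (fun=> 1) ^+ 2 <= c.
  rewrite sqr_l2n; under eq_Rintegral do rewrite expr1n.
  rewrite Rintegral_cst// mul1r -lee_fin fineK//.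
  by rewrite ge0_fin_numE.
have lN : ((l2n leb J (fun s => g (slide x s)) ^+ 2)%:E <= N x)%E.
  rewrite sqr_l2n /Rintegral fineK; last exact: integrable_fin_num sJ.2.
  apply: ge0_subset_integral => //; last exact: subIsetl.
  by apply/measurable_EFinP; apply: measurable_funX; exact: mgs.
rewrite -(fineK Nx) -EFinM lee_fin.
rewrite -(fineK Nx) lee_fin in lN.
apply: (@le_trans _ _ (l2n leb J (fun=> 1) ^+ 2 * l2n leb J (fun s => g (slide x s)) ^+ 2)).
  rewrite -exprMn -[leLHS]real_normK ?num_real//.
  rewrite ler_sqr ?nnegrE ?mulr_ge0 ?l2n_ge0//.
  apply: (le_trans (le_normr_Rintegral mJ (sqintM mJ s1 sJ))).
  exact: cauchy_schwarz.
by apply: ler_pM => //; exact: sqr_ge0.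
Qed.

(** Integration of steklov_le. Without information on the support one may take
    c = h, which gives a bound of order h^2; for a strip of fixed width the bound is
    only of order h, and this gain is the source of translation_small. *)
Lemma steklov_l2 (B : set mR) (c : R) : 0 < c -> measurable B ->
  (forall y, ~ B y.1 -> g y = 0) ->
  (forall a : R, leb (I `&` [set s | B (a + s)%R]) <= c%:E)%E ->
  sqint leb2 setT steklov /\ l2n leb2 setT steklov ^+ 2 <= c * (h * l2n leb2 setT g ^+ 2).
Proof.
move=> c0 mB gB lec.
have mS2 : measurable_fun setT (fun x => (steklov x ^+ 2)%:E).
  by apply/measurable_EFinP; apply: measurable_funX; exact: measurable_steklov.
have le : (\int[leb2]_x (steklov x ^+ 2)%:E <= (c * (h * l2n leb2 setT g ^+ 2))%:E)%E.
  apply: (@le_trans _ _ (\int[leb2]_x (c%:E * N x))%E).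
    apply: ge0_le_integral => //.
    - by move=> x _; rewrite lee_fin sqr_ge0.
    - exact: measurable_funeM.
    - by move=> x _; exact: (steklov_le c0 mB gB (lec x.1)).
  rewrite ge0_integralZl//; first by rewrite intN.
  - by move=> x _; exact: integral_ge0.
  - by rewrite lee_fin ltW.
have S2i : leb2.-integrable setT (EFin \o (fun x => steklov x ^+ 2)).
  apply/integrableP; split => //.
  under eq_integral do rewrite gee0_abs ?lee_fin ?sqr_ge0//.
  exact: le_lt_trans le (ltry _).
split; first by split => //; exact: measurable_steklov.
rewrite sqr_l2n -lee_fin /Rintegral fineK//; exact: integrable_fin_num.
Qed.

(** The adjoint of averaging to the right is averaging to the left. *)
Lemma steklov_fubini (phi Phi : plane -> R) (M : R) :
  measurable_fun setT phi -> (forall x, `|phi x| <= M) -> sqint leb2 setT phi ->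
  (forall x, Phi x = \int[leb]_(s in I) phi (slide x (- s))) ->
  \int[leb2]_x (steklov x * phi x) = \int[leb2]_x (g x * Phi x).
Proof.
move=> mphi phiM sphi PhiE.
have mN' : measurable_fun setT (fun s : mR => - s : mR).
  rewrite [X in measurable_fun _ X](_ : _ = (fun s : mR => 0 + -1 * s : mR)).
    exact: measurable_affine1.
  by apply/funext => s; rewrite add0r mulN1r.
have mI0 : measurable_fun setT (fun z : plane * mR => \1_I z.2 : R).
  exact: (measurableT_comp (measurable_indic mI) measurable_snd).
have m0 : measurable_fun setT (fun _ : mR => 0 : mR) by exact: measurable_cst.
have slide0 x : slide x 0 = x by case: x => a b; rewrite /slide addr0.
have indI s : (\1_I s : R) = (\1_I s) * (\1_I s).
  by rewrite indicE; case: (s \in I); rewrite ?mulr1 ?mulr0.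
pose F1 (z : plane * mR) := g (slide z.1 z.2) * phi z.1 * \1_I z.2.
pose F2 (z : plane * mR) := g z.1 * phi (slide z.1 (- z.2)) * \1_I z.2.
have sq t (q : plane -> R) : measurable_fun setT t -> sqint leb2 setT q ->
    sqint (leb2s \x leb)%E setT (fun z : plane * mR => q (slide z.1 (t z.2)) * \1_I z.2).
  move=> mt [mq qi]; split.
    apply/measurable_EFinP; apply: (measurable_slide_comp (q := EFin \o q) mt).
    exact/measurable_EFinP.
  have := integrable_slide mt (fun x => sqr_ge0 (q x)) qi.
  congr integrable; apply/funext => z; rewrite /= exprMn; congr (EFin (_ * _)).
  by rewrite expr2 -indI.
have iF1 : (leb2s \x leb)%E.-integrable setT (EFin \o F1).
  have := sqintM measurableT (sq _ _ mid sg) (sq _ _ m0 sphi).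
  congr integrable; apply/funext => z; rewrite /F1 /= slide0 [in RHS]indI.
  by congr EFin; ring.
have iF2 : (leb2s \x leb)%E.-integrable setT (EFin \o F2).
  have := sqintM measurableT (sq _ _ m0 sg) (sq _ _ mN' sphi).
  congr integrable; apply/funext => z; rewrite /F2 /= slide0 [in RHS]indI.
  by congr EFin; ring.
have swap1 := @Fubini _ _ _ _ R leb2s leb _ iF1.
have swap2 := @Fubini _ _ _ _ R leb2s leb _ iF2.
rewrite /Rintegral; congr fine.
transitivity (\int[leb2s]_x \int[leb]_s (F1 (x, s))%:E)%E.
  apply: ae_eq_integral => //.
  - apply/measurable_EFinP; apply: measurable_funM => //; exact: measurable_steklov.
  - exact: (measurable_fubini_F iF1).
  - apply: filterS ae_integrable_slide => x gi _.
    rewrite /steklov mulrC -RintegralZl// /Rintegral fineK; last first.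
      by apply: integrable_fin_num => //; exact: integrableZR.
    rewrite integral_inI; apply: eq_integral => s _.
    by rewrite /F1 /= -EFinM; congr EFin; ring.
apply: (etrans swap1).
transitivity (\int[leb]_s \int[leb2s]_x (F2 (x, s))%:E)%E.
  apply: eq_integral => s _.
  rewrite -[LHS]/(\int[leb2]_x (F1 (x, s))%:E)%E -[RHS]/(\int[leb2]_x (F2 (x, s))%:E)%E.
  have mphis : measurable_fun setT (fun x => phi (slide x (- s))).
    exact: (measurableT_comp mphi (measurable_slide2 (- s))).
  have qi : leb2.-integrable setT (EFin \o (fun x => F2 (x, s))).
    have sphis : sqint leb2 setT (fun x => phi (slide x (- s))).
      by split => //; exact: (shift_integrable (- s) sphi.2).
    have := integrableZR (\1_I s) measurableT (sqintM measurableT sg sphis).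
    by congr integrable; apply/funext => x; rewrite /F2 /= mulrC.
  have E := shift_Rintegral s qi.
  have e x : F2 (slide x s, s) = F1 (x, s).
    rewrite /F1 /F2 /=; congr (_ * phi _ * _).
    by case: x => a b; rewrite /slide /= addrK.
  have qi' := shift_integrable s qi.
  rewrite -(fineK (integrable_fin_num measurableT qi)).
  rewrite -[X in X%:E]/(\int[leb2]_x F2 (x, s)) -E /Rintegral fineK.
    by apply: eq_integral => x _; rewrite e.
  exact: integrable_fin_num.
apply: (etrans (esym swap2)).
apply: eq_integral => x _; rewrite PhiE.
have phii : leb.-integrable I (EFin \o (fun s => phi (slide x (- s)))).
  apply: measurable_bounded_integrable => //.
    apply: measurable_funTS; apply: (measurableT_comp mphi).
    exact: (measurableT_comp (measurable_slide1 x) mN').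
  apply: (@filterS _ _ _ (fun M' : R => M <= M')) => [M' M1 s' _|].
    exact: le_trans (phiM _) M1.
  by apply: nbhs_pinfty_ge; exact: num_real.
rewrite -RintegralZl// /Rintegral fineK; last first.
  by apply: integrable_fin_num => //; exact: integrableZR.
rewrite integral_inI; apply: eq_integral => s _.
by rewrite /F2 /= -EFinM; congr EFin; ring.
Qed.

End Strip.
Lemma steklovD (h : R) (g1 g2 : plane -> R) : 0 < h ->
  sqint leb2 setT g1 -> sqint leb2 setT g2 ->
  {ae leb2, forall x, steklov h (fun y => g1 y + g2 y) x = steklov h g1 x + steklov h g2 x}.
Proof.
move=> h0 s1 s2.
apply: filterS2 (ae_integrable_slide h0 s1) (ae_integrable_slide h0 s2) => x i1 i2.
by rewrite /steklov RintegralD//; exact: measurable_itv.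
Qed.

End Translation.

(** * Slow growth of the translates of a Beppo-Levi function *)

Section TranslationFormula.
Variable R : realType.
Notation mR := (measurableTypeR R).
Notation plane := (mR * mR)%type.
Notation leb := (@lebesgue_measure R).

Lemma slide_tens (p q : R -> R) (x : plane) (s : R) :
  tens p q (slide x s) = p (x.1 + s) * q x.2.
Proof. by []. Qed.

(** The left average of p is the difference of two values of a primitive of p.
    It has compact support although the primitive itself has not. *)
Lemma antiderivative_window (p q A : R -> R) (h : R) (x : plane) : 0 < h ->
  continuous p -> (forall t : R, is_derive t 1 A (p t)) ->
  tens (fun t => A t - A (t - h)) q x =
    \int[leb]_(s in `[0, h]%classic) tens p q (slide x (- s)).
Proof.
move=> h0 cp dA.
under eq_Rintegral do rewrite slide_tens mulrC.
have cps : continuous (fun s : R => p (x.1 - s)).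
  move=> s; apply: (@continuous_comp _ _ _ (fun s : R => x.1 - s) p); last exact: cp.
  by apply: cvgB; [exact: cvg_cst|exact: cvg_id].
have pi : leb.-integrable (`[0, h]%classic : set mR) (EFin \o (fun s => p (x.1 - s))).
  apply: continuous_compact_integrable; first exact: segment_compact.
  exact: continuous_subspaceT.
rewrite RintegralZl; [|exact: measurable_itv|exact: pi].
rewrite /tens mulrC; congr (_ * _).
pose F (s : R) := - A (x.1 + -1 * s).
have dF (s : R) : is_derive s 1 F (p (x.1 - s)).
  have d1 := is_derive_affine (-1) x.1 s.
  have d2 : is_derive s 1 (fun s : R => A (x.1 + -1 * s)) (p (x.1 + -1 * s) * -1).
    by apply: (@is_derive1_comp R A (fun s : R => x.1 + -1 * s)).
  have d3 := @is_deriveN _ _ _ _ _ _ _ d2.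
  by apply: (is_derive_eq d3); rewrite mulrN1 opprK mulN1r.
have cF : continuous F.
  move=> s; apply/differentiable_continuous/derivable1_diffP.
  by have [] := dF s.
rewrite /Rintegral (continuous_FTC2 (F := F) h0).
- by rewrite -EFinB /= /F mulr0 addr0 mulN1r opprK addrC.
- exact: continuous_subspaceT.
- split; first by move=> t _; have [] := dF t.
    by apply: cvg_at_right_filter; exact: cF.
  by apply: cvg_at_left_filter; exact: cF.
- by move=> t _; rewrite derive1E derive_val.
Qed.

(** The fundamental theorem of calculus for a function with a weak gradient.
    Tested against a product phi = p q, both sides become an integral of K against
    the first partial derivative of Phi, where Phi is the left average of phi. *)
Theorem weak_translation (K : R * R -> R) (G : R * R -> 'cV[R]_2) (h : R) : 0 < h ->
  is_wgrad setT K G -> sqint leb2 setT (fun x => G x 0 0) ->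
  {ae leb2, forall x : plane, K (slide x h) - K x = steklov h (fun x => G x 0 0) x}.
Proof.
move=> h0 wK sG; set g := (fun x => G x 0 0); set S := steklov h g.
have [Kl /(_ 0)[gl gi]] := wK.
have shE (f : plane -> R) s : (fun x => f (slide x s)) = (fun x => f ((s, 0) + 1 *: (x : R * R))).
  by apply/funext => x; rewrite slideE.
have Ksl : Lp_loc 1 setT (fun x => K (slide x h)).
  by rewrite shE; exact: Lp_loc1_affine.
have [sS _] : sqint leb2 setT S /\ l2n leb2 setT S ^+ 2 <= h * (h * l2n leb2 setT g ^+ 2).
  apply: (steklov_l2 h0 sG (B := setT)) => //; first by move=> y [].
  move=> a; rewrite (_ : _ `&` _ = `[0, h]%classic); last first.
    by apply/seteqP; split => s //=; case.
  by rewrite leb_cc ?subr0// ltW.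
have Sl : Lp_loc 1 setT S by apply: sqint_loc1.
have KKl := Lp_loc1_lin 1 (-1) Ksl Kl.
have H := @fundamental_lemma R setT _ openT (Lp_loc1_lin 1 (-1) KKl Sl).
suff : {ae leb2, forall x : plane, setT x ->
    1 * (1 * K (slide x h) + -1 * K x) + -1 * S x = 0}.
  apply: filterS => x /(_ Logic.I) /eqP; rewrite !mul1r !mulN1r subr_eq0 => /eqP.
  exact.
apply: H => p q [sp [a [b [ab pa pb]]]] [sq [c [d [cd qc qd]]]] tpq.
have [A [sA dA Aa Ab]] := compact_primitive ab sp pa pb.
set phi := tens p q in tpq *.
have [M _ phiM] := test_function_bounded tpq.
have cphi : continuous phi by exact: smooth2_continuous tpq.1.
have mphi : measurable_fun (setT : set plane) phi by exact: continuous_measurable2.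
have [_ [Q [cQ _ Q0]]] := tpq; have mQ := compact_measurable2 cQ.
have sphi : sqint leb2 setT phi.
  have phil : Lp_loc 1 setT phi by exact: continuous_on_loc1 openT (fun x _ => cphi x).
  by split => //; have := integrable_test openT phil tpq.
pose B t := A t - A (t - h).
pose Phi := tens B q.
have sB : smooth B.
  have h1 := smooth_affine 1 (- h) sA; have h2 := smoothZ (-1) h1.
  have := smoothD sA h2; congr smooth; apply/funext => t.
  by rewrite /B mulN1r mul1r addrC (addrC (- h)) addrC.
have tPhi : test_function setT Phi.
  apply: (test_function_tens (p := a) (q := b + h) (r := c) (s := d)) => //.
  - by move=> x xa; rewrite /B !Aa ?subrr//; lra.
  - by move=> x xb; rewrite /B (Ab x) ?(Ab (x - h)) ?subrr//; lra.
have dPhi x : partial 0 Phi x = phi x - phi (slide x (- h)).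
  have -> : partial 0 Phi x = tens (derive1 B) q x.
    by apply: partialE; exact: is_partial_tens0.
  rewrite /phi slide_tens /tens -mulrBl; congr (_ * _).
  rewrite derive1E.
  have d1 : is_derive x.1 1 (fun t : R => A (- h + 1 * t)) (p (- h + 1 * x.1) * 1).
    exact: (@is_derive1_comp R A (fun t : R => - h + 1 * t) _ _ _ (dA _)
      (is_derive_affine 1 (- h) x.1)).
  have d2 := is_deriveB (dA x.1) d1.
  have -> : B = (A - (fun t : R => A (- h + 1 * t))).
    by apply/funext => t; rewrite /B (_ : t - h = - h + 1 * t)//; ring.
  by rewrite derive_val mulr1 mul1r (addrC (- h)).
have mTT : measurable (setT : set plane) by [].
have iK := integrable_test openT Kl tpq.
have iKs := integrable_test openT Ksl tpq.
have iS := integrable_test openT Sl tpq.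
transitivity (\int[leb2]_x (K (slide x h) * phi x) - \int[leb2]_x (K x * phi x)
   - \int[leb2]_x (S x * phi x)).
  rewrite -RintegralB// -RintegralB//; last exact: integrableBR.
  by apply: eq_Rintegral => x _; ring.
have tphis : test_function setT (fun x : R * R => phi (slide x (- h))).
  by rewrite shE; exact: test_function_affine.
have iKp := integrable_test openT Kl tphis.
have -> : \int[leb2]_x (K (slide x h) * phi x) = \int[leb2]_x (K x * phi (slide x (- h))).
  rewrite -(shift_Rintegral h iKp); apply: eq_Rintegral => x _.
  by congr (_ * phi _); case: x => x1 x2; rewrite /slide /= addrK.
have -> : \int[leb2]_x (S x * phi x) = \int[leb2]_x (g x * Phi x).
  apply: (steklov_fubini h0 sG mphi phiM sphi) => x.
  exact: antiderivative_window h0 (smooth_continuous sp) dA.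
have E := gi _ tPhi; rewrite -/g in E.
have -> : \int[leb2]_x (g x * Phi x) = - \int[leb2]_x (K x * partial 0 Phi x).
  by rewrite E opprK.
rewrite opprK.
have -> : \int[leb2]_x (K x * partial 0 Phi x) =
    \int[leb2]_x (K x * phi x) - \int[leb2]_x (K x * phi (slide x (- h))).
  rewrite -RintegralB//; apply: eq_Rintegral => x _.
  by rewrite dPhi mulrBr.
by rewrite addrA subrK subrr.
Qed.

Lemma l2n_ae (f f' : plane -> R) : measurable_fun setT f -> measurable_fun setT f' ->
  {ae leb2, forall x : plane, f x = f' x} -> l2n leb2 setT f = l2n leb2 setT f'.
Proof.
move=> mf mf' ff'; rewrite /l2n /Rintegral; congr (Num.sqrt (fine _)).
apply: ae_eq_integral => //.
- by apply/measurable_EFinP; exact: measurable_funX.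
- by apply/measurable_EFinP; exact: measurable_funX.
- by apply: filterS ff' => x -> .
Qed.

(** If the first partial derivative G1 of K is square-integrable, then the
    difference of K with its translate by h is o(h) in L^2. Almost all the mass
    of G1 lies in a vertical strip |x1| <= M; the average of the part in the strip
    has squared norm O(M h), and the average of the remaining part has squared norm
    at most h^2 times a small mass. This replaces any inequality of Poincare type,
    and any pointwise decay of the corrector at infinity. *)
Theorem translation_small (K : R * R -> R) (G : R * R -> 'cV[R]_2) (eta : R) : 0 < eta ->
  is_wgrad setT K G -> sqint leb2 setT (fun x => G x 0 0) ->
  exists2 h0, 0 < h0 & forall h, h0 <= h ->
    sqint leb2 setT (fun x => K (slide x h) - K x) /\
    l2n leb2 setT (fun x => K (slide x h) - K x) ^+ 2 <= eta * h ^+ 2.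
Proof.
move=> eta0 wK sG; set g := (fun x => G x 0 0).
have e8 : 0 < eta / 8 by rewrite divr_gt0.
have [M M0 HM] := integrable_tail e8 sG.2 (fun x => sqr_ge0 (g x)).
pose B : set mR := `[- M, M]%classic.
have mB : measurable B by exact: measurable_itv.
pose P : set plane := [set x | B x.1].
have mP : measurable P.
  by have := measurable_rect mB (@measurableT _ mR); congr measurable;
    apply/seteqP; split => x //= -[].
pose gn x := g x * \1_P x; pose gf x := g x * \1_(~` P) x.
have gE : g = (fun x => gn x + gf x).
  apply/funext => x; rewrite /gn /gf -mulrDr !indicE in_setC.
  by case: (x \in P); rewrite ?addr0 ?add0r mulr1.
have ind_le (A : set plane) x : `|\1_A x : R| <= 1.
  by rewrite indicE; case: (x \in A); rewrite ?normr1 ?normr0.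
have sind (A : set plane) : measurable A -> sqint leb2 setT (fun x => g x * \1_A x).
  move=> mA; under [X in sqint _ _ X]eq_fun do rewrite mulrC.
  by apply: (sqint_bounded_mul (M := 1)) => //; exact: measurable_indic.
have sn : sqint leb2 setT gn by exact: sind.
have sf : sqint leb2 setT gf by apply: sind; exact: measurableC.
have fE : l2n leb2 setT gf ^+ 2 <= eta / 8.
  apply: le_trans (HM M (lexx _)); rewrite sqr_l2n.
  have -> : (fun x => gf x ^+ 2) = (fun x => g x ^+ 2) \_ (~` P).
    apply/funext => x; rewrite patchE /gf indicE.
    by case: ifP => _; rewrite ?mulr1// mulr0 expr0n.
  rewrite -Rintegral_mkcond.
  have mC : measurable (~` csq 0 M : set plane) by apply: measurableC; exact: measurable_csq.
  have mCP := measurableC mP.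
  have g2i := sG.2.
  rewrite /Rintegral fine_le//.
  - by apply: integrable_fin_num => //; exact: integrableS g2i.
  - by apply: integrable_fin_num => //; exact: integrableS g2i.
  - apply: ge0_subset_integral => //.
    + by apply/measurable_EFinP; apply: measurable_funTS; exact: measurable_funX sG.1.
    + by move=> x _; rewrite lee_fin sqr_ge0.
    + move=> x /= nB /csqE[+ _]; rewrite /= subr0 ler_norml => x1; apply: nB.
      by rewrite /P /= /B /= in_itv.
have nE : l2n leb2 setT gn <= l2n leb2 setT g.
  apply: le_l2n => // x _; rewrite /gn normrM ler_piMr//.
pose C := l2n leb2 setT g ^+ 2.
have C0 : 0 <= C by exact: sqr_ge0.
(* for these h the strip part, of order M h, is at most a fraction of eta h^2 *)
exists (Num.max 1 (8 * M * C / eta)); first by rewrite lt_max ltr01.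
move=> h; rewrite ge_max => /andP[h1 hC]; have h0 : 0 < h by exact: lt_le_trans h1.
have WT := weak_translation h0 wK sG.
have [sSn nSn] : sqint leb2 setT (steklov h gn) /\
    l2n leb2 setT (steklov h gn) ^+ 2 <= (2 * M) * (h * l2n leb2 setT gn ^+ 2).
  apply: (steklov_l2 h0 sn _ mB); first by rewrite mulr_gt0.
    by move=> y nBy; rewrite /gn indicE memNset ?mulr0.
  move=> a; have mJ : measurable (`[- M - a, M - a]%classic : set mR) by exact: measurable_itv.
  have -> : (2 * M)%:E = leb (`[- M - a, M - a]%classic : set mR).
    by rewrite leb_cc; [congr EFin; ring|lra].
  apply: le_measure; rewrite ?inE//.
  - apply: measurableI; first exact: measurable_itv.
    have m1 : measurable_fun setT (fun s : mR => a + s : mR).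
      by apply: measurable_funD => //; exact: measurable_cst.
    by rewrite -[X in measurable X]setTI; exact: m1.
  - move=> s [_]; rewrite /B /= !in_itv /= => /andP[? ?].
    by apply/andP; split; lra.
have [sSf nSf] : sqint leb2 setT (steklov h gf) /\
    l2n leb2 setT (steklov h gf) ^+ 2 <= h * (h * l2n leb2 setT gf ^+ 2).
  apply: (steklov_l2 h0 sf (B := setT)) => //; first by move=> y [].
  move=> a; rewrite (_ : _ `&` _ = `[0, h]%classic); last first.
    by apply/seteqP; split => s //=; case.
  by rewrite leb_cc ?subr0// ltW.
have sSS := sqintD measurableT sSn sSf.
have VE : {ae leb2, forall x : plane,
    steklov h gn x + steklov h gf x = K (slide x h) - K x}.
  apply: filterS2 WT (steklovD h0 sn sf) => x -> SE.
  by rewrite -SE -gE.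
have Kl := wK.1.
have mV : measurable_fun (setT : set plane) (fun x => K (slide x h) - K x).
  have Ksl : Lp_loc 1 setT (fun x => K (slide x h)).
    have -> : (fun x => K (slide x h)) = (fun x => K ((h, 0) + 1 *: (x : R * R))).
      by apply/funext => x; rewrite slideE.
    exact: Lp_loc1_affine.
  apply: measurable_funB; exact: Lp_loc1_measurable openT _.
split.
  have VE' : {ae leb2, forall x : plane, setT x ->
      steklov h gn x + steklov h gf x = K (slide x h) - K x}.
    by apply: filterS VE => x -> _.
  exact: (sqint_ae (U := setT) measurableT mV VE' sSS).
rewrite -(l2n_ae sSS.1 mV VE).
have := l2nD measurableT sSn sSf.
move: nSn nSf nE fE.
have := l2n_ge0 leb2 setT (steklov h gn); have := l2n_ge0 leb2 setT (steklov h gf).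
have := l2n_ge0 leb2 setT (fun x => steklov h gn x + steklov h gf x).
have := l2n_ge0 leb2 setT gn.
move: hC; rewrite /C; move: (l2n leb2 setT g) => c hC.
move: (l2n _ _ (fun x => _ + _)) => v.
move: (l2n _ _ (steklov h gn)) => sn'; move: (l2n _ _ (steklov h gf)) => sf'.
pose n := l2n leb2 setT gn; pose f := l2n leb2 setT gf; rewrite -/n -/f.
clearbody n f.
move=> n0 v0 f0 s0 nSn nSf nc f8 vs.
rewrite ler_pdivrMr// in hC.
have v2 : v ^+ 2 <= 2 * sn' ^+ 2 + 2 * sf' ^+ 2.
  have := sqr_ge0 (sn' - sf'); nra.
have n2 : n ^+ 2 <= c ^+ 2 by rewrite ler_sqr ?nnegrE// (le_trans n0).
have s1 : sn' ^+ 2 <= 2 * M * (h * c ^+ 2).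
  by apply: le_trans nSn _; rewrite ler_wpM2l ?mulr_ge0 ?(ltW M0)// ler_wpM2l// ltW.
have s2 : sf' ^+ 2 <= h ^+ 2 * (eta / 8).
  by apply: le_trans nSf _; rewrite mulrA -expr2 ler_wpM2l// sqr_ge0.
have s3 : h * (8 * M * c ^+ 2) <= h * (h * eta) by rewrite ler_wpM2l// ltW.
have e0 : 0 <= eta * h ^+ 2 by rewrite mulr_ge0 ?sqr_ge0// ltW.
move: v2 s1 s2 s3 e0; rewrite expr2; nra.
Qed.

End TranslationFormula.

(** * The state equation with and without the inclusion *)

Section Perturbation.
Variable R : realType.
Notation mR := (measurableTypeR R).
Notation plane := (mR * mR)%type.
Implicit Types (A B S D : set plane).

Lemma lamE (lin lout : R) A x : lam lin lout A x = lout + (lin - lout) * \1_A x.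
Proof.
by rewrite /lam indicE; case: (x \in A); rewrite ?mulr1 ?mulr0 ?addr0// addrC subrK.
Qed.

Lemma measurable_lam (lin lout : R) A D : measurable A -> measurable_fun D (lam lin lout A).
Proof.
move=> mA; rewrite (_ : lam lin lout A = (fun x => lout + (lin - lout) * \1_A x)); last first.
  by apply/funext => x; rewrite lamE.
apply: measurable_funD; first exact: measurable_cst.
by apply: measurable_funM; [exact: measurable_cst|exact: measurable_indic].
Qed.

Lemma lam_bound (alpha lin lout : R) A x : 0 < alpha -> 0 < lin -> lin < lout ->
  `|alpha * lam lin lout A x| <= alpha * lout.
Proof.
move=> a0 l0 ll; rewrite normrM gtr0_norm// ler_wpM2l ?(ltW a0)// /lam.
by case: ifP => _; rewrite gtr0_norm ?(ltW ll)// (lt_trans l0 ll).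
Qed.

Lemma lam_ge (lin lout : R) A x : lin < lout -> lin <= lam lin lout A x.
Proof. by move=> ll; rewrite /lam; case: ifP => // _; exact: ltW. Qed.

Lemma dotvDl (a b c : 'cV[R]_2) : dotv (a + b) c = dotv a c + dotv b c.
Proof. by rewrite !dotvE !mxE; ring. Qed.
Lemma dotvBl (a b c : 'cV[R]_2) : dotv (a - b) c = dotv a c - dotv b c.
Proof. by rewrite !dotvE !mxE; ring. Qed.
Lemma dotvC (a b : 'cV[R]_2) : dotv a b = dotv b a.
Proof. by rewrite !dotvE; ring. Qed.
Lemma dotvZl (k : R) (a c : 'cV[R]_2) : dotv (k *: a) c = k * dotv a c.
Proof. by rewrite !dotvE !mxE; ring. Qed.
Lemma dotvBr (a b c : 'cV[R]_2) : dotv c (a - b) = dotv c a - dotv c b.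
Proof. by rewrite dotvC dotvBl !(dotvC _ c). Qed.
Lemma dotvDr (a b c : 'cV[R]_2) : dotv c (a + b) = dotv c a + dotv c b.
Proof. by rewrite dotvC dotvDl !(dotvC _ c). Qed.
Lemma dotvZr (k : R) (a c : 'cV[R]_2) : dotv c (k *: a) = k * dotv c a.
Proof. by rewrite dotvC dotvZl dotvC. Qed.

Lemma vcauchy_schwarz1 S (g h : plane -> 'cV[R]_2) : measurable (S : set plane) ->
  vsqint leb2 S g -> vsqint leb2 S h ->
  `|\int[leb2]_(x in S) dotv (g x) (h x)| <= vn leb2 S g * vn leb2 S h.
Proof.
move=> mS sg sh.
have := vcauchy_schwarz mS (measurable_cst (1 : mR)) (M := 1) _ ler01 sg sh.
under eq_Rintegral do rewrite mul1r.
by rewrite mul1r; apply => x _; rewrite normr1.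
Qed.

Variables (D : set (R * R)) (alpha lin lout : R).
Hypotheses (oD : open D) (alpha0 : 0 < alpha) (lin0 : 0 < lin) (lin_lout : lin < lout).
Let mD : measurable (D : set plane) := open_measurable2 oD.

(** The bilinear form of the state equation. Functions and gradient fields are
    separate arguments, so that the form also applies to differences of states
    without choosing a weak gradient for the difference. *)
Definition aform A (g h : R * R -> 'cV[R]_2) (v w : R * R -> R) : R :=
  \int[leb2]_(x in D)
    (alpha * lam lin lout A x * dotv (g x) (h x) + v x * w x).

Lemma integrable_lam_dotv A E g h : measurable A -> measurable E -> vsqint leb2 E g ->
  vsqint leb2 E h ->
  leb2.-integrable E (EFin \o (fun x => alpha * lam lin lout A x * dotv (g x) (h x))).
Proof.
move=> mA mE sg sh.
apply: (@integrable_bounded_mul _ _ _ _ E (fun x => alpha * lam lin lout A x) _ (alpha * lout)) => //.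
- by apply: measurable_funM; [exact: measurable_cst|exact: measurable_lam].
- by move=> x _; exact: lam_bound.
- exact: integrable_dotv.
Qed.

Lemma integrable_aform A g h v w : measurable A ->
  vsqint leb2 D g -> vsqint leb2 D h -> sqint leb2 D v -> sqint leb2 D w ->
  leb2.-integrable (D : set plane)
    (EFin \o (fun x => alpha * lam lin lout A x * dotv (g x) (h x) + v x * w x)).
Proof.
move=> mA sg sh sv sw; apply: integrableDR => //; first exact: integrable_lam_dotv.
exact: sqintM.
Qed.

Lemma aformB A g g' h v v' w : measurable A ->
  vsqint leb2 D g -> vsqint leb2 D g' -> vsqint leb2 D h ->
  sqint leb2 D v -> sqint leb2 D v' -> sqint leb2 D w ->
  aform A (fun x => g x - g' x) h (fun x => v x - v' x) w =
  aform A g h v w - aform A g' h v' w.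
Proof.
move=> mA sg sg' sh sv sv' sw; rewrite /aform -RintegralB//; try exact: integrable_aform.
by apply: eq_Rintegral => x _; rewrite dotvBl; ring.
Qed.

Lemma aformC A g h v w : aform A g h v w = aform A h g w v.
Proof. by apply: eq_Rintegral => x _; rewrite dotvC [v x * _]mulrC. Qed.

(** On S, which does not meet A, the coefficient drops from lout to lin. *)
Lemma aform_perturb A S g h v w : measurable A -> measurable S -> A `&` S = set0 ->
  S `<=` D ->
  vsqint leb2 D g -> vsqint leb2 D h -> sqint leb2 D v -> sqint leb2 D w ->
  aform (A `|` S) g h v w =
  aform A g h v w + alpha * (lin - lout) * \int[leb2]_(x in S) dotv (g x) (h x).
Proof.
move=> mA mS AS SD sg sh sv sw.
have -> : \int[leb2]_(x in S) dotv (g x) (h x) =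
    \int[leb2]_(x in D) (\1_S x * dotv (g x) (h x)).
  rewrite [LHS]Rintegral_mkcond [RHS]Rintegral_mkcond; congr Rintegral.
  apply/funext => x; rewrite !patchE indicE.
  have [Sx|nSx] := boolP (x \in S).
    by rewrite mem_set ?mul1r//; apply: SD; exact: set_mem.
  by case: ifP; rewrite // mul0r.
have iS : leb2.-integrable (D : set plane) (EFin \o (fun x => \1_S x * dotv (g x) (h x))).
  apply: (@integrable_bounded_mul _ _ _ _ _ _ _ 1) => //.
  - by move=> x _; rewrite indicE; case: (x \in S); rewrite ?normr1 ?normr0.
  - exact: integrable_dotv.
rewrite /aform -RintegralZl// -RintegralD//; last 2 first.
- exact: integrable_aform.
- exact: integrableZR.
apply: eq_Rintegral => x _; rewrite !lamE !indicE in_setU.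
have : ~ (x \in A /\ x \in S).
  by rewrite !inE => -[Ax Sx]; have : (A `&` S) x by []; rewrite AS.
by case: (x \in A); case: (x \in S) => /= H; try (by exfalso; apply: H); ring.
Qed.

Variable f : R * R -> R.
Hypothesis sf : sqint leb2 D f.

Lemma stateP A u v : is_state D f alpha lin lout A u -> H1 D v ->
  aform A (wgrad D u) (wgrad D v) u v = \int[leb2]_(x in D) (f x * v x).
Proof. by move=> [_ H] /H. Qed.

(** The state tested against itself replaces the quadratic part of the cost by
    the work of f. *)
Lemma cost_state A u : measurable A -> is_state D f alpha lin lout A u ->
  cost D f alpha lin lout u A = 2^-1 * (\int[leb2]_(x in D) f x ^+ 2 -
    \int[leb2]_(x in D) (f x * u x)).
Proof.
move=> mA st; have [su _ sgu] := H1_elim oD st.1.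
have E := stateP st st.1.
have fu := sqintM mD sf su.
rewrite /cost; congr (_ * _).
transitivity (aform A (wgrad D u) (wgrad D u) u u + (\int[leb2]_(x in D) f x ^+ 2
   - 2 * \int[leb2]_(x in D) (f x * u x))); last by rewrite E; ring.
have i1 := integrable_aform mA sgu sgu su su.
have i2 := sf.2; have i3 := integrableZR 2 mD fu.
rewrite -RintegralZl// -RintegralB// /aform -RintegralD//; last exact: integrableBR.
by apply: eq_Rintegral => x _; ring.
Qed.

Variables (A S : set (R * R)) (u uS : R * R -> R).
Hypotheses (mA : measurable (A : set plane)) (mS : measurable (S : set plane)).
Hypotheses (AS : A `&` S = set0) (SD : S `<=` D).
Hypotheses (su : is_state D f alpha lin lout A u).
Hypotheses (suS : is_state D f alpha lin lout (A `|` S) uS).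
Let mAS : measurable (A `|` S : set plane). Proof. exact: measurableU. Qed.
Let g := wgrad D u.
Let gS := wgrad D uS.
Let Hu := H1_elim oD su.1.
Let HuS := H1_elim oD suS.1.
Let u2 : sqint leb2 D u. Proof. by case: Hu. Qed.
Let uS2 : sqint leb2 D uS. Proof. by case: HuS. Qed.
Let g2 : vsqint leb2 D g. Proof. by case: Hu. Qed.
Let gS2 : vsqint leb2 D gS. Proof. by case: HuS. Qed.
Let dg x := gS x - g x.
Let du x := uS x - u x.

(** Testing each of the two state equations with the other state, the form of
    the unperturbed problem cancels by symmetry and only the jump of the coefficient
    on S remains. *)
Lemma cost_difference :
  cost D f alpha lin lout uS (A `|` S) - cost D f alpha lin lout u A =
  alpha / 2 * (lin - lout) * \int[leb2]_(x in S) dotv (g x) (gS x).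
Proof.
rewrite (cost_state mAS suS) (cost_state mA su).
rewrite -(stateP su suS.1) -(stateP suS su.1) -/g -/gS aformC.
rewrite (aform_perturb mA mS AS SD)//.
rewrite (_ : \int[leb2]_(x in S) dotv (g x) (gS x) = \int[leb2]_(x in S) dotv (gS x) (g x)).
  by ring.
by apply: eq_Rintegral => x _; rewrite dotvC.
Qed.

Lemma difference_equation V : H1 D V ->
  aform (A `|` S) dg (wgrad D V) du V =
  alpha * (lout - lin) * \int[leb2]_(x in S) dotv (g x) (wgrad D V x).
Proof.
move=> HV; have [V2 _ gV2] := H1_elim oD HV.
rewrite /dg /du (aformB mAS)// (stateP suS HV) -(stateP su HV).
by rewrite (aform_perturb mA mS AS SD)//; ring.
Qed.

Let dg2 : vsqint leb2 D dg. Proof. exact: vsqintB. Qed.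
Let du2 : sqint leb2 D du. Proof. exact: sqintB. Qed.

Lemma energy_identity :
  aform (A `|` S) dg dg du du =
  alpha * (lout - lin) * \int[leb2]_(x in S) dotv (g x) (dg x).
Proof.
have -> : aform (A `|` S) dg dg du du = aform (A `|` S) gS dg uS du - aform (A `|` S) g dg u du.
  exact: aformB.
have := difference_equation suS.1; have := difference_equation su.1.
rewrite -/g -/gS !(aformC _ _ dg) => -> ->.
rewrite -mulrBr -RintegralB//.
- by congr (_ * _); apply: eq_Rintegral => x _; rewrite dotvBr.
- by apply: integrable_dotv; [exact: mS|exact: (vsqintS mD mS SD)|exact: (vsqintS mD mS SD)].
- by apply: integrable_dotv; [exact: mS|exact: (vsqintS mD mS SD)|exact: (vsqintS mD mS SD)].
Qed.

(** Coercivity of the form on the left of energy_identity and Cauchy-Schwarz on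
    its right. *)
Lemma energy_estimate :
  vn leb2 D dg <= (lout - lin) / lin * vn leb2 S g /\
  l2n leb2 D du ^+ 2 <=
    alpha * (lout - lin) ^+ 2 / lin * vn leb2 S g ^+ 2.
Proof.
have mSD h : vsqint leb2 D h -> vsqint leb2 S h.
  exact: vsqintS.
have lower : alpha * lin * vn leb2 D dg ^+ 2 + l2n leb2 D du ^+ 2
    <= aform (A `|` S) dg dg du du.
  rewrite sqr_vn sqr_l2n -RintegralZl//; last exact: integrable_dotv.
  rewrite -RintegralD//; last 2 first.
  - by apply: integrableZR => //; exact: integrable_dotv.
  - exact: du2.2.
  apply: le_Rintegral => //.
  - apply: integrableDR => //; last exact: du2.2.
    by apply: integrableZR => //; exact: integrable_dotv.
  - exact: integrable_aform.
  - move=> x _; rewrite expr2 lerD2r ler_wpM2r ?dotvv_ge0// ler_wpM2l ?(ltW alpha0)//.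
    exact: lam_ge.
have upper : `|\int[leb2]_(x in S) dotv (g x) (dg x)| <=
    vn leb2 S g * vn leb2 D dg.
  apply: le_trans (vcauchy_schwarz1 mS (mSD _ g2) (mSD _ dg2)) _.
  by rewrite ler_wpM2l ?vn_ge0// le_vnS.
rewrite energy_identity in lower.
have kap0 : 0 <= lout - lin by rewrite subr_ge0 ltW.
have := vn_ge0 leb2 (S : set plane) g; have := vn_ge0 leb2 (D : set plane) dg.
move: (vn leb2 S g) (vn leb2 D dg) upper lower => M N upper lower N0 M0.
have W2 := sqr_ge0 (l2n leb2 D du).
move: (l2n leb2 D du ^+ 2) lower W2 => W lower W0.
(* in the sequel N and M are the norms of dg on D and of g on S, W that of du, squared *)
have {upper}lower : alpha * lin * N ^+ 2 + W <= alpha * (lout - lin) * (M * N).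
  apply: le_trans lower _; rewrite ler_wpM2l ?mulr_ge0 ?(ltW alpha0)//.
  exact: le_trans (ler_norm _) upper.
have NM : N <= (lout - lin) / lin * M.
  move: N0; rewrite le_eqVlt => /predU1P[<-|N0].
    by rewrite !mulr_ge0// invr_ge0 ltW.
  have : alpha * N * (lin * N) <= alpha * N * ((lout - lin) * M).
    by apply: le_trans (_ : _ <= alpha * lin * N ^+ 2 + W) _;
      [rewrite -[leLHS]addr0 lerD// expr2; nra|apply: le_trans lower _; nra].
  rewrite ler_pM2l ?mulr_gt0// => H.
  by rewrite mulrAC ler_pdivlMr// mulrC.
split => //.
apply: (@le_trans _ _ (alpha * (lout - lin) * (M * N))).
  by apply: le_trans lower; rewrite lerDr !mulr_ge0// ?sqr_ge0// ltW.
apply: (@le_trans _ _ (alpha * (lout - lin) * (M * ((lout - lin) / lin * M)))).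
  by rewrite !ler_wpM2l ?mulr_ge0 ?(ltW alpha0).
by rewrite le_eqVlt; apply/orP; left; apply/eqP; field; rewrite gt_eqF.
Qed.

End Perturbation.

(** * The corrector equation on the scale of the inclusion *)

Section Corrector.
Variable R : realType.
Notation mR := (measurableTypeR R).
Notation plane := (mR * mR)%type.
Implicit Types (D E S omega : set plane) (G : R * R -> 'cV[R]_2).

Lemma sqint_affine (p : R * R) (a : R) (v : R * R -> R) : 0 < a ->
  sqint leb2 setT v ->
  sqint leb2 setT (fun x => v (p + a *: x)).
Proof.
move=> a0 [mv vi]; split; first exact: (measurableT_comp mv (measurable_affine p a)).
exact: (integrable_affine p a0 vi).
Qed.

Lemma sqr_l2n_affine (p : R * R) (a : R) (v : R * R -> R) : 0 < a ->
  sqint leb2 setT v ->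
  l2n leb2 setT (fun x => v (p + a *: x)) ^+ 2 =
  a ^- 2 * l2n leb2 setT v ^+ 2.
Proof.
move=> a0 [mv vi]; rewrite !sqr_l2n (Rintegral_affine p a0 vi) mulKf//.
by rewrite expf_neq0// gt_eqF.
Qed.

(** The map p + a x sends E out of a large square, hence only the tail of G
    counts; the factor is the Jacobian of the inverse map. *)
Lemma vn_affine_far (p : R * R) (a : R) G E r : 0 < a -> measurable E ->
  vsqint leb2 setT G -> (forall x, E x -> ~ csq 0 r (p + a *: x)) ->
  vsqint leb2 E (fun x => G (p + a *: x)) /\
  vn leb2 E (fun x => G (p + a *: x)) ^+ 2 <=
    a ^- 2 * \int[leb2]_(x in ~` (csq 0 r : set plane)) dotv (G x) (G x).
Proof.
move=> a0 mE sG far.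
have sGa : vsqint leb2 setT (fun x => G (p + a *: x)).
  by move=> i; exact: (sqint_affine p a0 (sG i)).
have sGE := vsqintS measurableT mE (subsetT E) sGa.
split=> //; rewrite sqr_vn.
have mF : measurable (~` (csq 0 r : set plane)) by apply: measurableC; exact: measurable_csq.
pose q x := \1_(~` (csq 0 r : set plane)) x * dotv (G x) (G x).
have iq : leb2.-integrable (setT : set plane) (EFin \o q).
  apply: (@integrable_bounded_mul _ _ _ _ _ _ _ 1) => //.
  - by move=> x _; rewrite indicE; case: (x \in _); rewrite ?normr1 ?normr0.
  - exact: integrable_dotv.
have -> : \int[leb2]_(x in ~` (csq 0 r : set plane)) dotv (G x) (G x) = \int[leb2]_x q x.
  rewrite [LHS]Rintegral_mkcond; apply: eq_Rintegral => x _.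
  by rewrite patchE /q indicE; case: ifP; rewrite ?mul1r ?mul0r.
rewrite (Rintegral_affine p a0 iq) mulKf ?expf_neq0 ?gt_eqF//.
rewrite [leLHS]Rintegral_mkcond; apply: le_Rintegral => //.
- by rewrite -restrict_EFin -integrable_mkcond//; exact: integrable_dotv.
- exact: (integrable_affine p a0 iq).
move=> x _; rewrite patchE /q indicE; case: ifPn => [/set_mem Ex|_].
  by rewrite mem_set ?mul1r//; exact: far.
by rewrite mulr_ge0// dotvv_ge0.
Qed.

Lemma Rintegral_ae D (h k : plane -> R) : measurable D -> measurable_fun D h ->
  measurable_fun D k -> {ae leb2, forall x : plane, D x -> h x = k x} ->
  \int[leb2]_(x in D) h x = \int[leb2]_(x in D) k x.
Proof.
move=> mD mh mk hk; congr fine; apply: ae_eq_integral => //.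
- exact/measurable_EFinP.
- exact/measurable_EFinP.
- by apply: filterS hk => x H Dx /=; rewrite H.
Qed.

Lemma ae_cV2 (U : set (R * R)) (g h : R * R -> 'cV[R]_2) :
  (forall i : 'I_2, {ae leb2, forall x : plane, U x -> g x i 0 = h x i 0}) ->
  {ae leb2, forall x : plane, U x -> g x = h x}.
Proof.
move=> H; apply: filterS2 (H 0) (H 1) => x H0 H1 Ux.
apply/matrixP => i j; rewrite ord1; case: i => -[|[|//]] /= i.
  by have := H0 Ux; congr (g x _ _ = h x _ _); exact: val_inj.
by have := H1 Ux; congr (g x _ _ = h x _ _); exact: val_inj.
Qed.

Lemma integrable_dotv_fin E (c : 'cV[R]_2) h : measurable E -> (leb2 E < +oo)%E ->
  vsqint leb2 E h -> leb2.-integrable E (EFin \o (fun x => dotv c (h x))).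
Proof.
move=> mE fE sh; under [_ \o _]eq_fun do rewrite /= dotvE.
by apply: integrableDR => //; apply: integrableZR => //; exact: sqint_integrable_fin (sh _).
Qed.

Lemma inclusionE (z : R * R) omega (eps : R) : 0 < eps ->
  inclusion z omega eps = (fun x => - (eps^-1 *: z) + eps^-1 *: x) @^-1` omega.
Proof.
move=> e0; apply/seteqP; split => [x [y oy <-]|x /= ox].
  by rewrite /preimage /= affineK.
by exists (- (eps^-1 *: z) + eps^-1 *: x) => //; rewrite affineVK.
Qed.

Lemma inclusion_affine (z : R * R) omega (eps : R) x : 0 < eps ->
  (z + eps *: x \in inclusion z omega eps) = (x \in omega).
Proof.
move=> e0; have E : inclusion z omega eps (z + eps *: x) <-> omega x.
  by rewrite inclusionE// /preimage /= affineK.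
by apply/idP/idP => /set_mem /E /mem_set.
Qed.

Lemma open_inclusion (z : R * R) (omega : set (R * R)) (eps : R) : 0 < eps -> open omega ->
  open (inclusion z omega eps).
Proof.
move=> e0 oo; rewrite inclusionE//; apply: open_comp => // x _.
exact: continuous_affine2.
Qed.

Lemma leb2_inclusion (z : R * R) omega (eps : R) : 0 < eps -> measurable omega ->
  leb2 (inclusion z omega eps : set plane) = ((eps ^+ 2)%:E * leb2 omega)%E.
Proof.
move=> e0 mo.
have mi : measurable (inclusion z omega eps : set plane).
  rewrite inclusionE// -[X in measurable X]setTI.
  exact: (measurable_affine _ _ measurableT mo).
rewrite (leb2_affine z e0 mi); congr (_ * leb2 _)%E.
apply/seteqP; split => x /=; rewrite inclusionE///preimage /= ?affineK//.
Qed.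

(** The test function v is pulled back to the scale of the reference inclusion,
    where its gradient is eps g. This factor eps and the Jacobian eps^2 are common to
    both sides. *)
Lemma corrector_scaled (alpha lin lout : R) (omega : set (R * R)) (eta : 'cV[R]_2)
    (K : R * R -> R) (z : R * R) (eps : R) (v : R * R -> R) (g : R * R -> 'cV[R]_2) :
  0 < alpha -> 0 < lin -> lin < lout -> (leb2 (omega : set plane) < +oo)%E ->
  is_corrector alpha lin lout omega eta K -> 0 < eps -> open omega ->
  sqint leb2 setT v -> is_wgrad setT v g ->
  vsqint leb2 setT g ->
  let S := inclusion z omega eps in
  let G x := wgrad setT K (- (eps^-1 *: z) + eps^-1 *: x) in
  \int[leb2]_x (alpha * lam lin lout S x * dotv (G x) (g x)) =
  alpha * (lout - lin) * \int[leb2]_(x in S) dotv eta (g x).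
Proof.
move=> alpha0 lin0 ll fo [HK HKe] e0 oo sv wg sg S G.
have [_ wK sK] := BL_elim HK.
have mo := open_measurable2 oo.
have e0' : 0 < eps^-1 by rewrite invr_gt0.
have mS : measurable (S : set plane) by apply: open_measurable2; exact: open_inclusion.
have wv' := is_wgrad_affine z e0 wg.
have sg' : vsqint leb2 setT (fun x => g (z + eps *: x)).
  by move=> i; exact: (sqint_affine z e0 (sg i)).
have seg' : vsqint leb2 setT (fun x => eps *: g (z + eps *: x)).
  move=> i; under [X in sqint _ _ X]eq_fun do rewrite mxE.
  exact: sqintZ.
have bv' : BL (fun x => v (z + eps *: x)).
  apply: (BL_intro _ wv' seg') => A cA _; apply/Lp_on2P; first exact: compact_measurable2.
  by apply: (sqintS measurableT (compact_measurable2 cA) (subsetT _)); exact: sqint_affine.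
have [_ wgv sgv] := BL_elim bv'.
have ae := ae_cV2 (is_wgrad_unique openT wgv wv').
have E1 : \int[leb2]_y (alpha * lam lin lout omega y *
      dotv (wgrad setT K y) (wgrad setT (fun x => v (z + eps *: x)) y)) =
    eps * \int[leb2]_y (alpha * lam lin lout omega y *
      dotv (wgrad setT K y) (g (z + eps *: y))).
  rewrite -RintegralZl//; last exact: integrable_lam_dotv.
  apply: Rintegral_ae => //.
  - exact: (integrable_measurable (integrable_lam_dotv alpha0 lin0 ll mo measurableT sK sgv)).
  - apply: measurable_funM => //.
    exact: (integrable_measurable (integrable_lam_dotv alpha0 lin0 ll mo measurableT sK sg')).
  - by apply: filterS ae => x /(_ Logic.I) ->; rewrite dotvZr mulrCA.
have E2 : \int[leb2]_(y in omega) dotv eta (wgrad setT (fun x => v (z + eps *: x)) y) =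
    eps * \int[leb2]_(y in omega) dotv eta (g (z + eps *: y)).
  have fin_om h : vsqint leb2 setT h -> vsqint leb2 omega h.
    exact: (vsqintS measurableT mo (subsetT _)).
  rewrite -RintegralZl//; last exact/integrable_dotv_fin/fin_om.
  apply: Rintegral_ae => //.
  - exact/integrable_measurable/integrable_dotv_fin/fin_om.
  - apply: measurable_funM => //.
    exact/integrable_measurable/integrable_dotv_fin/fin_om.
  - by apply: filterS ae => x /(_ Logic.I) -> _; rewrite dotvZr.
have := HKe _ bv'; rewrite E1 E2 => {E1 E2}E.
have sG : vsqint leb2 setT G.
  by move=> i; exact: (sqint_affine _ e0' (sK i)).
have fS : (leb2 (S : set plane) < +oo)%E.
  by rewrite leb2_inclusion// lte_mul_pinfty// lee_fin sqr_ge0.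
have Sz x := inclusion_affine z omega x e0; rewrite -/S in Sz.
rewrite (Rintegral_affine z e0 (integrable_lam_dotv alpha0 lin0 ll mS measurableT sG sg)).
pose q x := \1_(S : set plane) x * dotv eta (g x).
have -> : \int[leb2]_(x in S) dotv eta (g x) = \int[leb2]_x q x.
  rewrite [LHS]Rintegral_mkcond; apply: eq_Rintegral => x _.
  by rewrite patchE /q indicE; case: ifP; rewrite ?mul1r ?mul0r.
have iq : leb2.-integrable (setT : set plane) (EFin \o q).
  apply: (integrable_supp measurableT mS) => //.
    by move=> x _ nS; rewrite /q indicE memNset// mul0r.
  apply: (@integrable_bounded_mul _ _ _ _ _ _ _ 1) => //.
  - by move=> x _; rewrite indicE; case: (x \in _); rewrite ?normr1 ?normr0.
  - by apply: integrable_dotv_fin => //; exact: (vsqintS measurableT mS (subsetT _)).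
rewrite (Rintegral_affine z e0 iq).
have -> : \int[leb2]_x q (z + eps *: x) = \int[leb2]_(y in omega) dotv eta (g (z + eps *: y)).
  rewrite [RHS]Rintegral_mkcond; apply: eq_Rintegral => x _.
  by rewrite patchE /q indicE Sz; case: ifP; rewrite ?mul1r ?mul0r.
have -> : \int[leb2]_x (alpha * lam lin lout S (z + eps *: x) *
    dotv (G (z + eps *: x)) (g (z + eps *: x))) =
    \int[leb2]_y (alpha * lam lin lout omega y * dotv (wgrad setT K y) (g (z + eps *: y))).
  by apply: eq_Rintegral => x _; rewrite /lam Sz /G affineK.
rewrite expr2 -mulrA E; ring.
Qed.

End Corrector.

(** * Comparison of the perturbed state with the corrector *)

Section Comparison.
Variable R : realType.
Notation mR := (measurableTypeR R).
Notation plane := (mR * mR)%type.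
Implicit Types (A B S : set plane).

Lemma vnormE (a : 'cV[R]_2) : vnorm a = Num.sqrt (a 0 0 ^+ 2 + a 1 0 ^+ 2).
Proof. by rewrite /vnorm dotvE !expr2. Qed.

Lemma normr_entry (a : 'cV[R]_2) i : `|a i 0| <= vnorm a.
Proof.
rewrite vnormE -sqrtr_sqr; apply: ler_wsqrtr.
case: i => -[|[|//]] /= i.
- by rewrite (_ : Ordinal i = 0) ?lerDl ?sqr_ge0//; exact: val_inj.
- by rewrite (_ : Ordinal i = 1) ?lerDr ?sqr_ge0//; exact: val_inj.
Qed.

Lemma l2nZ S (c : R) (v : plane -> R) : measurable S -> sqint leb2 S v ->
  l2n leb2 S (fun x => c * v x) = `|c| * l2n leb2 S v.
Proof.
move=> mS [_ vi]; rewrite /l2n.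
rewrite (_ : \int[leb2]_(x in S) (c * v x) ^+ 2 = c ^+ 2 * \int[leb2]_(x in S) v x ^+ 2).
  by rewrite sqrtrM ?sqr_ge0// sqrtr_sqr.
by rewrite -RintegralZl//; apply: eq_Rintegral => x _; rewrite exprMn.
Qed.

Lemma sqint_supp A B (v : plane -> R) : measurable A -> measurable B -> B `<=` A ->
  (forall x, A x -> ~ B x -> v x = 0) -> sqint leb2 B v -> sqint leb2 A v.
Proof.
move=> mA mB BA v0 [mv vi]; split.
  rewrite -(setDUK BA); apply/measurable_funU; [exact: mB|exact: measurableD|split => //].
  have v00 : {in A `\` B, (cst 0 : plane -> R) =1 v}.
    by move=> x /set_mem[Ax nBx]; rewrite v0.
  exact: (eq_measurable_fun _ v00 (measurable_cst _)).
by apply: (integrable_supp mA mB) => // x Ax nBx; rewrite v0// expr0n.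
Qed.

Lemma test_function_grad_bounded U (chi : R * R -> R) : test_function U chi ->
  exists2 M, 0 <= M & forall x, vnorm (grad chi x) <= M.
Proof.
move=> tchi.
have [a a0 Ha] := test_function_bounded (test_function_partial 0 tchi).
have [b b0 Hb] := test_function_bounded (test_function_partial 1 tchi).
exists (a + b); first exact: addr_ge0.
move=> x; rewrite vnormE !mxE -[leRHS]ger0_norm ?addr_ge0// -sqrtr_sqr.
have : `|partial 0 chi x| ^+ 2 <= a ^+ 2 by rewrite ler_sqr ?nnegrE.
have : `|partial 1 chi x| ^+ 2 <= b ^+ 2 by rewrite ler_sqr ?nnegrE.
rewrite !real_normK ?num_real// => hb ha; apply: ler_wsqrtr.
by have := mulr_ge0 a0 b0; rewrite sqrrD; lra.
Qed.

Variables (D : set (R * R)) (alpha lin lout : R) (f : R * R -> R).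
Hypotheses (oD : open D) (alpha0 : 0 < alpha) (lin0 : 0 < lin) (lin_lout : lin < lout).
Hypothesis sf : sqint leb2 D f.
Let mD : measurable (D : set plane) := open_measurable2 oD.

(** Let w be the difference of the states, with gradient dg, and let Gn, the near
    field, be the rescaled gradient of the corrector. The corrector equation is
    tested with chi w, and the equation for w with V, whose gradient is Gn minus a
    far field Gf. Both produce an integral of dg against Gn with the same coefficient in the square
    where chi = 1, since that square avoids A; there the two integrals cancel. Every
    remaining term contains Gn outside the square, or Gf, or V itself, all of which
    are small. *)
Lemma corrector_comparison (A S : set (R * R)) (u uS : R * R -> R) (eta : 'cV[R]_2)
    (chi V : R * R -> R) (Gn Gf : R * R -> 'cV[R]_2) (z : R * R) (r Mc : R) :
  let dg x := wgrad D uS x - wgrad D u x in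
  let du x := uS x - u x in
  let kap := alpha * (lout - lin) in
  let E := (D : set plane) `\` (osq z r : set plane) in
  measurable (A : set plane) -> measurable (S : set plane) -> A `&` S = set0 -> S `<=` D ->
  is_state D f alpha lin lout A u -> is_state D f alpha lin lout (A `|` S) uS ->
  open (osq z r) -> osq z r `&` A = set0 -> S `<=` osq z r ->
  test_function D chi -> (forall x, osq z r x -> chi x = 1) ->
  0 <= Mc -> (forall x, `|chi x| <= Mc) -> (forall x, vnorm (grad chi x) <= Mc) ->
  vsqint leb2 setT Gn -> vsqint leb2 setT Gf ->
  (forall v g, sqint leb2 setT v -> is_wgrad setT v g ->
    vsqint leb2 setT g ->
    \int[leb2]_x (alpha * lam lin lout S x * dotv (Gn x) (g x)) =
    kap * \int[leb2]_(x in S) dotv eta (g x)) ->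
  sqint leb2 D V -> is_wgrad D V (fun x => Gn x - Gf x) ->
  `|kap * \int[leb2]_(x in S) dotv eta (dg x) -
    kap * \int[leb2]_(x in S) dotv (wgrad D u x) (Gn x)| <=
  alpha * lout * (2 * Mc + 1) *
    (vn leb2 E Gn * (vn leb2 D dg + l2n leb2 D du)) +
  alpha * lout * (vn leb2 D dg * vn leb2 D Gf) +
  l2n leb2 D du * l2n leb2 D V +
  kap * (vn leb2 S (wgrad D u) * vn leb2 S Gf).
Proof.
move=> dg du kap E mA mS AS SD su suS oQ QA SQ tchi chi1 Mc0 hM hgM sGn sGf corr sV wV.
have [u2 wu g2] := H1_elim oD su.1; have [uS2 wuS gS2] := H1_elim oD suS.1.
have mQ := open_measurable2 oQ.
have mE : measurable E by exact: measurableD.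
have ED : E `<=` D by move=> x [].
have dg2 : vsqint leb2 D dg by exact: vsqintB.
have du2 : sqint leb2 D du by exact: sqintB.
have wdu : is_wgrad D du dg.
  have := is_wgrad_lin 1 (-1) oD wuS wu; congr is_wgrad; apply/funext => x.
    by rewrite mul1r mulN1r.
  by rewrite scale1r scaleN1r.
have gr0 x : osq z r x -> grad chi x = 0.
  move=> Qx; apply/matrixP => i j; rewrite !mxE.
  apply: (@partial_out R i (~` osq z r) chi 1); first exact: open_closedC.
    by move=> y /contrapT; exact: chi1.
  by apply.
have [schi [K [cK KD K0]]] := tchi.
have clK := compact_closed (@hausdorff_plane R) cK.
have dK0 x : ~ K x -> grad chi x = 0.
  by move=> nK; apply/matrixP => i j; rewrite !mxE; exact: (@partial_out R i K chi 0 clK K0).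
pose h x := chi x *: dg x + du x *: grad chi x.
have wh := is_wgrad_cutoff oD wdu tchi.
have hD x : ~ D x -> h x = 0.
  move=> nD; have nK : ~ K x by move/KD.
  by rewrite /h K0// dK0// scale0r scaler0 addr0.
have mchi : measurable_fun (setT : set plane) chi.
  by apply: continuous_measurable2; exact: smooth2_continuous.
have mgchi i : measurable_fun (setT : set plane) (partial i chi).
  by apply: continuous_measurable2; apply: smooth2_continuous; exact: smooth2_partial.
have ggM i x : `|partial i chi x| <= Mc.
  by apply: le_trans (hgM x); have := normr_entry (grad chi x) i; rewrite mxE.
have sdc : vsqint leb2 D (fun x => chi x *: dg x).
  move=> i; under [X in sqint _ _ X]eq_fun do rewrite mxE.
  apply: (@sqint_bounded_mul _ _ _ _ _ _ _ Mc) => //.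
  exact: measurable_funTS.
have sdg : vsqint leb2 D (fun x => du x *: grad chi x).
  move=> i; under [X in sqint _ _ X]eq_fun do rewrite !mxE mulrC.
  apply: (@sqint_bounded_mul _ _ _ _ _ _ _ Mc) => //.
  exact: measurable_funTS.
have sh : vsqint leb2 D h by exact: vsqintD.
have shT : vsqint leb2 setT h.
  move=> i; apply: (sqint_supp measurableT mD (subsetT _) _ (sh i)).
  by move=> x _ /hD ->; rewrite mxE.
have scT : sqint leb2 setT (fun x => chi x * du x).
  apply: (sqint_supp measurableT mD (subsetT _)).
    by move=> x _ nD; rewrite K0 ?mul0r// => /KD.
  apply: (@sqint_bounded_mul _ _ _ _ _ _ _ Mc) => //; exact: measurable_funTS.
have E1 : \int[leb2]_x (alpha * lam lin lout S x * dotv (Gn x) (h x)) =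
    kap * \int[leb2]_(x in S) dotv eta (h x) := corr _ _ scT wh shT.
have HV : H1 D V.
  apply: (H1_intro oD sV wV); apply: vsqintB => //; exact: (vsqintS measurableT mD (subsetT _)).
have E2 := difference_equation oD alpha0 lin0 lin_lout mA mS AS SD su suS HV.

have mla S' E' : measurable (S' : set plane) ->
    measurable_fun (E' : set plane) (fun x => alpha * lam lin lout S' x).
  by move=> mS'; apply: measurable_funM; [exact: measurable_cst|exact: measurable_lam].
have laM S' x : `|alpha * lam lin lout S' x| <= alpha * lout by exact: lam_bound.
have sub (E' : set plane) g : measurable E' -> vsqint leb2 setT g -> vsqint leb2 E' g.
  by move=> mE'; exact: (vsqintS measurableT mE' (subsetT _)).
have mB : measurable (A `|` S : set plane) by exact: measurableU.
(* the coefficient left after subtraction of the two integrals of dg against Gn *)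
pose m x := chi x * (alpha * lam lin lout S x) - alpha * lam lin lout (A `|` S) x.
have mm : measurable_fun (D : set plane) m.
  apply: measurable_funB; last exact: mla.
  by apply: measurable_funM; [exact: measurable_funTS|exact: mla].
have al0 : 0 <= alpha * lout by rewrite mulr_ge0 ?ltW// (lt_trans lin0).
have mM x : `|m x| <= alpha * lout * (Mc + 1).
  rewrite mulrDr mulr1 (le_trans (ler_normB _ _))// lerD// normrM mulrC.
  by apply: ler_pM.
pose q1 x := m x * dotv (Gn x) (dg x).
pose q2 x := alpha * lam lin lout S x * dotv (Gn x) (du x *: grad chi x).
have GnD := sub _ _ mD sGn; have GfD := sub _ _ mD sGf.
have i1 : leb2.-integrable (D : set plane) (EFin \o q1).
  by apply: (integrable_bounded_mul mD mm (fun x _ => mM x)); exact: integrable_dotv.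
have i2 : leb2.-integrable (D : set plane) (EFin \o q2) by exact: integrable_lam_dotv.
have idGn : leb2.-integrable (D : set plane)
    (EFin \o (fun x => alpha * lam lin lout (A `|` S) x * dotv (dg x) (Gn x))).
  exact: integrable_lam_dotv.
have idGf : leb2.-integrable (D : set plane)
    (EFin \o (fun x => alpha * lam lin lout (A `|` S) x * dotv (dg x) (Gf x))).
  exact: integrable_lam_dotv.
have iduV : leb2.-integrable (D : set plane) (EFin \o (fun x => du x * V x)).
  exact: sqintM.
have L1 : kap * \int[leb2]_(x in S) dotv eta (dg x) =
    \int[leb2]_(x in D) q1 x + \int[leb2]_(x in D) q2 x +
    \int[leb2]_(x in D) (alpha * lam lin lout (A `|` S) x * dotv (dg x) (Gn x)).
  rewrite (_ : \int[leb2]_(x in S) dotv eta (dg x) =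
    \int[leb2]_(x in S) dotv eta (h x)); last first.
    apply: eq_Rintegral => x /set_mem Sx; have Qx := SQ _ Sx.
    by rewrite /h chi1// gr0// scale1r scaler0 addr0.
  rewrite -E1 -(@Rintegral_setT _ D); last by move=> x /hD ->; rewrite dotvE !mxE !mulr0 addr0 mulr0.
  rewrite -RintegralD// -RintegralD//; last exact: integrableDR.
  apply: eq_Rintegral => x _; rewrite /q1 /q2 /m dotvDr !dotvZr (dotvC (dg x)).
  by ring.
have L2 : kap * \int[leb2]_(x in S) dotv (wgrad D u x) (Gn x) =
    \int[leb2]_(x in D) (alpha * lam lin lout (A `|` S) x * dotv (dg x) (Gn x)) -
    \int[leb2]_(x in D) (alpha * lam lin lout (A `|` S) x * dotv (dg x) (Gf x)) +
    \int[leb2]_(x in D) (du x * V x) +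
    kap * \int[leb2]_(x in S) dotv (wgrad D u x) (Gf x).
  have iS g1 k2 : vsqint leb2 D g1 -> vsqint leb2 D k2 ->
      leb2.-integrable (S : set plane) (EFin \o (fun x => dotv (g1 x) (k2 x))).
    by move=> s1 s2; apply: (integrable_dotv mS); exact: (vsqintS mD mS SD).
  have [_ wV' sV'] := H1_elim oD HV.
  have aeV := ae_cV2 (is_wgrad_unique oD wV' wV).
  have sGG : vsqint leb2 D (fun x => Gn x - Gf x) by exact: vsqintB.
  have F1 : \int[leb2]_(x in S) dotv (wgrad D u x) (wgrad D V x) =
      \int[leb2]_(x in S) dotv (wgrad D u x) (Gn x) -
      \int[leb2]_(x in S) dotv (wgrad D u x) (Gf x).
    rewrite -RintegralB//; try exact: iS.
    under [RHS]eq_Rintegral do rewrite -dotvBr.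
    apply: Rintegral_ae => //; try exact/integrable_measurable/iS.
    by apply: filterS aeV => x H /SD /H ->.
  have F2 : aform D alpha lin lout (A `|` S) dg (wgrad D V) du V =
    \int[leb2]_(x in D) (alpha * lam lin lout (A `|` S) x * dotv (dg x) (Gn x)) -
    \int[leb2]_(x in D) (alpha * lam lin lout (A `|` S) x * dotv (dg x) (Gf x)) +
    \int[leb2]_(x in D) (du x * V x).
    rewrite -RintegralB// -RintegralD//; last exact: integrableBR.
    apply: Rintegral_ae => //.
    - exact/integrable_measurable/integrable_aform.
    - exact: (integrable_measurable (integrableDR mD (integrableBR mD idGn idGf) iduV)).
    - by apply: filterS aeV => x H /H ->; rewrite dotvBr; ring.
  move: E2; rewrite -/dg -/du F1 F2 -/kap => ->; ring.
have Eq v : (forall x, D x -> ~ E x -> v x = 0) ->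
    \int[leb2]_(x in D) v x = \int[leb2]_(x in E) v x.
  by move=> v0; apply: Rintegral_supp => // x /ED.
have QE x : D x -> ~ E x -> osq z r x by move=> Dx nE; apply: contrapT => nQ; apply: nE.
have q1Q x : D x -> ~ E x -> q1 x = 0.
  move=> Dx /(QE _ Dx) Qx; rewrite /q1 /m chi1// mul1r /lam in_setU.
  have -> : (x \in A) = false.
    by apply/negbTE/negP => /set_mem Ax; have : (osq z r `&` A) x by []; rewrite QA.
  by rewrite /= subrr mul0r.
have q2Q x : D x -> ~ E x -> q2 x = 0.
  by move=> Dx /(QE _ Dx) Qx; rewrite /q2 gr0// scaler0 dotvE !mxE !mulr0 addr0 mulr0.
rewrite L1 L2 (Eq _ q1Q) (Eq _ q2Q).
have GnE := sub _ _ mE sGn; have dgE := vsqintS mD mE ED dg2.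
have sdgE := vsqintS mD mE ED sdg.
have B1 : `|\int[leb2]_(x in E) q1 x| <=
    alpha * lout * (Mc + 1) * (vn leb2 E Gn * vn leb2 D dg).
  have H := vcauchy_schwarz mE (measurable_funS mD ED mm) (fun x _ => mM x) _ GnE dgE.
  apply: le_trans (H _) _; first by rewrite mulr_ge0// addr_ge0.
  have c0 : 0 <= alpha * lout * (Mc + 1) by rewrite mulr_ge0// addr_ge0.
  by apply: ler_wpM2l => //; apply: ler_wpM2l; [exact: vn_ge0|exact: le_vnS].
have B2 : `|\int[leb2]_(x in E) q2 x| <=
    alpha * lout * (vn leb2 E Gn * (Mc * l2n leb2 D du)).
  have H := vcauchy_schwarz mE (mla S E mS) (fun x _ => laM S x) al0 GnE sdgE.
  apply: le_trans H _; rewrite ler_wpM2l// ler_wpM2l ?vn_ge0//.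
  apply: le_trans (le_vnS mD mE ED sdg) _; rewrite vnE.
  rewrite -[X in X * _](ger0_norm Mc0) -l2nZ//; apply: le_l2n => //.
  - exact: vsqint_vnorm.
  - exact: sqintZ.
  - move=> x _; rewrite normrM (ger0_norm Mc0) /vnorm [X in X <= _]ger0_norm ?sqrtr_ge0//.
    rewrite dotvZl dotvZr mulrA -expr2 sqrtrM ?sqr_ge0// sqrtr_sqr mulrC.
    by rewrite ler_wpM2r//; exact: hgM.
have B3 : `|\int[leb2]_(x in D) (alpha * lam lin lout (A `|` S) x * dotv (dg x) (Gf x))|
    <= alpha * lout * (vn leb2 D dg * vn leb2 D Gf).
  exact: (vcauchy_schwarz mD (mla _ D mB) (fun x _ => laM _ x) al0 dg2 GfD).
have B4 : `|\int[leb2]_(x in D) (du x * V x)| <=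
    l2n leb2 D du * l2n leb2 D V.
  apply: le_trans (cauchy_schwarz mD du2 sV).
  exact: (le_normr_Rintegral mD iduV).
have B5 : `|\int[leb2]_(x in S) dotv (wgrad D u x) (Gf x)| <=
    vn leb2 S (wgrad D u) * vn leb2 S Gf.
  by apply: vcauchy_schwarz1 => //; [exact: (vsqintS mD mS SD)|exact: sub].
have kap0 : 0 <= kap by rewrite mulr_ge0 ?subr_ge0 ?ltW.
have W0 := l2n_ge0 leb2 (D : set plane) du; have N0 := vn_ge0 leb2 (D : set plane) dg.
have P0 := vn_ge0 leb2 E Gn.
apply: (@le_trans _ _ (alpha * lout * (Mc + 1) * (vn leb2 E Gn * vn leb2 D dg) +
    alpha * lout * (vn leb2 E Gn * (Mc * l2n leb2 D du)) +
    alpha * lout * (vn leb2 D dg * vn leb2 D Gf) +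
    l2n leb2 D du * l2n leb2 D V +
    kap * (vn leb2 S (wgrad D u) * vn leb2 S Gf))).
  have {}B5 : `|kap * \int[leb2]_(x in S) dotv (wgrad D u x) (Gf x)| <=
      kap * (vn leb2 S (wgrad D u) * vn leb2 S Gf).
    by rewrite normrM ger0_norm// ler_wpM2l.
  have five (x1 x2 x3 x4 x5 x6 b1 b2 b3 b4 b5 : R) : `|x1| <= b1 -> `|x2| <= b2 ->
      `|x4| <= b3 -> `|x5| <= b4 -> `|x6| <= b5 ->
      `|x1 + x2 + x3 - (x3 - x4 + x5 + x6)| <= b1 + b2 + b3 + b4 + b5.
    by rewrite !ler_norml; lra.
  exact: five.
rewrite !lerD2r -subr_ge0.
have := mulr_ge0 (mulr_ge0 al0 P0) (addr_ge0 (mulr_ge0 Mc0 N0) (mulr_ge0 (addr_ge0 Mc0 ler01) W0)).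
by congr (_ <= _); ring.
Qed.

End Comparison.

(** * Decay of the rescaled corrector *)

Section CorrectorDecay.
Variable R : realType.
Notation mR := (measurableTypeR R).
Notation plane := (mR * mR)%type.
Variables (K : R * R -> R).
Hypothesis BK : BL K.
Let G := wgrad setT K.
Let HK := BL_elim BK.

(** The coordinates in which the inclusion of size eps at z becomes the reference
    inclusion. *)
Definition blow (z : R * R) (eps : R) (x : R * R) : R * R := - (eps^-1 *: z) + eps^-1 *: x.

Lemma csq_blow z eps M x : 0 < eps -> csq 0 M (blow z eps x) <-> csq z (eps * M) x.
Proof.
move=> e0.
have E (a b : R) : (`|- (eps^-1 * a) + eps^-1 * b - 0| <= M) = (`|b - a| <= eps * M).
  have -> : - (eps^-1 * a) + eps^-1 * b - 0 = eps^-1 * (b - a) by ring.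
  by rewrite normrM gtr0_norm ?invr_gt0// ler_pdivrMl.
by rewrite !csqE /blow /= !E.
Qed.

(** Off a fixed square around z, the blown-up point is far from the origin, where
    the gradient of the corrector has little mass. *)
Lemma corrector_decay r eta : 0 < r -> 0 < eta ->
  exists2 e0, 0 < e0 & forall eps z (E : set plane), 0 < eps -> eps < e0 -> measurable E ->
    (forall x, E x -> ~ osq z r x) ->
    vn leb2 E (fun x => G (blow z eps x)) ^+ 2 <= eps ^+ 2 * eta.
Proof.
move=> r0 eta0; have [_ _ sG] := HK.
have [M M0 HM] := integrable_tail eta0 (integrable_dotv measurableT sG sG) (fun x => dotvv_ge0 (G x)).
exists (r / M); first exact: divr_gt0.
move=> eps z E e0 er mE far; rewrite ltr_pdivlMr// in er.
have e0' : 0 < eps^-1 by rewrite invr_gt0.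
have [|_ H] := @vn_affine_far _ (- (eps^-1 *: z)) eps^-1 G E M e0' mE sG.
  move=> x Ex /(csq_blow z M x e0) /csqE[h1 h2]; apply: (far _ Ex); apply/osqE.
  by split; apply: le_lt_trans er.
apply: le_trans H _; rewrite exprVn invrK ler_wpM2l ?sqr_ge0//.
exact: HM.
Qed.

(** The corrector rescaled around z minus the same function rescaled around a
    point at distance T. A Beppo-Levi function need not be square-integrable, even
    after subtraction of a constant, but this difference is for small eps; when the second centre
    lies away from D its contribution to the gradient in D is only a far field. *)
Definition dipole (z : R * R) (T eps : R) (x : R * R) : R :=
  eps * K (blow z eps x) - eps * K (blow (z - (T, 0)) eps x).

Lemma blow_slide z T eps x : blow (z - (T, 0)) eps x = slide (blow z eps x) (eps^-1 * T).
Proof.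
have E1 (c a b : R) : - (c * (a - T)) + c * b = - (c * a) + c * b + c * T by ring.
have E2 (c a b : R) : - (c * (a - 0)) + c * b = - (c * a) + c * b by ring.
by apply/pair_equal_spec; split; [exact: E1|exact: E2].
Qed.

Lemma vsqint_blow z eps : 0 < eps -> vsqint leb2 setT (fun x => G (blow z eps x)).
Proof.
move=> e0 i; have [_ _ sG] := HK; apply: (sqint_affine _ _ (sG i)); by rewrite invr_gt0.
Qed.

Lemma is_wgrad_dipole z T eps : 0 < eps ->
  is_wgrad setT (dipole z T eps)
    (fun x => G (blow z eps x) - G (blow (z - (T, 0)) eps x)).
Proof.
move=> e0; have [_ wG _] := HK; have e0' : 0 < eps^-1 by rewrite invr_gt0.
have := is_wgrad_lin eps (- eps) openT
  (is_wgrad_affine (- (eps^-1 *: z)) e0' wG)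
  (is_wgrad_affine (- (eps^-1 *: (z - (T, 0)))) e0' wG).
congr is_wgrad; apply/funext => x; first by rewrite /dipole mulNr.
by rewrite !scalerA mulNr mulfV ?gt_eqF// scale1r scaleN1r.
Qed.

(** In the blown-up variable the two centres are at distance T / eps, so that
    translation_small gives a squared norm o(T^2 / eps^2), to be multiplied by eps^2
    from the amplitude and eps^2 from the Jacobian. *)
Lemma dipole_small T eta : 0 < T -> 0 < eta ->
  exists2 e0, 0 < e0 & forall eps z, 0 < eps -> eps < e0 ->
    sqint leb2 setT (dipole z T eps) /\
    l2n leb2 setT (dipole z T eps) ^+ 2 <= eps ^+ 2 * eta.
Proof.
move=> T0 eta0; have [_ wG sG] := HK.
have eta0' : 0 < eta / T ^+ 2 by rewrite divr_gt0// exprn_gt0.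
have [h0 h00 H] := translation_small eta0' wG (sG 0).
exists (T / h0); first exact: divr_gt0.
move=> eps z e0 eT; have e0' : 0 < eps^-1 by rewrite invr_gt0.
have [|s1 s2] := H (eps^-1 * T).
  by rewrite ler_pdivlMl// ltW// -ltr_pdivlMr.
have dE : dipole z T eps = (fun x => - eps * (fun y => K (slide y (eps^-1 * T)) - K y)
    (- (eps^-1 *: z) + eps^-1 *: x)).
  by apply/funext => x; rewrite /dipole blow_slide /blow; ring.
have sq := sqint_affine (- (eps^-1 *: z)) e0' s1.
rewrite dE; split; first exact: sqintZ.
have n2 := sqr_l2n_affine (- (eps^-1 *: z)) e0' s1; cbv beta in n2.
rewrite l2nZ// exprMn normrN (gtr0_norm e0) n2 ler_wpM2l ?sqr_ge0//.
apply: (@le_trans _ _ (eps^-1 ^- 2 * (eta / T ^+ 2 * (eps^-1 * T) ^+ 2))).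
  by rewrite ler_wpM2l// invr_ge0 sqr_ge0.
by rewrite le_eqVlt; apply/orP; left; apply/eqP; field; rewrite !gt_eqF.
Qed.

End CorrectorDecay.

(** * Orders of magnitude and local estimates *)

Section Asymptotics.
Variable R : realType.
Notation mR := (measurableTypeR R).
Notation plane := (mR * mR)%type.
Implicit Types (S : set plane).

(** A e = o(e^n) as e tends to 0 from the right. *)
Definition lo (n : nat) (A : R -> R) := forall tau, 0 < tau ->
  \forall e \near (0 : R)^'+, `|A e| <= tau * e ^+ n.

(** A e = O(e^n) as e tends to 0 from the right. *)
Definition bO (n : nat) (A : R -> R) := exists2 C, 0 <= C &
  \forall e \near (0 : R)^'+, `|A e| <= C * e ^+ n.

Lemma loD n A B : lo n A -> lo n B -> lo n (fun e => A e + B e).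
Proof.
move=> lA lB tau tau0; have t2 : 0 < tau / 2 by rewrite divr_gt0.
near=> e; rewrite (splitr tau) mulrDl.
apply: (le_trans (ler_normD _ _)); apply: lerD; near: e; [exact: lA|exact: lB].
Unshelve. all: by end_near. Qed.

Lemma bOD n A B : bO n A -> bO n B -> bO n (fun e => A e + B e).
Proof.
move=> [a a0 lA] [b b0 lB]; exists (a + b); first exact: addr_ge0.
near=> e; rewrite mulrDl.
by apply: (le_trans (ler_normD _ _)); apply: lerD; near: e.
Unshelve. all: by end_near. Qed.

Lemma bOM n m A B : bO n A -> bO m B -> bO (n + m) (fun e => A e * B e).
Proof.
move=> [a a0 lA] [b b0 lB]; exists (a * b); first exact: mulr_ge0.
near=> e; rewrite exprD mulrACA normrM.
by apply: ler_pM => //; near: e.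
Unshelve. all: by end_near. Qed.

Lemma loM n m A B : lo n A -> bO m B -> lo (n + m) (fun e => A e * B e).
Proof.
move=> lA [b b0 lB] tau tau0.
have b1 : 0 < b + 1 by rewrite ltr_wpDl.
have t2 : 0 < tau / (b + 1) by rewrite divr_gt0.
near=> e.
have e0 : 0 < e by near: e; exact: nbhs_right_gt.
apply: (@le_trans _ _ ((tau / (b + 1) * e ^+ n) * ((b + 1) * e ^+ m))).
  rewrite normrM; apply: ler_pM => //; first by near: e; exact: lA.
  apply: (@le_trans _ _ (b * e ^+ m)); first by near: e.
  by rewrite ler_wpM2r ?exprn_ge0 ?(ltW e0)// lerDl.
rewrite mulrACA -exprD divfK// gt_eqF//.
Unshelve. all: by end_near. Qed.

Lemma bO_cst (c : R) : bO 0 (fun=> c).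
Proof. by exists `|c| => //; near=> e; rewrite expr0 mulr1. Unshelve. all: by end_near. Qed.

Lemma loZ n A c : lo n A -> lo n (fun e => c * A e).
Proof.
by move=> lA; have := loM lA (bO_cst c); rewrite addn0; under eq_fun do rewrite mulrC.
Qed.

Lemma le_lo n A B : lo n B -> (\forall e \near (0 : R)^'+, `|A e| <= B e) -> lo n A.
Proof.
move=> lB AB tau tau0; near=> e.
apply: (@le_trans _ _ (B e)); first by near: e.
by apply: (le_trans (ler_norm _)); near: e; exact: lB.
Unshelve. all: by end_near. Qed.

Lemma le_bO n A B : bO n B -> (\forall e \near (0 : R)^'+, `|A e| <= B e) -> bO n A.
Proof.
move=> [C C0 lB] AB; exists C => //; near=> e.
apply: (@le_trans _ _ (B e)); first by near: e.
by apply: (le_trans (ler_norm _)); near: e.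
Unshelve. all: by end_near. Qed.

(** The norms of the far fields are only controlled through their squares, with a
    small mass eta as the factor of e^2. *)
Lemma lo_sqr A : (forall e, 0 <= A e) ->
  (forall eta, 0 < eta -> \forall e \near (0 : R)^'+, A e ^+ 2 <= e ^+ 2 * eta) -> lo 1 A.
Proof.
move=> A0 H tau tau0; have t2 : 0 < tau ^+ 2 by rewrite exprn_gt0.
near=> e; have e0 : 0 < e by near: e; exact: nbhs_right_gt.
rewrite ger0_norm// expr1 -ler_sqr ?nnegrE ?mulr_ge0 ?(ltW e0) ?(ltW tau0)//.
by rewrite exprMn mulrC; near: e; exact: H.
Unshelve. all: by end_near. Qed.

Lemma near0 (P : R -> Prop) (e0 : R) : 0 < e0 -> (forall e, 0 < e -> e < e0 -> P e) ->
  \forall e \near (0 : R)^'+, P e.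
Proof.
move=> e00 H; near=> e; apply: H; near: e; [exact: nbhs_right_gt|exact: nbhs_right_lt].
Unshelve. all: by end_near. Qed.

Lemma lo_cvg (A : R -> R) (c l : R) : 0 < c -> lo 2 (fun e => A e - e ^+ 2 * c * l) ->
  A e / (e ^+ 2 * c) @[e --> (0 : R)^'+] --> l.
Proof.
move=> c0 H; apply/cvgrPdist_le => tau tau0.
near=> e; have e0 : 0 < e by near: e; exact: nbhs_right_gt.
have ec : 0 < e ^+ 2 * c by rewrite mulr_gt0 ?exprn_gt0.
have -> : l - A e / (e ^+ 2 * c) = - (A e - e ^+ 2 * c * l) / (e ^+ 2 * c).
  by field; rewrite !gt_eqF.
rewrite normrM normfV (gtr0_norm ec) ler_pdivrMr// normrN.
have -> : tau * (e ^+ 2 * c) = tau * c * e ^+ 2 by ring.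
by near: e; apply: H; exact: mulr_gt0.
Unshelve. all: by end_near. Qed.

Lemma open_eball (z : R * R) (r : R) : open (eball z r).
Proof.
rewrite /eball -[X in open X]/((fun x : R * R => (x.1 - z.1) ^+ 2 + (x.2 - z.2) ^+ 2) @^-1`
  [set t | t < r ^+ 2]).
apply: open_comp; last exact: open_lt.
move=> x _; apply: cvgD; rewrite /=.
  apply: (@continuous_comp _ _ _ (fun x : R * R => x.1 - z.1) (fun t => t ^+ 2)).
    by apply: cvgB; [exact: cvg_fst|exact: cvg_cst].
  exact: exprn_continuous.
apply: (@continuous_comp _ _ _ (fun x : R * R => x.2 - z.2) (fun t => t ^+ 2)).
  by apply: cvgB; [exact: cvg_snd|exact: cvg_cst].
exact: exprn_continuous.
Qed.

Lemma is_wgrad_ae (U : set (R * R)) v v' g : open U -> is_wgrad U v g -> Lp_loc 1 U v' ->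
  {ae leb2, forall x : plane, U x -> v x = v' x} -> is_wgrad U v' g.
Proof.
move=> oU [vl wg] vl' vv'; split => // i; have [gl gi] := wg i.
split => // phi tphi; rewrite -gi//; have td := test_function_partial i tphi.
apply: Rintegral_ae; first exact: open_measurable2.
- exact/integrable_measurable/(integrable_test oU vl' td).
- exact/integrable_measurable/(integrable_test oU vl td).
- by apply: filterS vv' => x H /H ->.
Qed.

Lemma vn_ae_le S (h : R * R -> 'cV[R]_2) tau : measurable S -> (leb2 S < +oo)%E ->
  vsqint leb2 S h -> 0 <= tau -> {ae leb2, forall x : plane, S x -> vnorm (h x) <= tau} ->
  vn leb2 S h <= tau * Num.sqrt (fine (leb2 S)).
Proof.
move=> mS fS sh tau0 hle.
rewrite -ler_sqr ?nnegrE ?vn_ge0 ?mulr_ge0 ?sqrtr_ge0// sqr_vn exprMn sqr_sqrtr ?fine_ge0//.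
have -> : tau ^+ 2 * fine (leb2 S) = \int[leb2]_(x in S) (cst (tau ^+ 2) x).
  by rewrite Rintegral_cst.
have mdot := integrable_dotv mS sh sh.
have mcst : leb2.-integrable S (EFin \o cst (tau ^+ 2)).
  exact: integrable_cst_fin.
rewrite /Rintegral fine_le//.
- exact: (integrable_fin_num mS mdot).
- exact: (integrable_fin_num mS mcst).
apply: ae_ge0_le_integral => //.
- by move=> x _; rewrite lee_fin dotvv_ge0.
- by case/integrableP: mdot.
- by move=> x _; rewrite lee_fin sqr_ge0.
- by case/integrableP: mcst.
apply: filterS hle => x H /H; rewrite lee_fin /vnorm => {}H.
rewrite -(sqr_sqrtr (dotvv_ge0 (h x))) ler_sqr ?nnegrE ?sqrtr_ge0//.
Qed.

Lemma Lp_oo_sqint (U : set (R * R)) f : measurable (U : set plane) ->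
  (leb2 (U : set plane) < +oo)%E -> Lp_on +oo U f -> sqint leb2 U f.
Proof.
move=> mU fU H; have mfU := sub_Lfun_mfun H.
have mf : measurable_fun (U : set plane) f.
  by apply/(measurable_restrictT _ mU); move: mfU; rewrite inE.
have leT : (0 < leb2 (setT : set plane))%E by exact: (@leb2_open_gt0 R setT 0 openT).
move: H; rewrite /Lp_on inE => /andP[_]; rewrite inE /= /finite_norm unlock /Lnorm leT.
move=> fb; have [M fM] := @ess_supr_bounded _ _ _ leb2 (fun x => `|(f \_ U) x|) fb.
split=> //; have mc := integrable_cst_fin (M ^+ 2) mU fU.
apply/integrableP; split; first by apply/measurable_EFinP; exact: measurable_funX.
case/integrableP: (mc) => mcM; apply: le_lt_trans.
apply: ae_ge0_le_integral => //.
- by apply: measurableT_comp => //; apply/measurable_EFinP; exact: measurable_funX.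
- exact: measurableT_comp.
apply: filterS fM => x /= H Ux; move: H; rewrite patchE mem_set// lee_fin => H.
rewrite !normrX ler_sqr ?nnegrE//; exact: le_trans H (ler_norm _).
Qed.

End Asymptotics.

(** * The topological derivative *)

Lemma open_osq (R : realType) (z : R * R) (q : R) : open (osq z q).
Proof.
rewrite -[X in open X]/((fst @^-1` `]z.1 - q, z.1 + q[%classic) `&`
  (snd @^-1` `]z.2 - q, z.2 + q[%classic)).
by apply: openI; apply: open_comp => [x _|]; [exact: cvg_fst|exact: itv_open|exact: cvg_snd|exact: itv_open].
Qed.

Lemma cutoff_exists (R : realType) (U : set (R * R)) (z : R * R) (q : R) : 0 < q ->
  csq z (2 * q) `<=` U ->
  exists2 chi, test_function U chi & forall x, osq z q x -> chi x = 1.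
Proof.
move=> q0 zU; have [c [sc c1 c0]] := smooth_plateau R.
have qV : 0 < q^-1 by rewrite invr_gt0.
pose a (p x : R) := c (- (q^-1 * p) + q^-1 * x).
have argE p x : - (q^-1 * p) + q^-1 * x = q^-1 * (x - p) by ring.
have a0 p x : 2 * q <= `|x - p| -> a p x = 0.
  by move=> h; apply: c0; rewrite argE normrM (gtr0_norm qV) ler_pdivlMl// mulrC.
exists (tens (a z.1) (a z.2)).
  apply: (@test_function_tens R U _ _ (z.1 - 2 * q) (z.1 + 2 * q) (z.2 - 2 * q) (z.2 + 2 * q)).
  - exact: smooth_affine.
  - exact: smooth_affine.
  - by move=> x h; apply: a0; rewrite ler_normr; apply/orP; right; lra.
  - by move=> x h; apply: a0; rewrite ler_normr; apply/orP; left; lra.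
  - by move=> x h; apply: a0; rewrite ler_normr; apply/orP; right; lra.
  - by move=> x h; apply: a0; rewrite ler_normr; apply/orP; left; lra.
  - exact: zU.
move=> x /osqE[h1 h2].
have a1 p y : `|y - p| < q -> a p y = 1.
  move=> h; apply: c1; rewrite argE normrM (gtr0_norm qV) ler_pdivrMl// mulr1.
  exact: ltW.
by rewrite /tens !a1// mulr1.
Qed.

Section TopologicalDerivative.
Variable R : realType.
Notation mR := (measurableTypeR R).
Notation plane := (mR * mR)%type.
Variables (D : set (R * R)) (f : R * R -> R) (alpha lin lout : R) (Omega : set (R * R)).
Variables (u : set (R * R) -> R * R -> R) (z : R * R) (omega : set (R * R)) (delta : R).
Variables (u0 : R * R -> R) (K : 'cV[R]_2 -> R * R -> R).
Hypotheses (oD : open D) (bD : bounded_set D) (hf : Lp_on +oo%E D f).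
Hypotheses (alpha0 : 0 < alpha) (lin0 : 0 < lin) (lin_lout : lin < lout).
Hypotheses (oOmega : open Omega) (OmegaD : Omega `<=` D).
Hypothesis hu : forall A : set (R * R), open A -> A `<=` D ->
  is_state D f alpha lin lout A (u A).
Hypotheses (zOmega : ~ closure Omega z) (oomega : open omega) (bomega : bounded_set omega).
Hypotheses (omega0 : omega 0) (delta0 : 0 < delta) (ballD : eball z delta `<=` D).
Hypothesis hu0 : Ck_on 2 (eball z delta) u0.
Hypothesis huu0 : {ae leb2, forall x, eball z delta x -> u Omega x = u0 x}.
Hypothesis hK : forall eta : 'cV[R]_2, is_corrector alpha lin lout omega eta (K eta).

Let mD : measurable (D : set plane) := open_measurable2 oD.
Let sf : sqint leb2 D f := Lp_oo_sqint mD (leb2_bounded mD bD) hf.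
Let mom : measurable (omega : set plane) := open_measurable2 oomega.
Let fom : (leb2 (omega : set plane) < +oo)%E := leb2_bounded mom bomega.
Let g := wgrad D (u Omega).
Let S e := inclusion z omega e.
Let uS e := u (Omega `|` S e).
Let dg e x := wgrad D (uS e) x - g x.
Let du e x := uS e x - u Omega x.
Let zeta := grad u0 z.
Let vol := fine (leb2 (omega : set plane)).
Let stu := hu oOmega OmegaD.

Let measurable_S e : 0 < e -> measurable (S e : set plane).
Proof. by move=> e0; apply: open_measurable2; exact: open_inclusion. Qed.

Let leb_S e : 0 < e -> leb2 (S e : set plane) = (e ^+ 2 * vol)%:E.
Proof.
have volE : leb2 (omega : set plane) = vol%:E by rewrite /vol fineK// ge0_fin_numE.
by move=> e0; rewrite leb2_inclusion// volE.
Qed.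

Let fin_S e : 0 < e -> (leb2 (S e : set plane) < +oo)%E.
Proof. by move=> e0; rewrite leb_S// ltry. Qed.

Let vol_gt0 : 0 < vol.
Proof. by rewrite /vol fine_gt0// fom (leb2_open_gt0 oomega omega0). Qed.

Let zball : eball z delta z.
Proof. by rewrite /eball /= !subrr expr0n /= addr0 exprn_gt0. Qed.

Let near_z : exists2 r, 0 < r & osq z r `<=` eball z delta /\ osq z r `&` Omega = set0.
Proof.
have /nbhs_csq[r r0 H] : nbhs z (eball z delta `&` ~` closure Omega).
  apply: filterI; apply: open_nbhs_nbhs; split => //.
    exact: open_eball.
  by apply: closed_openC; exact: closed_closure.
exists r => //; split; first by move=> x /osq_csq /H [].
apply/seteqP; split => // x [/osq_csq /H[_ nO] Ox]; apply: nO; exact: subset_closure.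
Qed.

Let S_small s : 0 < s -> \forall e \near (0 : R)^'+, S e `<=` osq z s.
Proof.
move=> s0; have [M M0 oM] := bounded_csq bomega.
apply: (@near0 R _ (s / M)); first exact: divr_gt0.
move=> e e0; rewrite ltr_pdivlMr// => eM x [y /oM /csqE[h1 h2] <-].
have bnd (a b c : R) : `|b - 0| <= M -> `|a + e * b - a| < s.
  move=> h; rewrite addrC addKr normrM gtr0_norm//.
  by rewrite subr0 in h; apply: le_lt_trans eM; rewrite ler_wpM2l// ltW.
by apply/osqE; split; exact: bnd.
Qed.

(** Weak gradients are unique and the classical gradient is one, so the weak
    gradient of the unperturbed state is continuous near z up to a null set. *)
Let state_grad : {ae leb2, forall x : plane, eball z delta x -> g x = grad u0 x}.
Proof.
have oB := @open_eball R z delta.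
have [_ wu _] := H1_elim oD stu.1.
have C1 : Ck_on 1 (eball z delta) u0 by exact: Ck_onW.
have w0 := is_wgrad_classical oB C1.
have wB := is_wgrad_ae oB (is_wgradS oB ballD wu) w0.1 huu0.
exact: (ae_cV2 (is_wgrad_unique oB wB w0)).
Qed.

Let grad_cvg (c : 'cV[R]_2) : vnorm (grad u0 x - c) @[x --> z] --> vnorm (zeta - c).
Proof.
have cg i : {for z, continuous (partial i u0)} by have [_ [H _]] := (hu0.2 i); exact: H.
have E x : vnorm (grad u0 x - c) =
    Num.sqrt ((partial 0 u0 x - c 0 0) ^+ 2 + (partial 1 u0 x - c 1 0) ^+ 2).
  by rewrite vnormE !mxE.
rewrite /zeta E; under eq_fun do rewrite E.
apply: continuous_cvg; first exact: sqrt_continuous.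
by apply: cvgD; apply: cvgM; apply: cvgB; (try exact: cvg_cst); exact: cg.
Qed.

Let state_S e : 0 < e -> S e `<=` D -> is_state D f alpha lin lout (Omega `|` S e) (uS e).
Proof.
move=> e0 SD; apply: hu; first by apply: openU => //; exact: open_inclusion.
by move=> x [/OmegaD|/SD].
Qed.

Let near_pos : \forall e \near (0 : R)^'+, 0 < e.
Proof. exact: nbhs_right_gt. Qed.

Let near_SD : \forall e \near (0 : R)^'+, S e `<=` D.
Proof.
have [r r0 [rb _]] := near_z; apply: filterS (S_small r0) => e Sr x /Sr /rb; exact: ballD.
Qed.

Let near_SO : \forall e \near (0 : R)^'+, Omega `&` S e = set0.
Proof.
have [r r0 [_ rO]] := near_z; apply: filterS (S_small r0) => e Sr.
by apply/seteqP; split => // x [Ox /Sr rx]; rewrite -rO.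
Qed.

Let sg : vsqint leb2 D g.
Proof. by have [_ _] := H1_elim oD stu.1. Qed.

Let sc c e : 0 < e -> vsqint leb2 (S e) (fun=> c).
Proof.
by move=> e0 i; apply: sqint_cst; [exact: measurable_S|exact: fin_S].
Qed.

(** The area of the inclusion is e^2 vol, and grad u0 is continuous at z. *)
Let vn_S_le c tau : vnorm (zeta - c) < tau ->
  \forall e \near (0 : R)^'+, vn leb2 (S e) (fun x => g x - c) <=
    tau * (e * Num.sqrt vol).
Proof.
move=> zt.
have /nbhs_csq[s s0 Hs] : nbhs z [set x | vnorm (grad u0 x - c) < tau].
  have Ht : nbhs (vnorm (zeta - c)) [set t | t < tau].
    by apply: open_nbhs_nbhs; split => //; exact: open_lt.
  exact: (grad_cvg Ht).
have [r r0 [rb _]] := near_z.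
near=> e; have e0 : 0 < e by near: e.
have Sr : S e `<=` osq z r by near: e; exact: S_small.
have Ss : S e `<=` osq z s by near: e; exact: S_small.
have -> : e * Num.sqrt vol = Num.sqrt (fine (leb2 (S e : set plane))).
  by rewrite leb_S//= sqrtrM ?sqr_ge0// sqrtr_sqr gtr0_norm.
have SD : S e `<=` D by move=> x /Sr /rb; exact: ballD.
have mS := measurable_S e0.
apply: vn_ae_le => //; first exact: fin_S.
- by apply: vsqintB => //; [exact: (vsqintS mD mS SD)|exact: sc].
- by apply: le_trans (ltW zt); exact: sqrtr_ge0.
- apply: filterS state_grad => x H Sx; rewrite H; last exact/rb/Sr.
  by apply/ltW/Hs; apply: osq_csq; exact: Ss.
Unshelve. all: by end_near. Qed.

Let lo_gS : lo 1 (fun e => vn leb2 (S e) (fun x => g x - zeta)).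
Proof.
move=> tau tau0; have m1 : 0 < Num.sqrt vol by rewrite sqrtr_gt0.
near=> e; have e0 : 0 < e by near: e.
rewrite ger0_norm ?vn_ge0// expr1.
apply: (@le_trans _ _ (tau / Num.sqrt vol * (e * Num.sqrt vol))).
  near: e; apply: vn_S_le; rewrite subrr /vnorm dotvE !mxE !mulr0 addr0 sqrtr0.
  exact: divr_gt0.
by rewrite mulrCA divfK ?gt_eqF// mulrC.
Unshelve. all: by end_near. Qed.

Let bO_gS : bO 1 (fun e => vn leb2 (S e) g).
Proof.
have z0 : 0 <= vnorm zeta by exact: sqrtr_ge0.
exists ((vnorm zeta + 1) * Num.sqrt vol); first by rewrite mulr_ge0 ?addr_ge0 ?sqrtr_ge0.
near=> e; rewrite ger0_norm ?vn_ge0// expr1 -mulrA (mulrC _ e).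
have -> : g = (fun x => g x - 0) by apply/funext => x; rewrite subr0.
by near: e; apply: vn_S_le; rewrite subr0 ltrDl.
Unshelve. all: by end_near. Qed.

Let near_energy : \forall e \near (0 : R)^'+,
  vn leb2 D (dg e) <= (lout - lin) / lin * vn leb2 (S e) g /\
  l2n leb2 D (du e) ^+ 2 <=
    alpha * (lout - lin) ^+ 2 / lin * vn leb2 (S e) g ^+ 2.
Proof.
near=> e; have e0 : 0 < e by near: e.
have SD : S e `<=` D by near: e.
apply: (energy_estimate oD alpha0 lin0 lin_lout _ _ _ SD stu (state_S e0 SD)).
- exact: open_measurable2.
- exact: measurable_S.
- by near: e.
Unshelve. all: by end_near. Qed.

Let bO_dg : bO 1 (fun e => vn leb2 D (dg e)).
Proof.
apply: (le_bO (B := fun e => (lout - lin) / lin * vn leb2 (S e) g)).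
  exact: (bOM (bO_cst _) bO_gS).
by apply: filterS near_energy => e [H _]; rewrite ger0_norm ?vn_ge0.
Qed.

Let bO_du : bO 1 (fun e => l2n leb2 D (du e)).
Proof.
have c0 : 0 <= alpha * (lout - lin) ^+ 2 / lin.
  by apply: divr_ge0; [apply: mulr_ge0; [exact: ltW|exact: sqr_ge0]|exact: ltW].
apply: (le_bO (B := fun e => Num.sqrt (alpha * (lout - lin) ^+ 2 / lin) *
    vn leb2 (S e) g)).
  exact: (bOM (bO_cst _) bO_gS).
apply: filterS near_energy => e [_ H]; rewrite ger0_norm ?l2n_ge0//.
rewrite -ler_sqr ?nnegrE ?mulr_ge0 ?sqrtr_ge0 ?l2n_ge0 ?vn_ge0//.
by rewrite exprMn (sqr_sqrtr c0); exact: H.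
Qed.

Let Gn k e x := wgrad setT (K (delta_mx k 0)) (blow z e x).

(** The far fields and the dipole are o(e) while the gradient of the state on the
    inclusion, and with it the difference of the states, is O(e); hence each product
    in corrector_comparison is o(e^2). *)
Let lo_comparison (k : 'I_2) : lo 2 (fun e =>
  \int[leb2]_(x in S e) dotv (delta_mx k 0) (dg e x) -
  \int[leb2]_(x in S e) dotv (g x) (Gn k e x)).
Proof.
have [BK _] := hK (delta_mx k 0).
have [r r0 [rb rO]] := near_z.
(* the cutoff has support in the square of radius 2 q, inside the open square of radius r *)
pose q := r / 4; have q0 : 0 < q by rewrite divr_gt0.
have [chi tchi chi1] : exists2 chi, test_function D chi & forall x, osq z q x -> chi x = 1.
  apply: cutoff_exists => // x /csqE[h1 h2]; apply/ballD/rb/osqE.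
  by rewrite /q in h1 h2; split; lra.
have [M1 M10 HM1] := test_function_bounded tchi.
have [M2 M20 HM2] := test_function_grad_bounded tchi.
have [rho rho0 Drho] := bounded_csq bD.
(* the second centre is then to the left of D, at distance at least q *)
pose T := 2 * rho + q; have T0 : 0 < T by rewrite /T; lra.
pose z' := z - (T, 0).
have far x : D x -> ~ osq z' q x.
  move=> /Drho /csqE[+ _] /osqE[+ _].
  have /Drho/csqE[+ _] := ballD zball.
  by rewrite /z' /= !ler_norml ltr_norml /T; lra.
pose E : set plane := (D : set plane) `\` (osq z q : set plane).
have oQ : open (osq z q) by exact: open_osq.
have mE : measurable E by apply: measurableD => //; exact: open_measurable2.
pose Gf e x := wgrad setT (K (delta_mx k 0)) (blow z' e x).
pose V e := dipole (K (delta_mx k 0)) z T e.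
have loE : lo 1 (fun e => vn leb2 E (Gn k e)).
  apply: lo_sqr => [e|eta eta0]; first exact: vn_ge0.
  have [e1 e10 H] := corrector_decay BK q0 eta0.
  apply: (near0 e10) => e e0 ee; apply: H => // x []; exact.
have loD' : lo 1 (fun e => vn leb2 D (Gf e)).
  apply: lo_sqr => [e|eta eta0]; first exact: vn_ge0.
  have [e1 e10 H] := corrector_decay BK q0 eta0.
  by apply: (near0 e10) => e e0 ee; exact: H.
have loV : lo 1 (fun e => l2n leb2 D (V e)).
  apply: lo_sqr => [e|eta eta0]; first exact: l2n_ge0.
  have [e1 e10 H] := dipole_small BK T0 eta0.
  apply: (near0 e10) => e e0 ee; have [h1 h2] := H e z e0 ee.
  by apply: le_trans h2; rewrite ler_sqr ?nnegrE ?l2n_ge0// le_l2nS.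
have [e1 e10 HV] := dipole_small BK T0 ltr01.
pose kap := alpha * (lout - lin).
have kap0 : 0 < kap by rewrite mulr_gt0 ?subr_gt0.
pose A e := \int[leb2]_(x in S e) dotv (delta_mx k 0) (dg e x).
pose B e := \int[leb2]_(x in S e) dotv (g x) (Gn k e x).
have -> : (fun e => A e - B e) = (fun e => kap^-1 * (kap * A e - kap * B e)).
  by apply/funext => e; rewrite -mulrBr mulKf// gt_eqF.
apply: loZ; apply: (@le_lo R 2 _ (fun e =>
  alpha * lout * (2 * (M1 + M2) + 1) *
    (vn leb2 E (Gn k e) * (vn leb2 D (dg e) + l2n leb2 D (du e))) +
  alpha * lout * (vn leb2 D (Gf e) * vn leb2 D (dg e)) +
  l2n leb2 D (V e) * l2n leb2 D (du e) +
  kap * (vn leb2 D (Gf e) * vn leb2 (S e) g))).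
  apply: loD; last exact/loZ/(loM loD' bO_gS).
  apply: loD; last exact: (loM loV bO_du).
  apply: loD; last exact/loZ/(loM loD' bO_dg).
  exact/loZ/(loM loE (bOD bO_dg bO_du)).
near=> e; have e0 : 0 < e by near: e.
have SD : S e `<=` D by near: e.
have Sq : S e `<=` osq z q by near: e; exact: S_small.
have SO : Omega `&` S e = set0 by near: e.
have ee1 : e < e1 by near: e; exact: nbhs_right_lt.
have [sV _] := HV e z e0 ee1.
have sn := vsqint_blow BK z e0; have sf' := vsqint_blow BK z' e0.
have wV := is_wgradS oD (subsetT _) (is_wgrad_dipole BK z T e0).
have mS := measurable_S e0.
have corr v h : sqint leb2 setT v -> is_wgrad setT v h ->
    vsqint leb2 setT h ->
    \int[leb2]_x (alpha * lam lin lout (S e) x * dotv (Gn k e x) (h x)) =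
    kap * \int[leb2]_(x in S e) dotv (delta_mx k 0) (h x).
  by move=> sv wv sh; apply: (corrector_scaled z alpha0 lin0 lin_lout fom (hK _) e0 oomega sv wv sh).
have QO : osq z q `&` Omega = set0.
  apply/seteqP; split => // x [/osqE[h1 h2] Ox]; rewrite -rO; split => //; apply/osqE.
  by rewrite /q in h1 h2; split; lra.
have := corrector_comparison oD alpha0 lin0 lin_lout (open_measurable2 oOmega) mS SO SD
  stu (state_S e0 SD) oQ QO Sq tchi chi1 (addr_ge0 M10 M20) _ _ sn sf' corr
  (sqintS measurableT mD (subsetT _) sV) wV.
rewrite -/kap => H; apply: le_trans (H _ _) _.
- by move=> x; apply: le_trans (HM1 x) _; rewrite lerDl.
- by move=> x; apply: le_trans (HM2 x) _; rewrite lerDr.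
have SDn : vn leb2 (S e) (Gf e) <= vn leb2 D (Gf e).
  by apply: le_vnS => //; exact: (vsqintS measurableT mD (subsetT _) sf').
rewrite [in leRHS](mulrC (vn leb2 D (Gf e)) (vn leb2 D (dg e))).
rewrite [in leRHS](mulrC (l2n leb2 D (V e))) [in leRHS](mulrC (vn leb2 D (Gf e))).
rewrite lerD2l; apply: ler_wpM2l; first exact: ltW.
by apply: ler_wpM2l SDn; exact: vn_ge0.
Unshelve. all: by end_near. Qed.

Let lo_cs (h1 h2 : R -> R * R -> 'cV[R]_2) :
  lo 1 (fun e => vn leb2 (S e) (h1 e)) ->
  bO 1 (fun e => vn leb2 (S e) (h2 e)) ->
  (\forall e \near (0 : R)^'+, vsqint leb2 (S e) (h1 e)) ->
  (\forall e \near (0 : R)^'+, vsqint leb2 (S e) (h2 e)) ->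
  lo 2 (fun e => \int[leb2]_(x in S e) dotv (h1 e x) (h2 e x)).
Proof.
move=> l1 b2 s1 s2; apply: (@le_lo R 2 _ (fun e => vn leb2 (S e) (h1 e) *
  vn leb2 (S e) (h2 e))); first exact: (loM l1 b2).
near=> e; apply: vcauchy_schwarz1; [|by near: e..].
by apply: measurable_S; near: e.
Unshelve. all: by end_near. Qed.

Let near_sg : \forall e \near (0 : R)^'+, vsqint leb2 (S e) g.
Proof.
near=> e; have e0 : 0 < e by near: e.
have SD : S e `<=` D by near: e.
exact: (vsqintS mD (measurable_S e0) SD sg).
Unshelve. all: by end_near. Qed.

Let near_sdg : \forall e \near (0 : R)^'+, vsqint leb2 D (dg e).
Proof.
near=> e; have e0 : 0 < e by near: e.
have SD : S e `<=` D by near: e.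
by apply: vsqintB => //; have [_ _] := H1_elim oD (state_S e0 SD).1.
Unshelve. all: by end_near. Qed.

Let near_sc c : \forall e \near (0 : R)^'+, vsqint leb2 (S e) (fun=> c).
Proof. by apply: filterS near_pos => e; exact: sc. Qed.

Let near_sgc : \forall e \near (0 : R)^'+, vsqint leb2 (S e) (fun x => g x - zeta).
Proof.
near=> e; have e0 : 0 < e by near: e.
by apply: (vsqintB (measurable_S e0)); near: e.
Unshelve. all: by end_near. Qed.

Let near_sG k : \forall e \near (0 : R)^'+, vsqint leb2 (S e) (Gn k e).
Proof.
near=> e; have e0 : 0 < e by near: e.
have [BK _] := hK (delta_mx k 0).
exact: (vsqintS measurableT (measurable_S e0) (subsetT _) (vsqint_blow BK z e0)).
Unshelve. all: by end_near. Qed.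

Let near_sdgS : \forall e \near (0 : R)^'+, vsqint leb2 (S e) (dg e).
Proof.
near=> e; have e0 : 0 < e by near: e.
have SD : S e `<=` D by near: e.
by apply: (vsqintS mD (measurable_S e0) SD); near: e.
Unshelve. all: by end_near. Qed.

Let bO_G k : bO 1 (fun e => vn leb2 (S e) (Gn k e)).
Proof.
have [BK _] := hK (delta_mx k 0); have [_ _ sGk] := BL_elim BK.
pose Gk := wgrad setT (K (delta_mx k 0)).
(* a square of negative radius is empty, so this is the integral over the plane *)
pose m := \int[leb2]_(x in ~` (csq 0 (-1) : set plane)) dotv (Gk x) (Gk x).
have m0 : 0 <= m by apply: Rintegral_ge0 => x _; exact: dotvv_ge0.
exists (Num.sqrt m); first exact: sqrtr_ge0.
near=> e; have e0 : 0 < e by near: e.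
rewrite expr1 ger0_norm ?vn_ge0//.
rewrite -ler_sqr ?nnegrE ?mulr_ge0 ?sqrtr_ge0 ?vn_ge0 ?(ltW e0)// exprMn (sqr_sqrtr m0).
have e0' : 0 < e^-1 by rewrite invr_gt0.
have [|_ H] := @vn_affine_far _ (- (e^-1 *: z)) e^-1 Gk (S e) (-1) e0' (measurable_S e0) sGk.
  by move=> x _ /csqE[+ _]; move=> /(le_trans (normr_ge0 _)); rewrite ler0N1.
by move: H; rewrite exprVn invrK mulrC.
Unshelve. all: by end_near. Qed.

Let bO_c c : bO 1 (fun e => vn leb2 (S e) (fun=> c)).
Proof.
exists (vnorm c * Num.sqrt vol); first by rewrite mulr_ge0 ?sqrtr_ge0.
near=> e; have e0 : 0 < e by near: e.
rewrite ger0_norm ?vn_ge0// expr1 -mulrA (mulrC _ e).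
have -> : e * Num.sqrt vol = Num.sqrt (fine (leb2 (S e : set plane))).
  by rewrite leb_S//= sqrtrM ?sqr_ge0// sqrtr_sqr gtr0_norm.
apply: vn_ae_le; [exact: measurable_S|exact: fin_S|exact: sc|exact: sqrtr_ge0|].
exact/aeW.
Unshelve. all: by end_near. Qed.

Let scaled_polarization k e : 0 < e ->
  \int[leb2]_(x in S e) dotv zeta (Gn k e x) =
  e ^+ 2 * \int[leb2]_(x in omega) dotv zeta (wgrad setT (K (delta_mx k 0)) x).
Proof.
move=> e0; have [BK _] := hK (delta_mx k 0); have [_ _ sGk] := BL_elim BK.
have mS := measurable_S e0.
have sGS := vsqintS measurableT mS (subsetT _) (vsqint_blow BK z e0).
pose q x := \1_(S e : set plane) x * dotv zeta (Gn k e x).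
have -> : \int[leb2]_(x in S e) dotv zeta (Gn k e x) = \int[leb2]_x q x.
  rewrite [LHS]Rintegral_mkcond; apply: eq_Rintegral => x _.
  by rewrite patchE /q indicE; case: ifP; rewrite ?mul1r ?mul0r.
have iq : leb2.-integrable (setT : set plane) (EFin \o q).
  apply: (integrable_supp measurableT mS) => //.
    by move=> x _ nS; rewrite /q indicE memNset// mul0r.
  apply: (@integrable_bounded_mul _ _ _ _ _ _ _ 1) => //.
  - by move=> x _; rewrite indicE; case: (x \in _); rewrite ?normr1 ?normr0.
  - exact: (integrable_dotv_fin _ mS (fin_S e0) sGS).
rewrite (Rintegral_affine z e0 iq); congr (_ * _).
rewrite [RHS]Rintegral_mkcond; apply: eq_Rintegral => x _.
rewrite patchE /q indicE inclusion_affine// /Gn /blow affineK//.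
by case: ifP; rewrite ?mul1r ?mul0r.
Qed.

Let pol k := \int[leb2]_(x in omega) dotv zeta (wgrad setT (K (delta_mx k 0)) x).

(** Write g = zeta + (g - zeta) on the inclusion. The part g - zeta is o(e) in
    norm and only yields terms o(e^2). The part of g . grad u_S with zeta against the
    difference of the states is a combination of the two integrals treated in
    lo_comparison, which become e^2 times the integral of the corrector over omega. *)
Let lo_cost : lo 2 (fun e => \int[leb2]_(x in S e) dotv (g x) (wgrad D (uS e) x) -
  e ^+ 2 * (vol * dotv zeta zeta + (zeta 0 0 * pol 0 + zeta 1 0 * pol 1))).
Proof.
pose I e (h1 h2 : R * R -> 'cV[R]_2) := \int[leb2]_(x in S e) dotv (h1 x) (h2 x).
pose cmp k e := I e (fun=> delta_mx k 0) (dg e) - I e g (Gn k e).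
pose gz x := g x - zeta.
have L1 : lo 2 (fun e => I e gz g) by apply: lo_cs => //; exact: bO_gS.
have L2 : lo 2 (fun e => I e gz (fun=> zeta)) by apply: lo_cs => //; exact: bO_c.
have bO_dgS : bO 1 (fun e => vn leb2 (S e) (dg e)).
  apply: (le_bO bO_dg); near=> e; have e0 : 0 < e by near: e.
  have SD : S e `<=` D by near: e.
  rewrite ger0_norm ?vn_ge0//; apply: le_vnS => //; first exact: measurable_S.
  by near: e.
have L3 : lo 2 (fun e => I e gz (dg e)) by apply: lo_cs.
have L4 k : lo 2 (fun e => I e gz (Gn k e)) by apply: lo_cs.
have := loD (loD (loD L1 L2) L3) (loD (loZ (zeta 0 0) (loD (lo_comparison 0) (L4 0)))
  (loZ (zeta 1 0) (loD (lo_comparison 1) (L4 1)))).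
move=> H tau tau0; near=> e; have e0 : 0 < e by near: e.
have mS := measurable_S e0.
have si : vsqint leb2 (S e) g by near: e.
have sdi : vsqint leb2 (S e) (dg e) by near: e.
have sGi k : vsqint leb2 (S e) (Gn k e).
  have [BK _] := hK (delta_mx k 0).
  exact: (vsqintS measurableT mS (subsetT _) (vsqint_blow BK z e0)).
have IB h1 h2 h3 : vsqint leb2 (S e) h1 -> vsqint leb2 (S e) h2 ->
    vsqint leb2 (S e) h3 ->
    I e (fun x => h1 x - h2 x) h3 = I e h1 h3 - I e h2 h3.
  move=> s1 s2 s3; rewrite /I -RintegralB//; try exact: integrable_dotv.
  by apply: eq_Rintegral => x _; rewrite dotvBl.
have IC h1 h2 : I e h1 h2 = I e h2 h1 by apply: eq_Rintegral => x _; rewrite dotvC.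
have sz := sc zeta e0.
have E1 : I e gz g = I e g g - I e (fun=> zeta) g by exact: IB.
have E2 : I e gz (fun=> zeta) = I e g (fun=> zeta) - e ^+ 2 * vol * dotv zeta zeta.
  by rewrite [LHS]IB// /I Rintegral_cst// leb_S//= mulrC.
have E3 : I e gz (dg e) = I e g (dg e) - I e (fun=> zeta) (dg e) by exact: IB.
have E4 k : I e gz (Gn k e) = I e g (Gn k e) - e ^+ 2 * pol k.
  by rewrite [LHS]IB// -scaled_polarization.
have E5 : \int[leb2]_(x in S e) dotv (g x) (wgrad D (uS e) x) =
    I e g g + I e g (dg e).
  rewrite /I -RintegralD//; try exact: integrable_dotv.
  by apply: eq_Rintegral => x _; rewrite -dotvDr /dg addrC subrK.
have E6 : I e (fun=> zeta) (dg e) = zeta 0 0 * I e (fun=> delta_mx 0 0) (dg e) +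
    zeta 1 0 * I e (fun=> delta_mx 1 0) (dg e).
  have i k : leb2.-integrable (S e : set plane)
      (EFin \o (fun x => dotv (delta_mx k 0) (dg e x))).
    by apply: integrable_dotv => //; exact: sc.
  rewrite /I -!RintegralZl// -RintegralD//; try exact: integrableZR.
  by apply: eq_Rintegral => x _; rewrite !dotvE !mxE /=; ring.
have -> : \int[leb2]_(x in S e) dotv (g x) (wgrad D (uS e) x) -
    e ^+ 2 * (vol * dotv zeta zeta + (zeta 0 0 * pol 0 + zeta 1 0 * pol 1)) =
  I e gz g + I e gz (fun=> zeta) + I e gz (dg e) +
   (zeta 0 0 * (I e (fun=> delta_mx 0 0) (dg e) - I e g (Gn 0 e) + I e gz (Gn 0 e)) +
    zeta 1 0 * (I e (fun=> delta_mx 1 0) (dg e) - I e g (Gn 1 e) + I e gz (Gn 1 e))).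
  have alg (a b v w m d0 d1 g0 g1 p0 p1 z0 z1 t : R) :
      a + m - t * (v * w + (z0 * p0 + z1 * p1)) =
      (a - b) + (b - t * v * w) + (m - (z0 * d0 + z1 * d1)) +
      (z0 * (d0 - g0 + (g0 - t * p0)) + z1 * (d1 - g1 + (g1 - t * p1))) by ring.
  by rewrite E1 E2 E3 !E4 E5 E6 (IC (fun=> zeta) g); exact: alg.
by near: e; exact: H.
Unshelve. all: by end_near. Qed.

(** The matrix expression is the quadratic form found in lo_cost, divided by the
    area of omega. *)
Lemma topological_derivative_cost : is_topological_derivative
  (fun A => cost D f alpha lin lout (u A) A) Omega z omega
  (alpha / 2 * (lin - lout)
   * ((grad u0 z)^T *m (1%:M + polarization omega K) *m grad u0 z) 0 0).
Proof.
have -> : ((grad u0 z)^T *m (1%:M + polarization omega K) *m grad u0 z) 0 0 =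
    dotv zeta zeta + vol^-1 * (zeta 0 0 * pol 0 + zeta 1 0 * pol 1).
  pose m i k := \int[leb2]_(x in omega) (wgrad setT (K (delta_mx k 0)) x i 0).
  have polE k : pol k = zeta 0 0 * m 0 k + zeta 1 0 * m 1 k.
    have [BK _] := hK (delta_mx k 0); have [_ _ sGk] := BL_elim BK.
    have im i : leb2.-integrable (omega : set plane)
        (EFin \o (fun x => wgrad setT (K (delta_mx k 0)) x i 0)).
      apply: sqint_integrable_fin => //.
      exact: (sqintS measurableT mom (subsetT _) (sGk i)).
    rewrite /pol /m -!RintegralZl// -RintegralD//; try exact: integrableZR.
    by apply: eq_Rintegral => x _; rewrite dotvE.
  have PE i k : polarization omega K i k = vol^-1 * m i k by rewrite mxE.
  have qf (P : 'M[R]_2) (v : 'cV[R]_2) : (v^T *m (1%:M + P) *m v) 0 0 =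
      dotv v v + (v 0 0 * (v 0 0 * P 0 0 + v 1 0 * P 1 0) +
                  v 1 0 * (v 0 0 * P 0 1 + v 1 0 * P 1 1)).
    have two (h : 'I_2 -> R) : \sum_i h i = h 0 + h 1.
      by rewrite big_ord_recl big_ord1; congr (_ + h _); exact: val_inj.
    rewrite mulmxDr mulmx1 mulmxDl mxE -/(dotv v v); congr (_ + _).
    by rewrite mxE two !mxE !two !mxE; ring.
  rewrite qf -/zeta !PE !polE; congr (_ + _).
  move: (zeta 0 0) (zeta 1 0) (m 0 0) (m 0 1) (m 1 0) (m 1 1) vol^-1 => *; ring.
pose c := alpha / 2 * (lin - lout).
pose J e := \int[leb2]_(x in S e) dotv (g x) (wgrad D (uS e) x).
have lim : c * (J e / (e ^+ 2 * vol)) @[e --> (0 : R)^'+] -->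
    c * (dotv zeta zeta + vol^-1 * (zeta 0 0 * pol 0 + zeta 1 0 * pol 1)).
  apply: cvgM; first exact: cvg_cst.
  apply: lo_cvg => //; have := lo_cost; congr lo; apply/funext => e; congr (_ - _).
  by rewrite -[RHS]mulrA [in RHS](mulrDr vol) mulVKf// gt_eqF.
rewrite /is_topological_derivative; apply: cvg_trans lim; apply: near_eq_cvg.
near=> e; have e0 : 0 < e by near: e.
have SD : S e `<=` D by near: e.
have SO : Omega `&` S e = set0 by near: e.
rewrite (cost_difference oD alpha0 lin0 lin_lout sf (open_measurable2 oOmega) (measurable_S e0)
  SO SD stu (state_S e0 SD)) -/c leb_S//= mulrA //.
Unshelve. all: by end_near. Qed.

End TopologicalDerivative.

Theorem theorem3p9 (R : realType) (D : set (R * R)) (f : R * R -> R)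
  (alpha lin lout : R) (Omega : set (R * R))
  (u : set (R * R) -> R * R -> R)
  (z : R * R) (omega : set (R * R)) (delta : R) (u0 : R * R -> R)
  (K : 'cV[R]_2 -> R * R -> R)
  (hD : bounded_lipschitz_domain D)
  (hf : Lp_on +oo%E D f)
  (halpha : 0 < alpha) (hlin : 0 < lin) (hlinout : lin < lout)
  (hOmega : open Omega) (hOmegaD : Omega `<=` D)
  (hu : forall A : set (R * R), open A -> A `<=` D ->
     is_state D f alpha lin lout A (u A))
  (hzD : D z) (hzOmega : ~ closure Omega z)
  (homega : open omega) (homegab : bounded_set omega) (homega0 : omega 0)
  (hdelta : 0 < delta) (hball : eball z delta `<=` D)
  (hu0 : Ck_on 2 (eball z delta) u0)
  (huu0 : {ae leb2, forall x, eball z delta x -> u Omega x = u0 x})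
  (hK : forall eta : 'cV[R]_2, is_corrector alpha lin lout omega eta (K eta)) :
  is_topological_derivative
    (fun A => cost D f alpha lin lout (u A) A) Omega z omega
    (alpha / 2 * (lin - lout)
     * ((grad u0 z)^T *m (1%:M + polarization omega K) *m grad u0 z) 0 0).
Proof.
by case: hD => oD _ bD _; exact: (topological_derivative_cost (delta := delta) oD bD).
Qed.
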